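(* Let $K$ be a field and let $n$ be a positive integer. Let $E_n$ be the directed graph with three vertices $u_1,u_2,u_3$, with exactly one edge from $u_i$ to $u_k$ for each ordered pair of distinct $i,k\in\{1,2,3\}$, and with exactly $2$ loops at $u_1$, $2+d(n)$ loops at $u_2$, and $2+\frac{H_2(n)}{d(n)}$ loops at $u_3$. Then $L_K(C_n^2)$ is isomorphic to $L_K(E_n)$ as $K$-algebras. Furthermore, when $K_0(L_K(C_n^2))$ is not cyclic, this realization is minimal in the sense that it is not possible to realize $L_K(C_n^2)$ up to isomorphism as the Leavitt path algebra of a graph having fewer than three vertices.
   Context: For a directed graph $E=(E^0,E^1,r,s)$ and a field $K$, the Leavitt path algebra $L_K(E)$ is the $K$-algebra generated by $\{v\mid v\in E^0\}\cup\{e,e^*\mid e\in E^1\}$ subject to: (V) $vw=\delta_{v,w}v$ for $v,w\in E^0$; (E1) $s(e)e=er(e)=e$; (E2) $r(e)e^*=e^*s(e)=e^*$; (CK1) $e^*e'=\delta_{e,e'}r(e)$ for $e,e'\in E^1$; (CK2) $v=\sum_{\{e\in E^1\mid s(e)=v\}}ee^*$ for every $v\in E^0$ with $0<|s^{-1}(v)|<\infty$. $K_0$ denotes the Grothendieck group of a ring. $C_n^2$ is the directed graph with $n$ vertices $v_1,\dots,v_n$ and $2n$ edges $e_1,\dots,e_n,f_1,\dots,f_n$, where $e_i$ goes from $v_i$ to $v_{i+1}$ and $f_i$ goes from $v_i$ to $v_{i+2}$ (subscripts mod $n$). Its incidence matrix $A_{C_n^2}$ is the $n\times n$ matrix whose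 $(i,k)$ entry is the number of edges from $v_i$ to $v_k$, and $H_2(n)=|\det(I_n-A_{C_n^2}^t)|$ (equivalently $H_2(1)=H_2(2)=1$ and $H_2(n)=H_2(n-1)+H_2(n-2)+1-(-1)^n$ for $n\geq 3$). $F$ is the Fibonacci sequence: $F(0)=0$, $F(1)=F(2)=1$, $F(n)=F(n-1)+F(n-2)$. For $n\geq 1$, $d(n)=\gcd(F(n),F(n-1)-1)$; $H_2(n)/d(n)$ is an integer. *)

(* Defs.v *)
From Stdlib Require List.
From HB Require Import structures.
From mathcomp Require Import all_boot all_order all_algebra.
From mathcomp Require Import all_classical.

Set Implicit Arguments.
Unset Strict Implicit.
Unset Printing Implicit Defensive.

Import GRing.Theory.
Local Open Scope ring_scope.
Local Open Scope quotient_scope.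

Record graph (V Ed : Type) := Graph { src : Ed -> V; rng : Ed -> V }.

Definition incidence_mx (n : nat) (Ed : finType) (G : graph 'I_n Ed) : 'M[int]_n :=
  \matrix_(i, k) #|[set e | (src G e == i) && (rng G e == k)]|%:Z.

Definition mult_graph (V : Type) (m : V -> V -> nat) :
    graph V {p : V * V & 'I_(m p.1 p.2)} :=
  Graph (fun e => (tag e).1) (fun e => (tag e).2).

(* L_K(G) is built as a presented associative, not necessarily unital,
   K-algebra: formal algebra expressions in the generators v, e, e^*, modulo
   the least congruence containing the K-algebra axioms and the Leavitt
   relations. No graph-finiteness assumption is made: V and Ed are arbitrary. *)

Inductive lpa_term (K V Ed : Type) :=
  | LVertex of V
  | LEdge of Ed
  | LGhost of Ed
  | LZero
  | LAdd of lpa_term K V Ed & lpa_term K V Ed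
  | LOpp of lpa_term K V Ed
  | LScale of K & lpa_term K V Ed
  | LMul of lpa_term K V Ed & lpa_term K V Ed.

Arguments LVertex {K V Ed} _.
Arguments LEdge {K V Ed} _.
Arguments LGhost {K V Ed} _.
Arguments LZero {K V Ed}.

Section LeavittPathAlgebra.
Variables (K : fieldType) (V Ed : Type) (G : graph V Ed).
Local Notation term := (lpa_term K V Ed).
Local Notation "x +' y" := (LAdd x y) (at level 50, left associativity).
Local Notation "x *' y" := (LMul x y) (at level 40, left associativity).

Inductive lpa_eqv : term -> term -> Prop :=
  | lpa_refl x : lpa_eqv x x
  | lpa_sym x y : lpa_eqv x y -> lpa_eqv y x
  | lpa_trans x y z : lpa_eqv x y -> lpa_eqv y z -> lpa_eqv x z
  | lpa_congD x x' y y' :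
      lpa_eqv x x' -> lpa_eqv y y' -> lpa_eqv (x +' y) (x' +' y')
  | lpa_congN x x' : lpa_eqv x x' -> lpa_eqv (LOpp x) (LOpp x')
  | lpa_congZ a x x' : lpa_eqv x x' -> lpa_eqv (LScale a x) (LScale a x')
  | lpa_congM x x' y y' :
      lpa_eqv x x' -> lpa_eqv y y' -> lpa_eqv (x *' y) (x' *' y')
  | lpa_addA x y z : lpa_eqv (x +' (y +' z)) (x +' y +' z)
  | lpa_addC x y : lpa_eqv (x +' y) (y +' x)
  | lpa_add0 x : lpa_eqv (LZero +' x) x
  | lpa_addN x : lpa_eqv (LOpp x +' x) LZero
  | lpa_scaleA a b x : lpa_eqv (LScale a (LScale b x)) (LScale (a * b) x)
  | lpa_scale1 x : lpa_eqv (LScale 1 x) x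
  | lpa_scaleDr a x y : lpa_eqv (LScale a (x +' y)) (LScale a x +' LScale a y)
  | lpa_scaleDl a b x : lpa_eqv (LScale (a + b) x) (LScale a x +' LScale b x)
  | lpa_mulA x y z : lpa_eqv (x *' (y *' z)) (x *' y *' z)
  | lpa_mulDl x y z : lpa_eqv ((x +' y) *' z) (x *' z +' y *' z)
  | lpa_mulDr x y z : lpa_eqv (x *' (y +' z)) (x *' y +' x *' z)
  | lpa_scaleAl a x y : lpa_eqv (LScale a (x *' y)) (LScale a x *' y)
  | lpa_scaleAr a x y : lpa_eqv (LScale a (x *' y)) (x *' LScale a y)
  (* (V) *)
  | lpa_Veq v : lpa_eqv (LVertex v *' LVertex v) (LVertex v)
  | lpa_Vneq v w : v <> w -> lpa_eqv (LVertex v *' LVertex w) LZero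
  (* (E1) *)
  | lpa_E1s e : lpa_eqv (LVertex (src G e) *' LEdge e) (LEdge e)
  | lpa_E1r e : lpa_eqv (LEdge e *' LVertex (rng G e)) (LEdge e)
  (* (E2) *)
  | lpa_E2r e : lpa_eqv (LVertex (rng G e) *' LGhost e) (LGhost e)
  | lpa_E2s e : lpa_eqv (LGhost e *' LVertex (src G e)) (LGhost e)
  (* (CK1) *)
  | lpa_CK1eq e : lpa_eqv (LGhost e *' LEdge e) (LVertex (rng G e))
  | lpa_CK1neq e e' : e <> e' -> lpa_eqv (LGhost e *' LEdge e') LZero
  (* (CK2): the hypotheses say that es enumerates the nonempty finite set
     of edges with source v, without repetition. *)
  | lpa_CK2 v (es : seq Ed) :
      es <> [::] -> List.NoDup es -> (forall e, List.In e es <-> src G e = v) ->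
      lpa_eqv (LVertex v)
        (foldr (fun e x => (LEdge e *' LGhost e) +' x) LZero es).

HB.instance Definition _ := gen_eqMixin term.
HB.instance Definition _ := gen_choiceMixin term.

Definition lpa_eqvb : rel term := fun x y => `[< lpa_eqv x y >].

Lemma lpa_eqvb_refl : reflexive lpa_eqvb.
Proof. by move=> x; apply/asboolP/lpa_refl. Qed.

Lemma lpa_eqvb_sym : symmetric lpa_eqvb.
Proof. by move=> x y; apply/asboolP/asboolP; apply: lpa_sym. Qed.

Lemma lpa_eqvb_trans : transitive lpa_eqvb.
Proof.
move=> y x z /asboolP xy /asboolP yz; apply/asboolP; exact: lpa_trans xy yz.
Qed.

Canonical lpa_equiv := EquivRel lpa_eqvb lpa_eqvb_refl lpa_eqvb_sym lpa_eqvb_trans.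

Definition lpa := {eq_quot lpa_equiv}.

HB.instance Definition _ := Choice.on lpa.

Definition lpa_pi (x : term) : lpa := \pi_({eq_quot lpa_equiv}) x.
Definition lpa_repr (x : lpa) : term := repr (x : {eq_quot lpa_equiv}).

Lemma lpa_piP x y : lpa_pi x = lpa_pi y <-> lpa_eqv x y.
Proof.
split=> [/(@eqquotP _ lpa_equiv {eq_quot lpa_equiv})/asboolP//|xy].
by apply/(@eqquotP _ lpa_equiv {eq_quot lpa_equiv})/asboolP.
Qed.

Lemma lpa_reprK : cancel lpa_repr lpa_pi.
Proof. exact: reprK. Qed.

Lemma lpa_pi_repr x : lpa_eqv (lpa_repr (lpa_pi x)) x.
Proof. by apply/lpa_piP; rewrite lpa_reprK. Qed.

Lemma lpaW (P : lpa -> Prop) : (forall x, P (lpa_pi x)) -> forall x, P x.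
Proof. by move=> Px x; rewrite -[x]lpa_reprK. Qed.

Definition lpa_zero := lpa_pi LZero.
Definition lpa_add (x y : lpa) := lpa_pi (lpa_repr x +' lpa_repr y).
Definition lpa_opp (x : lpa) := lpa_pi (LOpp (lpa_repr x)).
Definition lpa_scale (a : K) (x : lpa) := lpa_pi (LScale a (lpa_repr x)).
Definition lpa_mul (x y : lpa) := lpa_pi (lpa_repr x *' lpa_repr y).

Lemma lpa_piD x y : lpa_add (lpa_pi x) (lpa_pi y) = lpa_pi (x +' y).
Proof. by apply/lpa_piP; apply: lpa_congD; apply: lpa_pi_repr. Qed.
Lemma lpa_piN x : lpa_opp (lpa_pi x) = lpa_pi (LOpp x).
Proof. by apply/lpa_piP; apply: lpa_congN; apply: lpa_pi_repr. Qed.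
Lemma lpa_piZ a x : lpa_scale a (lpa_pi x) = lpa_pi (LScale a x).
Proof. by apply/lpa_piP; apply: lpa_congZ; apply: lpa_pi_repr. Qed.
Lemma lpa_piM x y : lpa_mul (lpa_pi x) (lpa_pi y) = lpa_pi (x *' y).
Proof. by apply/lpa_piP; apply: lpa_congM; apply: lpa_pi_repr. Qed.

Let piE := (lpa_piD, lpa_piN, lpa_piZ, lpa_piM).

Fact lpa_addrA : associative lpa_add.
Proof.
elim/lpaW=> x; elim/lpaW=> y; elim/lpaW=> z.
by rewrite !piE; apply/lpa_piP/lpa_addA.
Qed.
Fact lpa_addrC : commutative lpa_add.
Proof. by elim/lpaW=> x; elim/lpaW=> y; rewrite !piE; apply/lpa_piP/lpa_addC. Qed.
Fact lpa_add0r : left_id lpa_zero lpa_add.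
Proof. by elim/lpaW=> x; rewrite !piE; apply/lpa_piP/lpa_add0. Qed.
Fact lpa_addNr : left_inverse lpa_zero lpa_opp lpa_add.
Proof. by elim/lpaW=> x; rewrite !piE; apply/lpa_piP/lpa_addN. Qed.

HB.instance Definition _ :=
  GRing.isZmodule.Build lpa lpa_addrA lpa_addrC lpa_add0r lpa_addNr.

Fact lpa_scalerA a b x : lpa_scale a (lpa_scale b x) = lpa_scale (a * b) x.
Proof. by elim/lpaW: x => x; rewrite !piE; apply/lpa_piP/lpa_scaleA. Qed.
Fact lpa_scale1r : left_id 1 lpa_scale.
Proof. by elim/lpaW=> x; rewrite !piE; apply/lpa_piP/lpa_scale1. Qed.
Fact lpa_scalerDr : right_distributive lpa_scale +%R.
Proof.
by move=> a; elim/lpaW=> x; elim/lpaW=> y; rewrite /+%R/= !piE; apply/lpa_piP/lpa_scaleDr.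
Qed.
Fact lpa_scalerDl x : {morph lpa_scale^~ x : a b / a + b}.
Proof.
by elim/lpaW: x => x a b; rewrite [RHS]/+%R/= !piE; apply/lpa_piP/lpa_scaleDl.
Qed.

HB.instance Definition _ := GRing.Zmodule_isLmodule.Build K lpa
  lpa_scalerA lpa_scale1r lpa_scalerDr lpa_scalerDl.

Fact lpa_mulrA : associative lpa_mul.
Proof.
elim/lpaW=> x; elim/lpaW=> y; elim/lpaW=> z.
by rewrite !piE; apply/lpa_piP/lpa_mulA.
Qed.
Fact lpa_mulrDl : left_distributive lpa_mul +%R.
Proof.
elim/lpaW=> x; elim/lpaW=> y; elim/lpaW=> z.
by rewrite /+%R/= !piE; apply/lpa_piP/lpa_mulDl.
Qed.
Fact lpa_mulrDr : right_distributive lpa_mul +%R.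
Proof.
elim/lpaW=> x; elim/lpaW=> y; elim/lpaW=> z.
by rewrite /+%R/= !piE; apply/lpa_piP/lpa_mulDr.
Qed.
Let scaleE a (x : lpa) : a *: x = lpa_scale a x. Proof. by []. Qed.

Fact lpa_mulZl a x y : a *: lpa_mul x y = lpa_mul (a *: x) y.
Proof.
elim/lpaW: x => x; elim/lpaW: y => y.
by rewrite !scaleE !piE; apply/lpa_piP/lpa_scaleAl.
Qed.
Fact lpa_mulZr a x y : a *: lpa_mul x y = lpa_mul x (a *: y).
Proof.
elim/lpaW: x => x; elim/lpaW: y => y.
by rewrite !scaleE !piE; apply/lpa_piP/lpa_scaleAr.
Qed.

Definition lpa_vertex (v : V) := lpa_pi (LVertex v).
Definition lpa_edge (e : Ed) := lpa_pi (LEdge e).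
Definition lpa_ghost (e : Ed) := lpa_pi (LGhost e).

End LeavittPathAlgebra.

(* No condition on units: L_K(G) need not be unital, and between unital algebras
   a bijective multiplicative map preserves 1 automatically. *)
Definition lpa_iso (K : fieldType) (V V' Ed Ed' : Type)
    (G : graph V Ed) (H : graph V' Ed') : Prop :=
  exists f : {linear lpa K G -> lpa K H},
    bijective f /\ forall x y, f (lpa_mul x y) = lpa_mul (f x) (f y).

(* When the vertex set is finite, L_K(G) is unital with 1 = \sum_v v. It is
   only a pzRingType: it is the zero ring when there are no vertices. *)
Section UnitalLeavittPathAlgebra.
Variables (K : fieldType) (V : finType) (Ed : Type) (G : graph V Ed).

Definition lpa_one : lpa K G := \sum_(v : V) lpa_vertex K G v.

Let mul0x x : lpa_mul 0 x = 0 :> lpa K G.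
Proof. by apply: (addrI (lpa_mul 0 x)); rewrite -lpa_mulrDl !addr0. Qed.

Let mulx0 x : lpa_mul x 0 = 0 :> lpa K G.
Proof. by apply: (addrI (lpa_mul x 0)); rewrite -lpa_mulrDr !addr0. Qed.

Let mul_suml (I : Type) (r : seq I) (F : I -> lpa K G) x :
  lpa_mul (\sum_(i <- r) F i) x = \sum_(i <- r) lpa_mul (F i) x.
Proof.
apply: (big_morph (fun y => lpa_mul y x)) => [y z|]; first exact: lpa_mulrDl.
exact: mul0x.
Qed.

Let mul_sumr (I : Type) (r : seq I) (F : I -> lpa K G) x :
  lpa_mul x (\sum_(i <- r) F i) = \sum_(i <- r) lpa_mul x (F i).
Proof.
apply: (big_morph (lpa_mul x)) => [y z|]; first exact: lpa_mulrDr.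
exact: mulx0.
Qed.

Let vertexM v w : lpa_mul (lpa_vertex K G v) (lpa_vertex K G w) =
  if v == w then lpa_vertex K G v else 0.
Proof.
rewrite lpa_piM; case: eqP => [->|vw]; apply/lpa_piP; first exact: lpa_Veq.
exact: lpa_Vneq.
Qed.

Let one_fixl w x : lpa_mul (lpa_vertex K G w) x = x -> lpa_mul lpa_one x = x.
Proof.
move=> <-; rewrite lpa_mulrA; congr lpa_mul; rewrite mul_suml (bigD1 w)//=.
rewrite vertexM eqxx big1 ?addr0// => v /negPf vw.
by rewrite vertexM vw.
Qed.

Let one_fixr w x : lpa_mul x (lpa_vertex K G w) = x -> lpa_mul x lpa_one = x.
Proof.
move=> <-; rewrite -lpa_mulrA; congr lpa_mul; rewrite mul_sumr (bigD1 w)//=.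
rewrite vertexM eqxx big1 ?addr0// => v /negPf vw.
by rewrite vertexM eq_sym vw.
Qed.

Fact lpa_mul1r : left_id lpa_one (@lpa_mul K V Ed G).
Proof.
elim/lpaW; elim=> [v|e|e||x IHx y IHy|x IHx|a x IHx|x IHx y IHy].
- by apply: (one_fixl (w := v)); rewrite vertexM eqxx.
- by apply: (one_fixl (w := src G e)); rewrite lpa_piM; apply/lpa_piP/lpa_E1s.
- by apply: (one_fixl (w := rng G e)); rewrite lpa_piM; apply/lpa_piP/lpa_E2r.
- exact: mulx0.
- by rewrite -lpa_piD [LHS]lpa_mulrDr IHx IHy.
- rewrite -lpa_piN; apply: (addrI (lpa_pi G x)).
  rewrite -{1}IHx -lpa_mulrDr [X in lpa_mul _ X]addrN [RHS]addrN.
  exact: mulx0.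
- by rewrite -lpa_piZ -[lpa_scale _ _]/(a *: lpa_pi G x) -lpa_mulZr IHx.
- by rewrite -lpa_piM lpa_mulrA IHx.
Qed.

Fact lpa_mulr1 : right_id lpa_one (@lpa_mul K V Ed G).
Proof.
elim/lpaW; elim=> [v|e|e||x IHx y IHy|x IHx|a x IHx|x IHx y IHy].
- by apply: (one_fixr (w := v)); rewrite vertexM eqxx.
- by apply: (one_fixr (w := rng G e)); rewrite lpa_piM; apply/lpa_piP/lpa_E1r.
- by apply: (one_fixr (w := src G e)); rewrite lpa_piM; apply/lpa_piP/lpa_E2s.
- exact: mul0x.
- by rewrite -lpa_piD [LHS]lpa_mulrDl IHx IHy.
- rewrite -lpa_piN; apply: (addrI (lpa_pi G x)).
  rewrite -{1}IHx -lpa_mulrDl [X in lpa_mul X _]addrN [RHS]addrN.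
  exact: mul0x.
- by rewrite -lpa_piZ -[lpa_scale _ _]/(a *: lpa_pi G x) -lpa_mulZl IHx.
- by rewrite -lpa_piM -lpa_mulrA IHy.
Qed.

HB.instance Definition _ := GRing.Zmodule_isPzRing.Build (lpa K G)
  (@lpa_mulrA K V Ed G) lpa_mul1r lpa_mulr1
  (@lpa_mulrDl K V Ed G) (@lpa_mulrDr K V Ed G).

End UnitalLeavittPathAlgebra.

(* K_0(R) is the group completion of the monoid V(R) of isomorphism classes of
   finitely generated projective modules. As usual these are represented by
   idempotent matrices e (standing for the image of e in R^n): the modules of e
   and f are isomorphic iff e = x y and f = y x for some rectangular matrices
   x, y, and direct sum is block-diagonal sum. *)
Section K0.
Variable R : pzRingType.

Record idem := Idem { idem_dim : nat;
                      idem_mx :> 'M[R]_idem_dim;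
                      idem_mxP : idem_mx *m idem_mx = idem_mx }.

Definition idem_eqv (e f : idem) : Prop :=
  exists (x : 'M[R]_(idem_dim e, idem_dim f)) (y : 'M[R]_(idem_dim f, idem_dim e)),
    x *m y = e /\ y *m x = f.

Fact idem_add_subproof (e f : idem) :
  block_mx e 0 0 f *m block_mx e 0 0 f = block_mx e 0 0 f.
Proof. by rewrite mulmx_block !(mulmx0, mul0mx, addr0, add0r) !idem_mxP. Qed.

Definition idem_add (e f : idem) := Idem (idem_add_subproof e f).
Definition idem_zero := @Idem 0 0 (mul0mx _ _).

Lemma idem_refl e : idem_eqv e e.
Proof. by exists e, e; rewrite !idem_mxP. Qed.

Lemma idem_sym e f : idem_eqv e f -> idem_eqv f e.
Proof. by case=> x [y [xy yx]]; exists y, x. Qed.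

Lemma idem_trans e f g : idem_eqv e f -> idem_eqv f g -> idem_eqv e g.
Proof.
case=> x [y [xy yx]] [z [w [zw wz]]]; exists (x *m z), (w *m y); split.
  by rewrite mulmxA -(mulmxA x) zw -yx mulmxA xy -mulmxA xy idem_mxP.
by rewrite mulmxA -(mulmxA w) yx -zw mulmxA wz -mulmxA wz idem_mxP.
Qed.

Lemma idem_addE e e' f f' :
  idem_eqv e e' -> idem_eqv f f' -> idem_eqv (idem_add e f) (idem_add e' f').
Proof.
case=> x [y [xy yx]] [z [w [zw wz]]].
exists (block_mx x 0 0 z), (block_mx y 0 0 w).
by rewrite !mulmx_block !(mulmx0, mul0mx, addr0, add0r) xy yx zw wz.
Qed.

Lemma idem_addC e f : idem_eqv (idem_add e f) (idem_add f e).
Proof.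
exists (block_mx 0 e f 0), (block_mx 0 f e 0).
by rewrite !mulmx_block !(mulmx0, mul0mx, addr0, add0r) !idem_mxP.
Qed.

Lemma idem_add0 e : idem_eqv (idem_add idem_zero e) e.
Proof.
exists (col_mx 0 e), (row_mx 0 e); split.
  by rewrite mul_col_row !(mulmx0, mul0mx) idem_mxP.
by rewrite mul_row_col !(mulmx0, mul0mx) add0r idem_mxP.
Qed.

Lemma idem_cast e f (mn : idem_dim e = idem_dim f) :
  castmx (mn, mn) (e : 'M_(idem_dim e)) = f -> idem_eqv e f.
Proof.
case: e f mn => [m e eP] [n f fP] /= mn; case: n / mn f fP => f fP /=.
by rewrite castmx_id => ef; exists f, f; rewrite /= ef fP.
Qed.

Lemma idem_addA e f g :
  idem_eqv (idem_add e (idem_add f g)) (idem_add (idem_add e f) g).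
Proof.
apply/idem_sym; apply: (@idem_cast (idem_add (idem_add e f) g) (idem_add e (idem_add f g))
  (esym (addnA _ _ _))) => /=.
have := @block_mxA R _ _ _ _ _ _ (e : 'M_(idem_dim e)) 0 0 0
  (f : 'M_(idem_dim f)) 0 0 0 (g : 'M_(idem_dim g)).
by rewrite /= !row_mx0 !col_mx0 => ->.
Qed.

(* The pair (p, q) stands for [p] - [q]. *)
Definition K0_eqv (p q : idem * idem) : Prop :=
  exists r, idem_eqv (idem_add (idem_add p.1 q.2) r) (idem_add (idem_add q.1 p.2) r).

Definition K0_eqvb : rel (idem * idem) := fun p q => `[< K0_eqv p q >].

Lemma idem_addCA e f g :
  idem_eqv (idem_add e (idem_add f g)) (idem_add f (idem_add e g)).
Proof.
apply: idem_trans (idem_addA _ _ _) _.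
apply: idem_trans _ (idem_sym (idem_addA _ _ _)).
by apply: idem_addE; [apply: idem_addC|apply: idem_refl].
Qed.

Lemma idem_addACA e f g h :
  idem_eqv (idem_add (idem_add e f) (idem_add g h))
           (idem_add (idem_add e g) (idem_add f h)).
Proof.
apply: idem_trans (idem_sym (idem_addA _ _ _)) _.
apply: idem_trans _ (idem_addA _ _ _).
by apply: idem_addE; [apply: idem_refl|apply: idem_addCA].
Qed.


Lemma K0_eqvb_refl : reflexive K0_eqvb.
Proof. by move=> p; apply/asboolP; exists idem_zero; apply: idem_refl. Qed.

Lemma K0_eqvb_sym : symmetric K0_eqvb.
Proof.
by move=> p q; apply/asboolP/asboolP=> -[r pq]; exists r; apply: idem_sym.
Qed.

Lemma K0_eqvb_trans : transitive K0_eqvb.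
Proof.
move=> q p t /asboolP[r pq] /asboolP[u qt]; apply/asboolP.
exists (idem_add (idem_add q.1 q.2) (idem_add r u)).
have shuffle (a b c d : idem) :
    idem_eqv (idem_add (idem_add (idem_add a b) r) (idem_add (idem_add c d) u))
      (idem_add (idem_add a d) (idem_add (idem_add c b) (idem_add r u))).
  apply: idem_trans (idem_addACA _ _ _ _) _.
  apply: idem_trans _ (idem_sym (idem_addA _ _ _)).
  apply: idem_addE; last exact: idem_refl.
  apply: idem_trans (idem_addE (idem_refl _) (idem_addC _ _)) _.
  apply: idem_trans (idem_addACA _ _ _ _) _.
  exact: idem_addE (idem_refl _) (idem_addC _ _).
apply: idem_trans (idem_sym (shuffle _ _ _ _)) _.
apply: idem_trans (idem_addE pq qt) _.
apply: idem_trans (shuffle _ _ _ _) _.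
exact: idem_addCA.
Qed.

HB.instance Definition _ := gen_eqMixin idem.
HB.instance Definition _ := gen_choiceMixin idem.

Canonical K0_equiv := EquivRel K0_eqvb K0_eqvb_refl K0_eqvb_sym K0_eqvb_trans.

Definition K0 := {eq_quot K0_equiv}.

HB.instance Definition _ := Choice.on K0.

Definition K0_pi (p : idem * idem) : K0 := \pi_({eq_quot K0_equiv}) p.
Definition K0_repr (x : K0) : idem * idem := repr (x : {eq_quot K0_equiv}).

Lemma K0_piP p q : K0_pi p = K0_pi q <-> K0_eqv p q.
Proof.
split=> [/(@eqquotP _ K0_equiv {eq_quot K0_equiv})/asboolP//|pq].
by apply/(@eqquotP _ K0_equiv {eq_quot K0_equiv})/asboolP.
Qed.

Lemma K0_reprK : cancel K0_repr K0_pi.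
Proof. exact: reprK. Qed.

Lemma K0_pi_repr p : K0_eqv (K0_repr (K0_pi p)) p.
Proof. by apply/K0_piP; rewrite K0_reprK. Qed.

Lemma K0W (P : K0 -> Prop) : (forall p, P (K0_pi p)) -> forall x, P x.
Proof. by move=> Pp x; rewrite -[x]K0_reprK. Qed.

Definition K0_pair_add (p q : idem * idem) := (idem_add p.1 q.1, idem_add p.2 q.2).
Definition K0_pair_opp (p : idem * idem) := (p.2, p.1).

Definition K0_zero := K0_pi (idem_zero, idem_zero).
Definition K0_add (x y : K0) := K0_pi (K0_pair_add (K0_repr x) (K0_repr y)).
Definition K0_opp (x : K0) := K0_pi (K0_pair_opp (K0_repr x)).

Lemma K0_piD p q : K0_add (K0_pi p) (K0_pi q) = K0_pi (K0_pair_add p q).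
Proof.
apply/K0_piP; have [r pr] := K0_pi_repr p; have [u qu] := K0_pi_repr q.
exists (idem_add r u) => /=.
have shuffle (a b c d : idem) :
    idem_eqv (idem_add (idem_add (idem_add a b) (idem_add c d)) (idem_add r u))
      (idem_add (idem_add (idem_add a c) r) (idem_add (idem_add b d) u)).
  apply: idem_trans _ (idem_addACA _ _ _ _).
  exact: idem_addE (idem_addACA _ _ _ _) (idem_refl _).
apply: idem_trans (shuffle _ _ _ _) _.
exact: idem_trans (idem_addE pr qu) (idem_sym (shuffle _ _ _ _)).
Qed.

Lemma K0_piN p : K0_opp (K0_pi p) = K0_pi (K0_pair_opp p).
Proof.
apply/K0_piP; have [r pr] := K0_pi_repr p; exists r => /=.
apply: idem_trans (idem_addE (idem_addC _ _) (idem_refl _)) _.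
apply: idem_trans (idem_sym pr) _.
exact: idem_addE (idem_addC _ _) (idem_refl _).
Qed.

Lemma K0_pi_idem p q : idem_eqv p.1 q.1 -> idem_eqv p.2 q.2 -> K0_pi p = K0_pi q.
Proof.
move=> pq1 pq2; apply/K0_piP; exists idem_zero.
by apply: idem_addE; [exact: idem_addE pq1 (idem_sym pq2)|exact: idem_refl].
Qed.

Fact K0_addrA : associative K0_add.
Proof.
elim/K0W=> p; elim/K0W=> q; elim/K0W=> t.
by rewrite !K0_piD; apply: K0_pi_idem; apply: idem_addA.
Qed.
Fact K0_addrC : commutative K0_add.
Proof.
by elim/K0W=> p; elim/K0W=> q; rewrite !K0_piD; apply: K0_pi_idem; apply: idem_addC.
Qed.
Fact K0_add0r : left_id K0_zero K0_add.
Proof. by elim/K0W=> p; rewrite !K0_piD; apply: K0_pi_idem; apply: idem_add0. Qed.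
Fact K0_addNr : left_inverse K0_zero K0_opp K0_add.
Proof.
elim/K0W=> p; rewrite K0_piN K0_piD; apply/K0_piP; exists idem_zero => /=.
apply: idem_addE; last exact: idem_refl.
apply: idem_trans (idem_addC _ _) _; apply: idem_trans (idem_add0 _) _.
by apply: idem_trans (idem_addC _ _) _; apply: idem_sym; apply: idem_add0.
Qed.

HB.instance Definition _ :=
  GRing.isZmodule.Build K0 K0_addrA K0_addrC K0_add0r K0_addNr.

End K0.

Definition cyclic_zmod (M : zmodType) : Prop :=
  exists g : M, forall x : M, exists m : int, x = g *~ m.

(* C_n^2, with vertices v_1, ..., v_n reindexed as 0, ..., n-1; [ordS] is the
   successor modulo n, [inl i] is the edge e_i and [inr i] is the edge f_i. *)
Definition Cn2 (n : nat) : graph 'I_n ('I_n + 'I_n) :=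
  Graph (fun e => match e with inl i | inr i => i end)
        (fun e => match e with inl i => ordS i | inr i => ordS (ordS i) end).

Definition H2 (n : nat) : nat := `|\det (1%:M - (incidence_mx (Cn2 n))^T)|%N.

Fixpoint fib (n : nat) : nat :=
  if n is n'.+1 then (if n' is n''.+1 then fib n' + fib n'' else 1)%N else 0%N.

(* The subtraction is in int: F(0) - 1 = -1. *)
Definition fib_gcd (n : nat) : nat := `|gcdz (fib n) ((fib n.-1)%:Z - 1)|%N.

(* Vertices u_1, u_2, u_3 are 0, 1, 2. The quotient is exact, since
   fib_gcd n divides H2 n for n >= 1. *)
Definition E_loops (n : nat) (i : 'I_3) : nat :=
  nth 0%N [:: 2; 2 + fib_gcd n; 2 + H2 n %/ fib_gcd n]%N i.

Definition E_mult (n : nat) (i k : 'I_3) : nat :=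
  if i == k then E_loops n i else 1%N.

Definition E_graph (n : nat) := mult_graph (E_mult n).

(* Main.v *)
(* The algebra of a graph in which the vertex [u_i] emits the edges listed in
   row i is presented by isomorphisms [u_i = sum_k A_ik u_k] of projectives. Two
   moves keep the algebra, not only its Morita class: inside row i an occurrence
   of [u_j], j <> i, may be replaced by row j, and vertices with equal columns
   may be merged by adding their rows. Row moves and one merge take C_n^2 to three
   vertices; once [u_1 = u_1 + w] with [w = u_1 + u_2 + u_3], the other two rows
   only matter modulo w, hence form a 2 x 2 integer matrix on which the moves
   induce the elementary row and column operations. For C_n^2 its entries have
   gcd d(n) and its determinant is H_2(n), so its Smith form is that of E_n.

   For minimality, [1] = 0 in K_0(L(C_n^2)), because 1 is equivalent to 1 + 1, and
   K_0 of the algebra of any graph with finitely many vertices is generated by its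
   vertices. So at most two vertices make K_0 cyclic. *)
Require Import Defs.
From Stdlib Require List.
From HB Require Import structures.
From mathcomp Require Import all_boot all_order all_algebra.
From mathcomp Require Import all_classical.
From mathcomp Require Import zify ring.

Set Implicit Arguments.
Unset Strict Implicit.
Unset Printing Implicit Defensive.

Import Order.TTheory GRing.Theory Num.Theory.
Local Open Scope ring_scope.

(** With [p = F(n)] and [q = F(n-1) - 1], the 2 x 2 matrix left by [C_n^2], [n >= 3], has rows
    [(q - p, - p)] and [(- q, - (p + q))]. Its first row already has gcd [gcd(p, q) = d(n)], which
    divides the second, so one Euclidean pass on the columns and one row operation suffice. Its
    determinant [p^2 - p q - q^2] is nonnegative by Cassini's identity, which disposes of the
    absolute value in [H_2(n)].

    The obstacle in minimality is that K_0 is made of arbitrary idempotent matrices over an algebra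
    that is only presented, possibly with infinitely many edges. One idempotent involves finitely
    many edges. Multiplying its columns on the right by long paths removes the ghost edges, and
    column vectors of paths admit a Groebner reduction for right multiplication: reduced generators
    are free, up to the idempotent at the end of each leading path. So the idempotent becomes
    diagonal, with entries whose classes come from vertices. That a nonzero path is not a
    combination of smaller ones with the same end is read off the degree-0 component of the grading,
    in place of a linear basis of the algebra. *)

(** * Algebras of graphs with finitely many vertices, and maps between them *)

Section FiniteVertices.
Variables (K : fieldType) (V : finType) (Ed : Type) (G : graph V Ed).
Implicit Types (v w : V) (e : Ed) (x y : lpa K G).
Local Notation vx := (lpa_vertex K G).
Local Notation ed := (lpa_edge K G).
Local Notation gh := (lpa_ghost K G).

Lemma lpa_oneE : 1 = \sum_v vx v :> lpa K G. Proof. by []. Qed.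

Lemma lpa_scalerAl a x y : a *: (x * y) = a *: x * y.
Proof. exact: lpa_mulZl. Qed.

Lemma lpa_scalerAr a x y : a *: (x * y) = x * (a *: y).
Proof. exact: lpa_mulZr. Qed.

Lemma lpa_addE (s t : lpa_term K V Ed) :
  lpa_pi G (LAdd s t) = lpa_pi G s + lpa_pi G t.
Proof. by rewrite -lpa_piD. Qed.

Lemma lpa_oppE (s : lpa_term K V Ed) : lpa_pi G (LOpp s) = - lpa_pi G s.
Proof. by rewrite -lpa_piN. Qed.

Lemma lpa_scaleE a (s : lpa_term K V Ed) :
  lpa_pi G (LScale a s) = a *: lpa_pi G s.
Proof. by rewrite -lpa_piZ. Qed.

Lemma lpa_prodE (s t : lpa_term K V Ed) :
  lpa_pi G (LMul s t) = lpa_pi G s * lpa_pi G t.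
Proof. by rewrite -lpa_piM. Qed.

Lemma vertexM v w : vx v * vx w = if v == w then vx v else 0.
Proof.
rewrite -lpa_prodE; case: eqP => [->|vw]; apply/lpa_piP; first exact: lpa_Veq.
exact: lpa_Vneq.
Qed.

Lemma vertexMid v : vx v * vx v = vx v.
Proof. by rewrite vertexM eqxx. Qed.

Lemma src_edge e : vx (src G e) * ed e = ed e.
Proof. by rewrite -lpa_prodE; apply/lpa_piP/lpa_E1s. Qed.

Lemma edge_rng e : ed e * vx (rng G e) = ed e.
Proof. by rewrite -lpa_prodE; apply/lpa_piP/lpa_E1r. Qed.

Lemma rng_ghost e : vx (rng G e) * gh e = gh e.
Proof. by rewrite -lpa_prodE; apply/lpa_piP/lpa_E2r. Qed.

Lemma ghost_src e : gh e * vx (src G e) = gh e.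
Proof. by rewrite -lpa_prodE; apply/lpa_piP/lpa_E2s. Qed.

Lemma ghost_edge e : gh e * ed e = vx (rng G e).
Proof. by rewrite -lpa_prodE; apply/lpa_piP/lpa_CK1eq. Qed.

Lemma ghost_edge_neq e e' : e <> e' -> gh e * ed e' = 0.
Proof. by move=> ee'; rewrite -lpa_prodE; apply/lpa_piP/lpa_CK1neq. Qed.

Lemma vertex_edge v e : vx v * ed e = if v == src G e then ed e else 0.
Proof.
rewrite -{1}src_edge mulrA vertexM; case: eqP => [->|_]; first exact: src_edge.
exact: mul0r.
Qed.

Lemma edge_vertex v e : ed e * vx v = if rng G e == v then ed e else 0.
Proof.
rewrite -{1}edge_rng -mulrA vertexM; case: eqP => [_|_]; first exact: edge_rng.
exact: mulr0.
Qed.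

Lemma ghost_vertex v e : gh e * vx v = if src G e == v then gh e else 0.
Proof.
rewrite -{1}ghost_src -mulrA vertexM; case: eqP => [_|_]; first exact: ghost_src.
exact: mulr0.
Qed.

Lemma vertex_ghost v e : vx v * gh e = if v == rng G e then gh e else 0.
Proof.
rewrite -{1}rng_ghost mulrA vertexM; case: eqP => [->|_]; first exact: rng_ghost.
exact: mul0r.
Qed.

Lemma edge_ghost e e' : rng G e != rng G e' -> ed e * gh e' = 0.
Proof.
by move=> /negPf ee'; rewrite -edge_rng -mulrA vertex_ghost ee' mulr0.
Qed.

End FiniteVertices.

Lemma ghost_edgeE (K : fieldType) (V : finType) (Ed : eqType) (G : graph V Ed) (e e' : Ed) :
  lpa_ghost K G e * lpa_edge K G e' =
  if e == e' then lpa_vertex K G (rng G e) else 0.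
Proof. by case: eqP => [->|ee']; [rewrite ghost_edge|rewrite ghost_edge_neq]. Qed.

Lemma list_inE (T : eqType) (s : seq T) x : List.In x s <-> x \in s.
Proof.
elim: s => //= a s IH; rewrite inE; split=> [[->|/IH ->]|/orP[/eqP->|/IH]].
- by rewrite eqxx.
- by rewrite orbT.
- by left.
- by right.
Qed.

Lemma list_uniqE (T : eqType) (s : seq T) : List.NoDup s <-> uniq s.
Proof.
elim: s => [|a s IH] /=; first by split=> // _; constructor.
split=> [H|/andP[as_ /IH us]].
  by inversion_clear H; apply/andP; split; [apply/negP => /list_inE|apply/IH].
by constructor=> // /list_inE; apply/negP.
Qed.

Lemma lpa_CK2_fin (K : fieldType) (V Ed : finType) (G : graph V Ed) (v : V) :
  (exists e, src G e = v) ->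
  lpa_vertex K G v =
    \sum_(e | src G e == v) lpa_edge K G e * lpa_ghost K G e.
Proof.
case=> e0 e0v; have /lpa_piP : lpa_eqv G (LVertex v : lpa_term K V Ed)
    (foldr (fun e x => LAdd (LMul (LEdge e) (LGhost e)) x) LZero
      (enum [pred e | src G e == v])).
  apply: lpa_CK2.
  - by move=> E; have := mem_enum [pred e | src G e == v] e0; rewrite E in_nil inE/= e0v eqxx.
  - exact/list_uniqE/enum_uniq.
  - by move=> e; rewrite list_inE mem_enum inE; split=> /eqP.
rewrite /lpa_vertex => ->; rewrite -big_enum.
by elim: (enum _) => [|e s IH] /=; rewrite ?big_nil// big_cons lpa_addE IH lpa_prodE.
Qed.

(** The data of the universal property: images in the algebra of [H] for the generators of [G],
    subject to the relations of [G]. Since [Ed] is finite, (CK2) can be a sum over a finite type. *)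
Record leavitt_family (K : fieldType) (V Ed V' : finType) (Ed' : Type)
    (G : graph V Ed) (H : graph V' Ed')
    (fv : V -> lpa K H) (fe fg : Ed -> lpa K H) : Prop := LeavittFamily {
  fam_vertex v w : fv v * fv w = if v == w then fv v else 0;
  fam_src e : fv (src G e) * fe e = fe e;
  fam_rng e : fe e * fv (rng G e) = fe e;
  fam_rng_ghost e : fv (rng G e) * fg e = fg e;
  fam_ghost_src e : fg e * fv (src G e) = fg e;
  fam_ghost_edge e e' : fg e * fe e' = if e == e' then fv (rng G e) else 0;
  fam_CK2 v : (exists e, src G e = v) ->
    fv v = \sum_(e | src G e == v) fe e * fg e }.

Section Lift.
Variables (K : fieldType) (V Ed V' : finType) (Ed' : Type).
Variables (G : graph V Ed) (H : graph V' Ed').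
Variables (fv : V -> lpa K H) (fe fg : Ed -> lpa K H).
Hypothesis fam : leavitt_family G fv fe fg.

Fixpoint term_eval (t : lpa_term K V Ed) : lpa K H :=
  match t with
  | LVertex v => fv v
  | LEdge e => fe e
  | LGhost e => fg e
  | LZero => 0
  | LAdd s t => term_eval s + term_eval t
  | LOpp s => - term_eval s
  | LScale a s => a *: term_eval s
  | LMul s t => term_eval s * term_eval t
  end.

Lemma term_eval_eqv s t : lpa_eqv G s t -> term_eval s = term_eval t.
Proof.
elim=> //=.
- by move=> x y z _ -> _ ->.
- by move=> x x' y y' _ -> _ ->.
- by move=> x x' _ ->.
- by move=> a x x' _ ->.
- by move=> x x' y y' _ -> _ ->.
- by move=> x y z; rewrite addrA.
- by move=> x y; rewrite addrC.
- by move=> x; rewrite add0r.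
- by move=> x; rewrite addNr.
- by move=> a b x; rewrite scalerA.
- by move=> x; rewrite scale1r.
- by move=> a x y; rewrite scalerDr.
- by move=> a b x; rewrite scalerDl.
- by move=> x y z; rewrite mulrA.
- by move=> x y z; rewrite mulrDl.
- by move=> x y z; rewrite mulrDr.
- by move=> a x y; rewrite lpa_scalerAl.
- by move=> a x y; rewrite lpa_scalerAr.
- by move=> v; rewrite (fam_vertex fam) eqxx.
- by move=> v w /eqP/negPf vw; rewrite (fam_vertex fam) vw.
- exact: (fam_src fam).
- exact: (fam_rng fam).
- exact: (fam_rng_ghost fam).
- exact: (fam_ghost_src fam).
- by move=> e; rewrite (fam_ghost_edge fam) eqxx.
- by move=> e e' /eqP/negPf ee'; rewrite (fam_ghost_edge fam) ee'.
move=> v es es0 /list_uniqE us esv.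
have esE e : e \in es = (src G e == v).
  by apply/idP/eqP => [/list_inE/esv//|/esv/list_inE].
have -> : fv v = \sum_(e | src G e == v) fe e * fg e.
  apply: (fam_CK2 fam); case: es es0 esv {us esE} => // e es _ esv.
  by exists e; apply/esv; left.
under eq_bigl do rewrite -esE; rewrite -big_uniq//=.
by elim: (es) => [|e es' IH]; rewrite ?big_nil// big_cons IH.
Qed.

Definition lpa_lift (x : lpa K G) : lpa K H := term_eval (lpa_repr x).

Lemma lpa_lift_pi t : lpa_lift (lpa_pi G t) = term_eval t.
Proof. exact/term_eval_eqv/lpa_pi_repr. Qed.

Lemma lpa_lift_linear : linear lpa_lift.
Proof.
move=> a; elim/lpaW => x; elim/lpaW => y.
by rewrite -lpa_scaleE -lpa_addE !lpa_lift_pi.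
Qed.

HB.instance Definition _ := GRing.isLinear.Build K (lpa K G) (lpa K H) _
  lpa_lift lpa_lift_linear.

Lemma lpa_liftM x y : lpa_lift (x * y) = lpa_lift x * lpa_lift y.
Proof.
elim/lpaW: x => x; elim/lpaW: y => y.
by rewrite -lpa_prodE !lpa_lift_pi.
Qed.

Lemma lpa_liftE : exists f : {linear lpa K G -> lpa K H},
  [/\ forall x y, f (x * y) = f x * f y,
      forall v, f (lpa_vertex K G v) = fv v,
      forall e, f (lpa_edge K G e) = fe e &
      forall e, f (lpa_ghost K G e) = fg e].
Proof. by exists lpa_lift; split=> *; rewrite ?lpa_liftM//= lpa_lift_pi. Qed.

End Lift.

Lemma lpa_fun_id (K : fieldType) (V Ed V' : finType) (Ed' : Type)
    (G : graph V Ed) (H : graph V' Ed')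
    (f : {linear lpa K G -> lpa K H}) (g : {linear lpa K H -> lpa K G}) :
  (forall x y, f (x * y) = f x * f y) -> (forall x y, g (x * y) = g x * g y) ->
  (forall v, g (f (lpa_vertex K G v)) = lpa_vertex K G v) ->
  (forall e, g (f (lpa_edge K G e)) = lpa_edge K G e) ->
  (forall e, g (f (lpa_ghost K G e)) = lpa_ghost K G e) -> cancel f g.
Proof.
move=> fM gM gfv gfe gfg; elim/lpaW; elim=> //.
- by rewrite -[lpa_pi _ _]/(0 : lpa K G) !linear0.
- by move=> x IHx y IHy; rewrite lpa_addE !linearD IHx IHy.
- by move=> x IHx; rewrite lpa_oppE !linearN IHx.
- by move=> a x IHx; rewrite lpa_scaleE !linearZ/= IHx.
- by move=> x IHx y IHy; rewrite lpa_prodE fM gM IHx IHy.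
Qed.

(** Two induced maps are mutually inverse as soon as they are so on generators. They enter the
    hypothesis as arbitrary multiplicative linear maps with known values, so that the six checks
    never unfold the lift. *)
Lemma lpa_iso_family (K : fieldType) (V Ed V' Ed' : finType)
    (G : graph V Ed) (H : graph V' Ed')
    (fv : V -> lpa K H) (fe fg : Ed -> lpa K H)
    (gv : V' -> lpa K G) (ge gg : Ed' -> lpa K G) :
  leavitt_family G fv fe fg -> leavitt_family H gv ge gg ->
  (forall (f : {linear lpa K G -> lpa K H}) (g : {linear lpa K H -> lpa K G}),
    (forall x y, f (x * y) = f x * f y) -> (forall x y, g (x * y) = g x * g y) ->
    (forall v, f (lpa_vertex K G v) = fv v) ->
    (forall e, f (lpa_edge K G e) = fe e) ->
    (forall e, f (lpa_ghost K G e) = fg e) ->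
    (forall v, g (lpa_vertex K H v) = gv v) ->
    (forall e, g (lpa_edge K H e) = ge e) ->
    (forall e, g (lpa_ghost K H e) = gg e) ->
    [/\ forall v, g (fv v) = lpa_vertex K G v,
        forall e, g (fe e) = lpa_edge K G e,
        forall e, g (fg e) = lpa_ghost K G e &
     [/\ forall v, f (gv v) = lpa_vertex K H v,
        forall e, f (ge e) = lpa_edge K H e &
        forall e, f (gg e) = lpa_ghost K H e]]) ->
  lpa_iso K G H.
Proof.
move=> /lpa_liftE[f [fM fvE feE fgE]] /lpa_liftE[g [gM gvE geE ggE]].
case/(_ f g fM gM fvE feE fgE gvE geE ggE) => gv1 ge1 gg1 [fv1 fe1 fg1].
exists f; split; last exact: fM.
exists g; apply: lpa_fun_id => // *.
- by rewrite fvE.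
- by rewrite feE.
- by rewrite fgE.
- by rewrite gvE.
- by rewrite geE.
- by rewrite ggE.
Qed.

Lemma lpa_iso_refl (K : fieldType) (V Ed : Type) (G : graph V Ed) : lpa_iso K G G.
Proof. by exists idfun; split=> //; exists idfun. Qed.

Lemma lpa_iso_sym (K : fieldType) (V Ed V' Ed' : Type)
    (G : graph V Ed) (H : graph V' Ed') : lpa_iso K G H -> lpa_iso K H G.
Proof.
case=> f [[g fK gK] fM].
have gL : linear g by move=> a x y; apply: (can_inj fK); rewrite linearP/= !gK.
pose gl := HB.pack_for {linear lpa K H -> lpa K G} g
  (GRing.isLinear.Build K (lpa K H) (lpa K G) _ g gL).
exists gl; split; first by exists f.
by move=> x y; apply: (can_inj fK); rewrite fM/= !gK.
Qed.

Lemma lpa_iso_trans (K : fieldType) (V1 E1 V2 E2 V3 E3 : Type)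
    (G1 : graph V1 E1) (G2 : graph V2 E2) (G3 : graph V3 E3) :
  lpa_iso K G1 G2 -> lpa_iso K G2 G3 -> lpa_iso K G1 G3.
Proof.
case=> f [fb fM] [g [gb gM]]; exists (g \o f : {linear _ -> _}).
by split=> [|x y /=]; [exact: bij_comp|rewrite fM gM].
Qed.

Lemma lpa_iso_graph (K : fieldType) (V Ed V' Ed' : finType)
    (G : graph V Ed) (H : graph V' Ed') (p : V -> V') (q : Ed -> Ed') :
  bijective p -> bijective q ->
  (forall e, src H (q e) = p (src G e)) -> (forall e, rng H (q e) = p (rng G e)) ->
  lpa_iso K G H.
Proof.
case=> p' pK p'K [q' qK q'K] qs qr.
have qs' e : src G (q' e) = p' (src H e) by rewrite -{2}[e]q'K qs pK.
have qr' e : rng G (q' e) = p' (rng H e) by rewrite -{2}[e]q'K qr pK.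
apply: (@lpa_iso_family _ _ _ _ _ _ _ (lpa_vertex K H \o p) (lpa_edge K H \o q)
  (lpa_ghost K H \o q) (lpa_vertex K G \o p') (lpa_edge K G \o q') (lpa_ghost K G \o q')).
- split=> /=.
  + by move=> v w; rewrite vertexM (can_eq pK).
  + by move=> e; rewrite -qs src_edge.
  + by move=> e; rewrite -qr edge_rng.
  + by move=> e; rewrite -qr rng_ghost.
  + by move=> e; rewrite -qs ghost_src.
  + by move=> e e'; rewrite ghost_edgeE (can_eq qK) qr.
  + move=> v [e ev]; rewrite lpa_CK2_fin; last by exists (q e); rewrite qs ev.
    rewrite (reindex q) /=; last by exists q' => ? _.
    by apply: eq_bigl => f; rewrite qs (can_eq pK).
- split=> /=.
  + by move=> v w; rewrite vertexM (can_eq p'K).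
  + by move=> e; rewrite -qs' src_edge.
  + by move=> e; rewrite -qr' edge_rng.
  + by move=> e; rewrite -qr' rng_ghost.
  + by move=> e; rewrite -qs' ghost_src.
  + by move=> e e'; rewrite ghost_edgeE (can_eq q'K) qr'.
  + move=> v [e ev]; rewrite lpa_CK2_fin; last by exists (q' e); rewrite qs' ev.
    rewrite (reindex q') /=; last by exists q => ? _.
    by apply: eq_bigl => f; rewrite qs' (can_eq p'K).
move=> f g _ _ fv fe fg gv ge gg.
by split=> [v|e|e|]; rewrite ?gv ?ge ?gg/= ?pK ?qK//; split=> [v|e|e];
  rewrite ?fv ?fe ?fg/= ?p'K ?q'K.
Qed.

(** * The row move *)

Lemma sum_sig (R : nmodType) (I : finType) (P : pred I) (F : I -> R) :
  \sum_(i | P i) F i = \sum_(s : {i | P i}) F (val s).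
Proof. exact: (big_sub [pred i | P i]). Qed.

Section RowMove.
Variables (K : fieldType) (V C : finType) (G0 : graph V C) (i j : V).
Hypotheses (ij : i != j) (emits : exists f, src G0 f = j).

Definition edge_graph : graph V (unit + C) :=
  Graph (fun e => if e is inr f then src G0 f else i)
        (fun e => if e is inr f then rng G0 f else j).

Definition expanded_graph : graph V (C + {f : C | src G0 f == j}) :=
  Graph (fun e => if e is inl f then src G0 f else i)
        (fun e => match e with inl f => rng G0 f | inr f => rng G0 (val f) end).

Local Notation G := edge_graph.
Local Notation H := expanded_graph.
Local Notation "'a" := (lpa_edge K G (inl tt)).
Local Notation "'a^*" := (lpa_ghost K G (inl tt)).
Local Notation x f := (lpa_edge K G (inr f)).
Local Notation x' f := (lpa_ghost K G (inr f)).
Local Notation y f := (lpa_edge K H (inl f)).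
Local Notation y' f := (lpa_ghost K H (inl f)).
Local Notation z s := (lpa_edge K H (inr s)).
Local Notation z' s := (lpa_ghost K H (inr s)).

(** Multiplying (CK2) at [j] by the edge [a] gives [a = sum_f a f f^*], so [a] and the products
    [a f] determine each other. As [i != j], neither [a] nor its replacements are emitted by [j],
    and (CK2) at [j] reads the same in both graphs. *)
Let fe (e : unit + C) := if e is inr f then y f else \sum_s z s * y' (val s).
Let fg (e : unit + C) := if e is inr f then y' f else \sum_s y (val s) * z' s.
Let ge (e : C + {f : C | src G0 f == j}) :=
  match e with inl f => x f | inr s => 'a * x (val s) end.
Let gg (e : C + {f : C | src G0 f == j}) :=
  match e with inl f => x' f | inr s => x' (val s) * 'a^* end.

Let CK2j : lpa_vertex K H j =
  \sum_(s : {f | src G0 f == j}) y (val s) * y' (val s).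
Proof.
have [f fj] := emits.
rewrite lpa_CK2_fin; last by exists (inl f).
rewrite big_sumType/= [X in _ + X]big_pred0 ?addr0; last by move=> s; rewrite (negPf ij).
exact: (sum_sig _ (fun f => y f * y' f)).
Qed.

Let famF : leavitt_family G (lpa_vertex K H) fe fg.
Proof.
split.
- exact: vertexM.
- case=> [[]|f] /=; last exact: (@src_edge K V _ H (inl f)).
  by rewrite mulr_sumr; apply: eq_bigr => s _; rewrite mulrA (@src_edge K V _ H (inr s)).
- case=> [[]|f] /=; last exact: (@edge_rng K V _ H (inl f)).
  rewrite mulr_suml; apply: eq_bigr => s _; rewrite -mulrA ghost_vertex/=.
  by rewrite (valP s).
- case=> [[]|f] /=; last exact: (@rng_ghost K V _ H (inl f)).
  rewrite mulr_sumr; apply: eq_bigr => s _; rewrite mulrA vertex_edge/=.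
  by rewrite eq_sym (valP s).
- case=> [[]|f] /=; last exact: (@ghost_src K V _ H (inl f)).
  by rewrite mulr_suml; apply: eq_bigr => s _; rewrite -mulrA (@ghost_src K V _ H (inr s)).
- case=> [[]|f] [[]|f'] /=.
  + rewrite CK2j mulr_sumr; apply: eq_bigr => s _; rewrite mulr_suml.
    under eq_bigr do rewrite -mulrA (mulrA (z' _)).
    rewrite (bigD1 s)//= ghost_edge/= (@rng_ghost K V _ H (inl (val s))) big1 ?addr0// => t ts.
    by rewrite ghost_edgeE/= (inj_eq inr_inj) (negPf ts) mul0r mulr0.
  + by rewrite mulr_suml big1// => s _; rewrite -mulrA ghost_edgeE mulr0.
  + by rewrite mulr_sumr big1// => s _; rewrite mulrA ghost_edgeE mul0r.
  + by rewrite ghost_edgeE !(inj_eq inl_inj) !(inj_eq inr_inj).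
- move=> v [e ev]; rewrite big_sumType/=.
  rewrite lpa_CK2_fin; last first.
    case: e ev => [[]|f] /= ev; last by exists (inl f).
    by have [f fj] := emits; exists (inr (exist _ f (introT eqP fj))).
  rewrite big_sumType/= addrC; congr (_ + _).
  case: (i == v) => /=; last by rewrite !big_pred0.
  rewrite (big_pred1 tt)//.
  rewrite mulr_suml; apply: eq_bigr => s _; rewrite mulr_sumr (bigD1 s)//=.
  rewrite -mulrA (mulrA (y' _)) ghost_edge/= big1 ?addr0.
    by rewrite (@rng_ghost K V _ H (inr s)).
  by move=> t ts; rewrite -mulrA (mulrA (y' _)) ghost_edgeE (inj_eq inl_inj) (inj_eq val_inj)
    eq_sym (negPf ts) mul0r mulr0.
Qed.

Let famG : leavitt_family H (lpa_vertex K G) ge gg.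
Proof.
split.
- exact: vertexM.
- case=> [f|s] /=; first exact: (@src_edge K V _ G (inr f)).
  by rewrite mulrA (@src_edge K V _ G (inl tt)).
- case=> [f|s] /=; first exact: (@edge_rng K V _ G (inr f)).
  by rewrite -mulrA (@edge_rng K V _ G (inr _)).
- case=> [f|s] /=; first exact: (@rng_ghost K V _ G (inr f)).
  by rewrite mulrA (@rng_ghost K V _ G (inr _)).
- case=> [f|s] /=; first exact: (@ghost_src K V _ G (inr f)).
  by rewrite -mulrA (@ghost_src K V _ G (inl tt)).
- case=> [f|s] [f'|s'] /=.
  + by rewrite ghost_edgeE !(inj_eq inl_inj) !(inj_eq inr_inj).
  + by rewrite mulrA ghost_edgeE mul0r.
  + by rewrite -mulrA ghost_edgeE mulr0.
  + rewrite -mulrA (mulrA 'a^*) ghost_edge/= vertex_edge/= eq_sym (valP s').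
    by rewrite ghost_edgeE !(inj_eq inr_inj).
- move=> v [e ev]; rewrite big_sumType/=.
  rewrite lpa_CK2_fin; last first.
    case: e ev => [f|s] /= ev; first by exists (inr f).
    by exists (inl tt).
  rewrite big_sumType/= addrC; congr (_ + _).
  case: (i == v) => /=; last by rewrite !big_pred0.
  rewrite (big_pred1 tt)//.
  under eq_bigr do rewrite -mulrA (mulrA (x _)).
  rewrite -mulr_sumr -mulr_suml -(sum_sig _ (fun f => x f * x' f)).
  have -> : \sum_(f | src G0 f == j) x f * x' f = lpa_vertex K G j.
    rewrite lpa_CK2_fin; last by have [f fj] := emits; exists (inr f).
    by rewrite big_sumType/= [X in X + _]big_pred0 ?add0r// => -[]; rewrite (negPf ij).
  by rewrite (@rng_ghost K V _ G (inl tt)).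
Qed.

Lemma row_move_iso : lpa_iso K G H.
Proof.
apply: (lpa_iso_family famF famG) => f g fM gM fv feE fgE gv geE ggE.
have CK2j' : lpa_vertex K G j = \sum_(s : {f | src G0 f == j}) x (val s) * x' (val s).
  rewrite -(sum_sig _ (fun f => x f * x' f)) lpa_CK2_fin.
    by rewrite big_sumType/= [X in X + _]big_pred0 ?add0r// => -[]; rewrite (negPf ij).
  by have [h hj] := emits; exists (inr h).
split=> //.
- case=> [[]|h]; rewrite /fe ?geE// linear_sum/=.
  under eq_bigr do rewrite gM geE ggE/= -mulrA.
  by rewrite -mulr_sumr -CK2j' (@edge_rng K V _ G (inl tt)).
- case=> [[]|h]; rewrite /fg ?ggE// linear_sum/=.
  under eq_bigr do rewrite gM geE ggE/= mulrA.
  by rewrite -mulr_suml -CK2j' (@rng_ghost K V _ G (inl tt)).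
split=> //.
- case=> [h|s]; rewrite /ge ?feE// fM !feE/= mulr_suml (bigD1 s)//= big1 ?addr0.
    by rewrite -mulrA ghost_edge (@edge_rng K V _ H (inr s)).
  by move=> t ts; rewrite -mulrA ghost_edgeE (inj_eq inl_inj) (inj_eq val_inj) (negPf ts) mulr0.
- case=> [h|s]; rewrite /gg ?fgE// fM !fgE/= mulr_sumr (bigD1 s)//= big1 ?addr0.
    by rewrite mulrA ghost_edge (@rng_ghost K V _ H (inr s)).
  by move=> t ts; rewrite mulrA ghost_edgeE (inj_eq inl_inj) (inj_eq val_inj) eq_sym (negPf ts) mul0r.
Qed.

End RowMove.

(** * Graphs given by their edge multiplicities *)

Definition edge_count (V Ed : finType) (G : graph V Ed) (i k : V) : nat :=
  (\sum_(e | (src G e == i) && (rng G e == k)) 1)%N.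

(** An edge is matched with its rank among the edges parallel to it. *)
Lemma lpa_iso_count (K : fieldType) (V Ed : finType) (G : graph V Ed)
    (m : V -> V -> nat) :
  (forall i k, edge_count G i k = m i k) -> lpa_iso K G (mult_graph m).
Proof.
pose A (p : V * V) := [pred e | (src G e == p.1) && (rng G e == p.2)].
move=> mE; have {mE} -> : m = fun i k => #|A (i, k)|.
  by apply/funext => i; apply/funext => k; rewrite -mE /edge_count sum1_card.
have Ae e : e \in A (src G e, rng G e) by rewrite inE/= !eqxx.
pose q e : {p : V * V & 'I_#|A (p.1, p.2)|} :=
  existT _ (src G e, rng G e) (enum_rank_in (Ae e) e).
apply: (@lpa_iso_graph _ _ _ _ _ _ _ id q) => //; first by exists id.
pose q' (e : {p : V * V & 'I_#|A (p.1, p.2)|}) := enum_val (tagged e).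
exists q' => [e|[[i k] t]]; first by rewrite /q'/= enum_rankK_in ?Ae.
have Aik : enum_val t \in A (i, k) := enum_valP t.
have /andP[/= /eqP si /eqP rk] := Aik; rewrite /q /q'/=.
rewrite -[in RHS](enum_valK_in Aik t); move: (Ae _) Aik.
move: (enum_val t) si rk => e si rk; subst i k => h1 h2.
by rewrite (bool_irrelevance h1 h2).
Qed.

Definition row_graph (V : finType) (m : V -> {ffun V -> nat}) :=
  mult_graph (fun i k => m i k).

Definition row_iso (K : fieldType) (V V' : finType)
    (m : V -> {ffun V -> nat}) (m' : V' -> {ffun V' -> nat}) : Prop :=
  lpa_iso K (row_graph m) (row_graph m').

Section RowIso.
Variables (K : fieldType) (V1 V2 V3 : finType).
Variables (m1 : V1 -> {ffun V1 -> nat}) (m2 : V2 -> {ffun V2 -> nat})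
  (m3 : V3 -> {ffun V3 -> nat}).

Lemma row_iso_refl : row_iso K m1 m1. Proof. exact: lpa_iso_refl. Qed.

Lemma row_iso_sym : row_iso K m1 m2 -> row_iso K m2 m1.
Proof. exact: lpa_iso_sym. Qed.

Lemma row_iso_trans : row_iso K m1 m2 -> row_iso K m2 m3 -> row_iso K m1 m3.
Proof. exact: lpa_iso_trans. Qed.

End RowIso.

Section RowGraphs.
Variables (V : finType).
Implicit Types (m : V -> {ffun V -> nat}) (i j k : V) (Q s : {ffun V -> nat}).

Definition delta j : {ffun V -> nat} := [ffun k => (k == j) : nat].

Definition set_row m i Q : V -> {ffun V -> nat} := fun k => if k == i then Q else m k.

Lemma set_row_id m i : set_row m i (m i) = m.
Proof. by apply/funext => k; rewrite /set_row; case: eqP => [->|]. Qed.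

Lemma set_rowE m i Q : set_row m i Q i = Q.
Proof. by rewrite /set_row eqxx. Qed.

Lemma set_rowNE m i Q j : i != j -> set_row m i Q j = m j.
Proof. by rewrite /set_row eq_sym => /negPf ->. Qed.

Lemma set_row2 m i Q Q' : set_row (set_row m i Q) i Q' = set_row m i Q'.
Proof. by apply/funext => k; rewrite /set_row; case: eqP. Qed.

Lemma edge_count_row_graph m i k : edge_count (row_graph m) i k = m i k.
Proof.
rewrite /edge_count.
transitivity (\sum_(p : V * V | (p.1 == i) && (p.2 == k)) \sum_(t : 'I_(m p.1 p.2)) 1)%N.
  rewrite (sig_big_dep (fun p : V * V => (p.1 == i) && (p.2 == k)) (fun _ _ => true)
    (fun _ _ => 1%N))/=.
  by apply: eq_bigl => -[p t]; rewrite andbT.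
rewrite (big_pred1 (i, k)); last by case=> a b; rewrite /= -xpair_eqE.
by rewrite sum1_card card_ord.
Qed.

Variable K : fieldType.

Local Notation row_iso := (row_iso K).

(** Both multiplicity matrices extend the one with [s] in row [i]: by an edge from [i] to [j], or by
    the expansion of that edge. The condition [m j != 0] says that [j] emits, as (CK2) at [j]
    requires. *)
Lemma row_step m i j s : i != j -> m j != 0 ->
  row_iso (set_row m i (delta j + s)) (set_row m i (m j + s)).
Proof.
move=> ij mj; pose G0 := row_graph (set_row m i s).
have emits : exists f, src G0 f = j.
  have [k mjk] : exists k, m j k != 0.
    apply/existsP; apply: contra_neqT mj; rewrite negb_exists => /forallP mj.
    by apply/ffunP => k; rewrite ffunE; apply/eqP; have := mj k; rewrite negbK.
  have h : (0 < set_row m i s (j, k).1 (j, k).2)%N by rewrite set_rowNE// lt0n.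
  by exists (existT _ (j, k) (Ordinal h)).
have cnt0 := edge_count_row_graph (set_row m i s).
apply: lpa_iso_trans (lpa_iso_trans _ (row_move_iso K ij emits)) _.
  apply/lpa_iso_sym/lpa_iso_count => i' k.
  rewrite /edge_count big_sumType/= -[X in (_ + X)%N]/(edge_count G0 i' k) cnt0.
  rewrite /set_row (eq_sym i).
  case: eqP => [_|_] /=; last by rewrite big_pred0.
  rewrite !ffunE; congr addn; rewrite (eq_sym j).
  by case: (k == j); [rewrite (big_pred1 tt)|rewrite big_pred0].
apply/lpa_iso_count => i' k.
rewrite /edge_count big_sumType/= -[X in (X + _)%N]/(edge_count G0 i' k) cnt0.
rewrite /set_row (eq_sym i).
case: eqP => [_|_] /=; last by rewrite big_pred0// addn0.
rewrite !ffunE addrC; congr addn.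
have <- : edge_count G0 j k = m j k by rewrite cnt0 set_rowNE.
rewrite /edge_count big_mkcondr [LHS]big_mkcond/=.
symmetry; exact: sum_sig.
Qed.

(* This follows from equality of [Q] and [Q'] in the commutative monoid on V
   presented by the relations [delta j = m j], j != i; the quantification over s
   makes it a congruence. *)
Definition row_cong m i Q Q' :=
  forall s, row_iso (set_row m i (Q + s)) (set_row m i (Q' + s)).

Lemma row_cong_refl m i Q : row_cong m i Q Q.
Proof. by move=> s; apply: row_iso_refl. Qed.

Lemma row_cong_sym m i Q Q' : row_cong m i Q Q' -> row_cong m i Q' Q.
Proof. by move=> QQ' s; apply: row_iso_sym. Qed.

Lemma row_cong_trans m i Q Q' Q'' :
  row_cong m i Q Q' -> row_cong m i Q' Q'' -> row_cong m i Q Q''.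
Proof. by move=> h1 h2 s; apply: row_iso_trans (h1 s) (h2 s). Qed.

Lemma row_congDr m i Q Q' s : row_cong m i Q Q' -> row_cong m i (Q + s) (Q' + s).
Proof. by move=> QQ' t; rewrite -!addrA; apply: QQ'. Qed.

Lemma row_congD m i Q Q' s s' : row_cong m i Q Q' -> row_cong m i s s' ->
  row_cong m i (Q + s) (Q' + s').
Proof.
move=> QQ' ss'; apply: row_cong_trans (row_congDr s QQ') _.
by rewrite ![Q' + _]addrC; apply: row_congDr.
Qed.

Lemma row_congMn m i Q Q' c : row_cong m i Q Q' -> row_cong m i (Q *+ c) (Q' *+ c).
Proof.
move=> QQ'; elim: c => [|c IH]; first exact: row_cong_refl.
by rewrite !mulrS; apply: row_congD.
Qed.

Lemma row_cong_step m i j : i != j -> m j != 0 -> row_cong m i (delta j) (m j).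
Proof. by move=> ij mj s; apply: row_step. Qed.

Lemma row_cong_iso m i Q Q' : row_cong m i Q Q' -> m i = Q ->
  row_iso m (set_row m i Q').
Proof. by move=> /(_ 0); rewrite !addr0 => QQ' mi; rewrite -{1}(set_row_id m i) mi. Qed.

End RowGraphs.

(** * Merging vertices *)

Section Amalgamation.
Variables (K : fieldType) (V V' X : finType) (p : V -> V') (s : X -> V) (r : X -> V').
Hypotheses (p_surj : forall w, exists v, p v = w) (emits : forall v, exists q, s q = v).

Definition amalgam_graph : graph V' X := Graph (p \o s) r.

(** The out-split of [amalgam_graph] for the partition of its edges along [s]: a vertex [w] becomes
    the vertices over [w], and each edge into [w] gets one copy for each of them. *)
Definition split_graph : graph V {a : X * V | r a.1 == p a.2} :=
  Graph (fun a => s (val a).1) (fun a => (val a).2).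

Local Notation H := amalgam_graph.
Local Notation G := split_graph.
Local Notation "'E" := {a : X * V | r a.1 == p a.2}.
Local Notation y q := (lpa_edge K H q).
Local Notation y' q := (lpa_ghost K H q).
Local Notation x a := (lpa_edge K G a).
Local Notation x' a := (lpa_ghost K G a).

(** An original vertex or edge is the sum of its pieces. In the other direction, [v] is the part of
    (CK2) at [p v] carried by the edges [q] with [s q = v], and a copy of an edge is that edge cut
    by such a part at its range. *)
Let gv (w : V') : lpa K G := \sum_(v | p v == w) lpa_vertex K G v.
Let ge (q : X) : lpa K G := \sum_(a : 'E | (val a).1 == q) x a.
Let gg (q : X) : lpa K G := \sum_(a : 'E | (val a).1 == q) x' a.
Let fv (v : V) : lpa K H := \sum_(q | s q == v) y q * y' q.
Let fe (a : 'E) : lpa K H := y (val a).1 * fv (val a).2.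
Let fg (a : 'E) : lpa K H := fv (val a).2 * y' (val a).1.

Let CK2G v : lpa_vertex K G v = \sum_(a : 'E | s (val a).1 == v) x a * x' a.
Proof.
apply: lpa_CK2_fin; have [q qv] := emits v; have [u /esym/eqP pu] := p_surj (r q).
by exists (exist _ (q, u) pu).
Qed.

Let sum_gv w : lpa_vertex K H w = \sum_(v | p v == w) fv v.
Proof.
rewrite lpa_CK2_fin; last first.
  by have [v <-] := p_surj w; have [q <-] := emits v; exists q.
rewrite (partition_big s (fun v => p v == w))//=; apply: eq_bigr => v /eqP pv.
by apply: eq_bigl => q /=; case: (s q =P v) => [->|_]; rewrite ?pv ?eqxx ?andbF.
Qed.

Let fv_vertex v : fv v * lpa_vertex K H (p v) = fv v.
Proof.
rewrite mulr_suml; apply: eq_bigr => q /eqP <-.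
by rewrite -mulrA (@ghost_src K V' _ H q).
Qed.

Let fv_edge v q : fv v * y q = if v == s q then y q else 0.
Proof.
rewrite mulr_suml; case: eqP => [->|/eqP vq].
  rewrite (bigD1 q)//= big1 ?addr0 => [|t /andP[_ /negPf tq]].
    by rewrite -mulrA ghost_edge/= (@edge_rng K V' _ H q).
  by rewrite -mulrA ghost_edgeE tq mulr0.
apply: big1 => t /eqP tv; rewrite -mulrA ghost_edgeE; case: eqP => [tq|]; last by rewrite mulr0.
by rewrite -tv tq eqxx in vq.
Qed.

Let ghost_fv v q : y' q * fv v = if v == s q then y' q else 0.
Proof.
rewrite mulr_sumr; case: eqP => [->|/eqP vq].
  rewrite (bigD1 q)//= big1 ?addr0 => [|t /andP[_ /negPf tq]].
    by rewrite mulrA ghost_edge/= (@rng_ghost K V' _ H q).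
  by rewrite mulrA ghost_edgeE eq_sym tq mul0r.
apply: big1 => t /eqP tv; rewrite mulrA ghost_edgeE; case: eqP => [tq|]; last by rewrite mul0r.
by rewrite -tv tq eqxx in vq.
Qed.

Let fvM v w : fv v * fv w = if v == w then fv v else 0.
Proof.
rewrite {2}/fv mulr_sumr; under eq_bigr do rewrite mulrA fv_edge.
case: eqP => [->|/eqP vw]; first by apply: eq_bigr => q /eqP ->; rewrite eqxx.
by apply: big1 => q /eqP qw; rewrite qw (negPf vw) mul0r.
Qed.

Let sum_split (R : nmodType) (P : pred X) (F : X -> V -> R) :
  \sum_(a : 'E | P (val a).1) F (val a).1 (val a).2 =
  \sum_(q | P q) \sum_(v | p v == r q) F q v.
Proof.
rewrite big_mkcond/= -(sum_sig _ (fun a : X * V => if P a.1 then F a.1 a.2 else 0)).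
rewrite pair_big_dep/= -big_mkcondr; apply: eq_bigl => a.
by rewrite andbC eq_sym.
Qed.

Let famG : leavitt_family G fv fe fg.
Proof.
split.
- exact: fvM.
- by move=> a; rewrite /fe mulrA fv_edge/= eqxx.
- by move=> a; rewrite /fe -mulrA fvM/= eqxx.
- by move=> a; rewrite /fg mulrA fvM/= eqxx.
- by move=> a; rewrite /fg -mulrA ghost_fv/= eqxx.
- move=> [[qa ua] /= ha] [[qb ub] /= hb]; rewrite /fg /fe -mulrA (mulrA (y' _)).
  rewrite ghost_edgeE -val_eqE/= xpair_eqE.
  case: eqP => _ /=; last by rewrite mul0r mulr0.
  by rewrite /= (eqP ha) mulrA fv_vertex fvM.
- move=> v _; rewrite (sum_split (fun q => s q == v) (fun q u => y q * fv u * (fv u * y' q))).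
  apply: eq_bigr => q _; under eq_bigr do rewrite mulrA -(mulrA (y q)) fvM eqxx.
  by rewrite -mulr_suml -mulr_sumr -sum_gv (@edge_rng K V' _ H q).
Qed.

Let gv_vertex w v : gv w * lpa_vertex K G v = if p v == w then lpa_vertex K G v else 0.
Proof.
rewrite mulr_suml; case: eqP => [pv|/eqP pv].
  rewrite (bigD1 v) ?pv//= vertexMid big1 ?addr0// => u /andP[_ /negPf uv].
  by rewrite vertexM uv.
apply: big1 => u /eqP pu; rewrite vertexM; case: eqP => // uv.
by rewrite -uv pu eqxx in pv.
Qed.

Let vertex_gv w v : lpa_vertex K G v * gv w = if p v == w then lpa_vertex K G v else 0.
Proof.
rewrite mulr_sumr; case: eqP => [pv|/eqP pv].
  rewrite (bigD1 v) ?pv//= vertexMid big1 ?addr0// => u /andP[_ /negPf uv].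
  by rewrite vertexM eq_sym uv.
apply: big1 => u /eqP pu; rewrite vertexM; case: eqP => // uv.
by rewrite uv pu eqxx in pv.
Qed.

Let ge_gg q : ge q * gg q = \sum_(a : 'E | (val a).1 == q) x a * x' a.
Proof.
rewrite mulr_suml; apply: eq_bigr => a /eqP aq.
rewrite mulr_sumr (bigD1 a) ?aq//= big1 ?addr0// => b /andP[/eqP bq ba].
apply: edge_ghost => /=; apply: contra ba => /eqP ab; rewrite -val_eqE.
by case: a b aq bq ab => [[? ?] ?] [[? ?] ?] /= -> -> ->.
Qed.

Let famH : leavitt_family H gv ge gg.
Proof.
split.
- move=> v w; rewrite {2}/gv mulr_sumr; under eq_bigr do rewrite gv_vertex.
  case: eqP => [->|/eqP vw]; first by apply: eq_bigr => u ->.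
  by apply: big1 => u /eqP ->; rewrite eq_sym (negPf vw).
- move=> q /=; rewrite mulr_sumr; apply: eq_bigr => a /eqP aq.
  by rewrite -src_edge mulrA gv_vertex/= aq eqxx.
- move=> q /=; rewrite mulr_suml; apply: eq_bigr => a /eqP aq.
  by rewrite -edge_rng -mulrA vertex_gv/= -aq eq_sym (valP a).
- move=> q /=; rewrite mulr_sumr; apply: eq_bigr => a /eqP aq.
  by rewrite -rng_ghost mulrA gv_vertex/= -aq eq_sym (valP a).
- move=> q /=; rewrite mulr_suml; apply: eq_bigr => a /eqP aq.
  by rewrite -ghost_src -mulrA vertex_gv/= aq eqxx.
- move=> q q' /=; rewrite mulr_suml.
  transitivity (\sum_(a : 'E | (val a).1 == q)
      if q == q' then lpa_vertex K G (val a).2 else 0).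
    apply: eq_bigr => a /eqP aq; rewrite mulr_sumr; case: eqP => [qq'|/eqP qq'].
      rewrite (bigD1 a)/=; last by rewrite aq qq'.
      rewrite ghost_edge/= big1 ?addr0// => b /andP[_ /negPf ba].
      by rewrite ghost_edgeE eq_sym ba.
    apply: big1 => b /eqP bq; rewrite ghost_edgeE; case: eqP => // ab.
    by rewrite -aq ab bq eqxx in qq'.
  case: eqP => _; last exact: big1.
  rewrite (sum_split (fun t => t == q) (fun _ u => lpa_vertex K G u)).
  by rewrite (big_pred1 q).
- move=> w _; rewrite /gv; under eq_bigr do rewrite CK2G.
  under [RHS]eq_bigr do rewrite ge_gg.
  (* After exchanging sums, both sides run over the edges [a] of the split graph; each is met once,
     through its source on the left and through its original edge on the right. *)
  have pT (I : eqType) (h : I -> V') (i0 : I) : h i0 = w ->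
      (fun i => (h i == w) && (i0 == i)) =1 pred1 i0.
    by move=> <- i /=; case: (eqVneq i0 i) => [->|_]; rewrite ?andbF// eqxx.
  rewrite [RHS](exchange_big_dep (fun a : 'E => p (s (val a).1) == w))/=; last first.
    by move=> q a /eqP <- /eqP ->.
  rewrite (exchange_big_dep (fun a : 'E => p (s (val a).1) == w))/=; last first.
    by move=> v a /eqP <- /eqP ->.
  apply: eq_bigr => a /eqP aw.
  by rewrite (big_pred1 _ (pT V p _ aw)) (big_pred1 _ (pT X (p \o s) _ aw)).
Qed.

Lemma amalgam_iso : lpa_iso K G H.
Proof.
apply: (lpa_iso_family famG famH) => f g fM gM fvE feE fgE gvE geE ggE.
have gfv v : g (fv v) = lpa_vertex K G v.
  rewrite CK2G linear_sum (partition_big (fun a : 'E => (val a).1) (fun q => s q == v))//=.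
  apply: eq_bigr => q /eqP qv; rewrite gM geE ggE ge_gg; apply: eq_bigl => a.
  by case: ((val a).1 =P q) => [->|_]; rewrite ?andbF// qv eqxx.
have ge_vertex (a : 'E) : ge (val a).1 * lpa_vertex K G (val a).2 = x a.
  rewrite mulr_suml (bigD1 a)//= (@edge_rng K V _ G a) big1 ?addr0// => b /andP[/eqP ba bna].
  rewrite edge_vertex/=; case: eqP => // ba2; case/eqP: bna; apply: val_inj.
  by case: a b ba ba2 => [[? ?] ?] [[? ?] ?] /= -> ->.
have vertex_gg (a : 'E) : lpa_vertex K G (val a).2 * gg (val a).1 = x' a.
  rewrite mulr_sumr (bigD1 a)//= (@rng_ghost K V _ G a) big1 ?addr0// => b /andP[/eqP ba bna].
  rewrite vertex_ghost/=; case: eqP => // ba2; case/eqP: bna; apply: val_inj.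
  by case: a b ba ba2 => [[? ?] ?] [[? ?] ?] /= -> <-.
split=> [|a|a|]; rewrite ?gM ?geE ?ggE ?gfv//.
split=> [w|q|q]; rewrite linear_sum/=.
- by under eq_bigr do rewrite fvE; rewrite -sum_gv.
- under eq_bigr do rewrite feE.
  rewrite (sum_split (pred1 q) (fun q u => y q * fv u)) big_pred1_eq -mulr_sumr -sum_gv.
  by rewrite (@edge_rng K V' _ H q).
- under eq_bigr do rewrite fgE.
  rewrite (sum_split (pred1 q) (fun q u => fv u * y' q)) big_pred1_eq -mulr_suml -sum_gv.
  by rewrite (@rng_ghost K V' _ H q).
Qed.

End Amalgamation.

(** Rows that are constant on the fibres of [p] are the shape of an out-split; [X] realizes the
    multiplicities [Q] as edges from [V] to [V']. *)
Lemma row_amalgam (K : fieldType) (V V' : finType) (p : V -> V')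
    (Q : V -> {ffun V' -> nat}) :
  (forall w, exists v, p v = w) -> (forall v, Q v != 0) ->
  row_iso K (fun v => [ffun u => Q v (p u)]) (fun w => \sum_(v | p v == w) Q v).
Proof.
move=> p_surj Q0; pose X := {a : V * V' & 'I_(Q a.1 a.2)}.
pose s (q : X) := (tag q).1; pose r (q : X) := (tag q).2.
have emits v : exists q, s q = v.
  have [w qw] : exists w, Q v w != 0.
    apply/existsP; apply: contra_neqT (Q0 v); rewrite negb_exists => /forallP Qv.
    by apply/ffunP => k; rewrite ffunE; apply/eqP; have := Qv k; rewrite negbK.
  have h : (0 < Q (v, w).1 (v, w).2)%N by rewrite lt0n.
  by exists (existT _ (v, w) (Ordinal h)).
have cnt (P : pred (V * V')) : (\sum_(q : X | P (tag q)) 1 = \sum_(a | P a) Q a.1 a.2)%N.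
  have -> : (\sum_(a | P a) Q a.1 a.2 = \sum_(a | P a) \sum_(t : 'I_(Q a.1 a.2)) 1)%N.
    by apply: eq_bigr => a _; rewrite sum1_card card_ord.
  rewrite (sig_big_dep P (fun _ _ => true) (fun _ _ => 1%N))/=.
  by apply: eq_bigl => -[a t]; rewrite andbT.
apply: lpa_iso_trans (lpa_iso_trans (amalgam_iso K r p_surj emits) _).
  apply/lpa_iso_sym/lpa_iso_count => v u; rewrite ffunE /edge_count/=.
  transitivity (\sum_(q : X | (fun a => (a.1 == v) && (a.2 == p u)) (tag q)) 1)%N.
    rewrite big_mkcond/=.
    rewrite -(sum_sig (fun a : X * V => r a.1 == p a.2)
      (fun a => if (s a.1 == v) && (a.2 == u) then 1%N else 0%N)) -big_mkcondr/=.
    rewrite (reindex_onto (fun q => (q, u)) fst)/=; last by case=> a b /= /and3P[_ _ /eqP ->].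
    by apply: eq_bigl => q; rewrite !eqxx !andbT andbC.
  rewrite (cnt (fun a => (a.1 == v) && (a.2 == p u))) (big_pred1 (v, p u))//.
apply: lpa_iso_count => w w'; rewrite /edge_count/= sum_ffunE.
rewrite (cnt (fun a => (p a.1 == w) && (a.2 == w'))).
rewrite (reindex_onto (fun v => (v, w')) fst) /=; last by move=> [a b] /= /andP[_ /eqP ->].
by apply: eq_bigl => v; rewrite !eqxx !andbT.
Qed.

(** * Three vertices and integer matrices *)

Section ThreeVertices.
Variable K : fieldType.
Local Notation row_iso := (row_iso K).

Lemma row_expand (V : finType) (m : V -> {ffun V -> nat}) i j c s :
  i != j -> m j != 0 -> m i = delta j *+ c + s ->
  row_iso m (set_row m i (m j *+ c + s)).
Proof.
by move=> ij mj; apply: row_cong_iso; apply: row_congDr; apply: row_congMn; apply: row_cong_step.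
Qed.

Lemma row_collapse (V : finType) (m : V -> {ffun V -> nat}) i j c s :
  i != j -> m j != 0 -> m i = m j *+ c + s ->
  row_iso m (set_row m i (delta j *+ c + s)).
Proof.
move=> ij mj; apply: row_cong_iso; apply: row_congDr; apply: row_congMn.
exact/row_cong_sym/row_cong_step.
Qed.

Definition row3 (a b c : nat) : {ffun 'I_3 -> nat} := [ffun k : 'I_3 => nth 0%N [:: a; b; c] k].
Definition row4 (a b c d : nat) : {ffun 'I_4 -> nat} :=
  [ffun k : 'I_4 => nth 0%N [:: a; b; c; d] k].

Local Notation i0 := (@Ordinal 3 0 isT).
Local Notation i1 := (@Ordinal 3 1 isT).
Local Notation i2 := (@Ordinal 3 2 isT).

Definition state3 (x0 x1 x2 y0 y1 y2 : nat) : 'I_3 -> {ffun 'I_3 -> nat} :=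
  fun i => nth 0 [:: row3 2 1 1; row3 x0 x1 x2; row3 y0 y1 y2] i.

Lemma row3_neq0 a b c : (0 < a)%N || (0 < b)%N || (0 < c)%N -> row3 a b c != 0.
Proof.
move=> h; apply/eqP => /ffunP E.
by have := (E i0, E i1, E i2); rewrite !ffunE/= => -[[a0 b0] c0]; move: h; rewrite a0 b0 c0.
Qed.

(* [u1 = u1 + w] with [w = u1 + u2 + u3]; modulo multiples of [w], which the
   first row absorbs, the other two rows are [u2 = u2 + a u2 + b u3] and
   [u3 = u3 + c u2 + d u3]. *)
Definition presents (a b c d : int) (x0 x1 x2 y0 y1 y2 : nat) : Prop :=
  [/\ (0 < x0)%N, (0 < y0)%N & [/\ x1%:Z - x0%:Z = 1 + a, x2%:Z - x0%:Z = b,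
    y1%:Z - y0%:Z = c & y2%:Z - y0%:Z = 1 + d]].

Ltac ord3 := apply/funext => -[[|[|[|//]]] ?]; apply/ffunP => -[[|[|[|//]]] ?];
  rewrite /state3 /set_row /row3 /delta ?ffunE /= ?ffunMnE ?ffunE /= ?ffunE /= ; try lia.

(** Replacing one [u_1] in the second row by [2 u_1 + u_2 + u_3] adds [w] to that row; [x0 > 0]
    provides the occurrence. *)
Lemma state3_add2 x0 x1 x2 y0 y1 y2 N : (0 < x0)%N ->
  row_iso (state3 x0 x1 x2 y0 y1 y2) (state3 (x0 + N) (x1 + N) (x2 + N) y0 y1 y2).
Proof.
elim: N x0 x1 x2 => [|N IH] x0 x1 x2 x0_gt0; first by rewrite !addn0; exact: row_iso_refl.
rewrite !addnS -!addSn; apply: row_iso_trans (IH _ _ _ _) => //.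
have -> : state3 x0.+1 x1.+1 x2.+1 y0 y1 y2 =
    set_row (state3 x0 x1 x2 y0 y1 y2) i1 (row3 2 1 1 *+ 1 + row3 x0.-1 x1 x2).
  by ord3.
apply: (@row_expand _ _ i1 i0); rewrite //=; first exact: row3_neq0.
by apply/ffunP => -[[|[|[|//]]] ?]; rewrite !ffunE/= ?ffunE/=; lia.
Qed.

Lemma state3_neq0 x0 x1 x2 y0 y1 y2 i : (0 < x0)%N -> (0 < y0)%N ->
  state3 x0 x1 x2 y0 y1 y2 i != 0.
Proof. by move=> hx hy; case: i => -[|[|[|//]]] ?; apply: row3_neq0; rewrite ?hx ?hy. Qed.

Definition swap12 (i : 'I_3) : 'I_3 := nth i0 [:: i0; i2; i1] i.

Lemma swap12K : involutive swap12.
Proof. by case=> -[|[|[|//]]] ?; apply: val_inj. Qed.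

Lemma state3_swap x0 x1 x2 y0 y1 y2 : (0 < x0)%N -> (0 < y0)%N ->
  row_iso (state3 x0 x1 x2 y0 y1 y2) (state3 y0 y2 y1 x0 x2 x1).
Proof.
move=> hx hy; have := @row_amalgam K _ _ swap12 (fun v => state3 y0 y2 y1 x0 x2 x1 (swap12 v)).
move=> /(_ (fun w => ex_intro _ (swap12 w) (swap12K w)) (fun w => state3_neq0 _ _ _ _ _ hy hx)).
have -> : (fun v => [ffun u => state3 y0 y2 y1 x0 x2 x1 (swap12 v) (swap12 u)]) =
    state3 x0 x1 x2 y0 y1 y2 by ord3.
have -> // : (fun w => \sum_(v | swap12 v == w) state3 y0 y2 y1 x0 x2 x1 (swap12 v)) =
    state3 y0 y2 y1 x0 x2 x1.
apply/funext => w; rewrite (big_pred1 (swap12 w)) ?swap12K// => v /=.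
by rewrite (can2_eq swap12K swap12K).
Qed.

Lemma state3_add3 x0 x1 x2 y0 y1 y2 N : (0 < x0)%N -> (0 < y0)%N ->
  row_iso (state3 x0 x1 x2 y0 y1 y2) (state3 x0 x1 x2 (y0 + N) (y1 + N) (y2 + N)).
Proof.
move=> hx hy; apply: row_iso_trans (state3_swap _ _ _ _ hx hy) _.
apply: row_iso_trans (state3_add2 _ _ _ _ _ N hy) _.
by apply: state3_swap; rewrite // addn_gt0 hy.
Qed.

(** Rows that present the same integers differ by a multiple of [w], so adding [x0'] copies of [w]
    to one and [x0] copies to the other makes them equal. *)
Lemma presents_uniq a b c d x0 x1 x2 y0 y1 y2 x0' x1' x2' y0' y1' y2' :
  presents a b c d x0 x1 x2 y0 y1 y2 -> presents a b c d x0' x1' x2' y0' y1' y2' ->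
  row_iso (state3 x0 x1 x2 y0 y1 y2) (state3 x0' x1' x2' y0' y1' y2').
Proof.
case=> hx hy [h1 h2 h3 h4] [hx' hy' [h1' h2' h3' h4']].
apply: row_iso_trans (state3_add2 _ _ _ _ _ x0' hx) _.
apply: row_iso_trans (state3_add3 _ _ _ _ y0' _ hy) _; first by rewrite addn_gt0 hx.
apply: row_iso_sym.
apply: row_iso_trans (state3_add2 _ _ _ _ _ x0 hx') _.
apply: row_iso_trans (state3_add3 _ _ _ _ y0 _ hy') _; first by rewrite addn_gt0 hx'.
have <- : state3 (x0 + x0') (x1 + x0') (x2 + x0') (y0 + y0') (y1 + y0') (y2 + y0') =
  state3 (x0' + x0) (x1' + x0) (x2' + x0) (y0' + y0) (y1' + y0) (y2' + y0).
  by congr state3; lia.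
exact: row_iso_refl.
Qed.

Lemma presents_large a b c d (N : nat) : exists x0 x1 x2 y0 y1 y2 : nat,
  presents a b c d x0 x1 x2 y0 y1 y2 /\ [/\ (N <= x0)%N, (N <= x1)%N, (N <= x2)%N &
    [/\ (N <= y0)%N, (N <= y1)%N & (N <= y2)%N]].
Proof.
pose M := (N + 2 + `|a| + `|b| + `|c| + `|d|)%N.
exists M, (absz (M%:Z + 1 + a)), (absz (M%:Z + b)), M, (absz (M%:Z + c)), (absz (M%:Z + 1 + d)).
by rewrite /presents /M; split; split=> //; try split; lia.
Qed.

(** Quantifying over all presentations lets a chain of moves forget the natural numbers;
    [presents_large] provides presentations with entries as large as a move requires. *)
Definition same_algebra (a b c d a' b' c' d' : int) : Prop :=
  forall x0 x1 x2 y0 y1 y2 x0' x1' x2' y0' y1' y2',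
    presents a b c d x0 x1 x2 y0 y1 y2 ->
    presents a' b' c' d' x0' x1' x2' y0' y1' y2' ->
    row_iso (state3 x0 x1 x2 y0 y1 y2) (state3 x0' x1' x2' y0' y1' y2').

Lemma same_algebra_intro a b c d a' b' c' d' x0 x1 x2 y0 y1 y2 x0' x1' x2' y0' y1' y2' :
  presents a b c d x0 x1 x2 y0 y1 y2 ->
  presents a' b' c' d' x0' x1' x2' y0' y1' y2' ->
  row_iso (state3 x0 x1 x2 y0 y1 y2) (state3 x0' x1' x2' y0' y1' y2') ->
  same_algebra a b c d a' b' c' d'.
Proof.
move=> h h' e ? ? ? ? ? ? ? ? ? ? ? ? p p'.
exact: row_iso_trans (presents_uniq p h) (row_iso_trans e (presents_uniq h' p')).
Qed.

Lemma same_algebra_refl a b c d : same_algebra a b c d a b c d.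
Proof. by move=> ? ? ? ? ? ? ? ? ? ? ? ?; apply: presents_uniq. Qed.

Lemma same_algebra_sym a b c d a' b' c' d' :
  same_algebra a b c d a' b' c' d' -> same_algebra a' b' c' d' a b c d.
Proof. by move=> h ? ? ? ? ? ? ? ? ? ? ? ? p p'; apply: row_iso_sym; apply: h. Qed.

Lemma same_algebra_trans a b c d a' b' c' d' a'' b'' c'' d'' :
  same_algebra a b c d a' b' c' d' -> same_algebra a' b' c' d' a'' b'' c'' d'' ->
  same_algebra a b c d a'' b'' c'' d''.
Proof.
move=> h h' ? ? ? ? ? ? ? ? ? ? ? ? p p''.
have [x0 [x1 [x2 [y0 [y1 [y2 [p' _]]]]]]] := presents_large a' b' c' d' 0.
exact: row_iso_trans (h _ _ _ _ _ _ _ _ _ _ _ _ p p') (h' _ _ _ _ _ _ _ _ _ _ _ _ p' p'').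
Qed.

Lemma same_algebra_swap a b c d : same_algebra a b c d d c b a.
Proof.
have [x0 [x1 [x2 [y0 [y1 [y2 [p _]]]]]]] := presents_large a b c d 0.
have [hx hy [h1 h2 h3 h4]] := p.
by apply: same_algebra_intro p _ (state3_swap _ _ _ _ hx hy).
Qed.

(** One [u_3] in the second row is replaced by the third row. Losing that occurrence cancels the [1]
    in [y2 - y0 = 1 + d]. *)
Lemma same_algebra_row a b c d : same_algebra a b c d (a + c) (b + d) c d.
Proof.
have [x0 [x1 [x2 [y0 [y1 [y2 [p]]]]]]] := presents_large a b c d 1.
case=> l0 l1 l2 [l3 l4 l5]; have [_ _ [h1 h2 h3 h4]] := p.
apply: same_algebra_intro p _ (_ : row_iso _
  (state3 (x0 + y0) (x1 + y1) (x2.-1 + y2) y0 y1 y2)); first by split; try split; lia.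
have -> : state3 (x0 + y0) (x1 + y1) (x2.-1 + y2) y0 y1 y2 =
    set_row (state3 x0 x1 x2 y0 y1 y2) i1 (row3 y0 y1 y2 *+ 1 + row3 x0 x1 x2.-1).
  by ord3.
apply: (@row_expand _ _ i1 i2); rewrite //=; first by apply: row3_neq0; rewrite l3.
by apply/ffunP => -[[|[|[|//]]] ?]; rewrite !ffunE/= ?ffunE/=; lia.
Qed.

Definition split0 (i : 'I_4) : 'I_3 := nth i0 [:: i0; i0; i1; i2] i.
Definition split1 (i : 'I_4) : 'I_3 := nth i0 [:: i0; i1; i1; i2] i.

Definition state4 (r0 r1 r2 r3 : {ffun 'I_4 -> nat}) : 'I_4 -> {ffun 'I_4 -> nat} :=
  fun i => nth 0 [:: r0; r1; r2; r3] i.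

Ltac ord4 := apply/funext => -[[|[|[|[|//]]]] ?]; apply/ffunP => -[[|[|[|[|//]]]] ?];
  rewrite /state4 /set_row /row4 /row3 /delta ?ffunE /= ?ffunMnE ?ffunE /= ?ffunE /= ; try lia.

Local Notation j1 := (@Ordinal 4 1 isT).
Local Notation j3 := (@Ordinal 4 3 isT).

(** The vertex [j1] emits a single edge, to [j3], so in any other row the two are
    interchangeable. *)
Lemma state4_shift (m : 'I_4 -> {ffun 'I_4 -> nat}) i a b c d c' :
  i != j1 -> m j1 = row4 0 0 0 1 -> m i = row4 a (b + c)%N c' d ->
  row_iso m (set_row m i (row4 a b c' (d + c)%N)).
Proof.
move=> ij m1 mi.
have -> : row4 a b c' (d + c) = m j1 *+ c + row4 a b c' d.
  by rewrite m1; apply/ffunP => -[[|[|[|[|//]]]] ?]; rewrite !ffunE/= ?ffunMnE ?ffunE/=; lia.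
apply: row_expand => //.
  by rewrite m1; apply/eqP => /ffunP/(_ j3); rewrite !ffunE.
by rewrite mi; apply/ffunP => -[[|[|[|[|//]]]] ?]; rewrite !ffunE/= ?ffunMnE ?ffunE/=; lia.
Qed.

Lemma state4_balance (m : 'I_4 -> {ffun 'I_4 -> nat}) i a b c d b' d' :
  i != j1 -> m j1 = row4 0 0 0 1 -> m i = row4 a b c d -> (b + d = b' + d')%N ->
  row_iso m (set_row m i (row4 a b' c d')).
Proof.
move=> ij m1 mi bd; have [b'b|bb'] := leqP b' b.
  have -> : d' = (d + (b - b'))%N by lia.
  by apply: state4_shift; rewrite ?subnKC.
have {1}-> : m = set_row (set_row m i (row4 a b' c d')) i (row4 a b c (d' + (b' - b))).
  have -> : (d' + (b' - b) = d)%N by lia.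
  by rewrite set_row2 -mi set_row_id.
by apply/row_iso_sym/state4_shift; [|rewrite set_rowNE|rewrite set_rowE subnKC// ltnW].
Qed.

(* Split [u1 = 2 u1 + u2 + u3] into [y1 = 2 y1 + 2 y2 + u2] and [y2 = u3]; exchanging
   y2 and u3 inside the other rows equalizes the columns of y2 and u2, and merging
   those two makes [u2 + u3] the new second vertex. *)
Lemma same_algebra_col a b c d : same_algebra a b c d a (b - a) c (d - c).
Proof.
(* The bound keeps [x2 + x0 - x1] and [y2 + y0 - y1] from truncating, as [x1 - x0 = 1 + a] and
   [y1 - y0 = c]. *)
have [x0 [x1 [x2 [y0 [y1 [y2 [p]]]]]]] := presents_large a b c d (1 + `|a| + `|c|).
case=> l0 l1 l2 [l3 l4 l5]; have [hx hy [h1 h2 h3 h4]] := p.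
apply: same_algebra_intro p _ (_ : row_iso _
  (state3 x0 x1 (x2 + x0 - x1).+1 y0 y1 (y2 + y0 - y1))); first by split; try split; lia.
(* Adding rows over the fibres of [split0] in [Q0] gives the given state; over those of [split1] in
   [Q1] it gives the new one, where the row [0 0 1] of [y2] contributes the successor in the third
   column. *)
pose Q0 (i : 'I_4) := nth 0 [:: row3 2 1 0; row3 0 0 1; row3 x0 x1 x2; row3 y0 y1 y2] i.
pose Q1 (i : 'I_4) := nth 0 [:: row3 2 1 1; row3 0 0 1; row3 x0 x1 (x2 + x0 - x1);
  row3 y0 y1 (y2 + y0 - y1)] i.
have Q0_neq0 i : Q0 i != 0.
  by case: i => -[|[|[|[|//]]]] ?; apply: row3_neq0; rewrite ?hx ?hy.
have Q1_neq0 i : Q1 i != 0.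
  by case: i => -[|[|[|[|//]]]] ?; apply: row3_neq0; rewrite ?hx ?hy.
have surj0 w : exists v, split0 v = w.
  by case: w => -[|[|[|//]]] ?; [exists ord0|exists (inord 2)|exists (inord 3)];
    apply: val_inj; rewrite /split0/= ?inordK.
have surj1 w : exists v, split1 v = w.
  by case: w => -[|[|[|//]]] ?; [exists ord0|exists (inord 2)|exists (inord 3)];
    apply: val_inj; rewrite /split1/= ?inordK.
have := row_amalgam K surj0 Q0_neq0; have := row_amalgam K surj1 Q1_neq0.
have -> : (fun w => \sum_(v | split0 v == w) Q0 v) = state3 x0 x1 x2 y0 y1 y2.
  apply/funext => w; rewrite big_mkcond !big_ord_recl big_ord0.
  case: w => -[|[|[|//]]] ?; apply/ffunP => -[[|[|[|//]]] ?];
  by rewrite /state3 /row3/= ?ffunE/= ?ffunE/= ?ffunE/=; lia.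
have -> : (fun w => \sum_(v | split1 v == w) Q1 v) =
    state3 x0 x1 (x2 + x0 - x1).+1 y0 y1 (y2 + y0 - y1).
  apply/funext => w; rewrite big_mkcond !big_ord_recl big_ord0.
  case: w => -[|[|[|//]]] ?; apply/ffunP => -[[|[|[|//]]] ?];
  by rewrite /state3 /row3/= ?ffunE/= ?ffunE/= ?ffunE/=; lia.
have -> : (fun v => [ffun u => Q0 v (split0 u)]) =
   state4 (row4 2 2 1 0) (row4 0 0 0 1) (row4 x0 x0 x1 x2) (row4 y0 y0 y1 y2) by ord4.
have -> : (fun v => [ffun u => Q1 v (split1 u)]) =
   state4 (row4 2 1 1 1) (row4 0 0 0 1) (row4 x0 x1 x1 (x2 + x0 - x1))
          (row4 y0 y1 y1 (y2 + y0 - y1)) by ord4.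
move=> iso1 iso0; apply: row_iso_trans (row_iso_sym iso0) (row_iso_trans _ iso1).
apply: row_iso_trans (@state4_balance _ ord0 2 2 1 0 1 1 _ _ _ _) _ => //.
apply: row_iso_trans
  (@state4_balance _ (@Ordinal 4 2 isT) x0 x0 x1 x2 x1 (x2 + x0 - x1) _ _ _ _) _ => //.
  by lia.
apply: row_iso_trans
  (@state4_balance _ j3 y0 y0 y1 y2 y1 (y2 + y0 - y1) _ _ _ _) _ => //.
  by lia.
rewrite [X in _ X _](_ : _ = state4 (row4 2 1 1 1) (row4 0 0 0 1)
  (row4 x0 x1 x1 (x2 + x0 - x1)) (row4 y0 y1 y1 (y2 + y0 - y1))).
  exact: row_iso_refl.
by apply/funext => -[[|[|[|[|//]]]] ?].
Qed.

End ThreeVertices.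

(** * Smith form of the 2 x 2 matrix *)

Section Smith.
Variable K : fieldType.
Local Notation same_algebra := (same_algebra K).

Lemma same_algebra_rowZ (a b c d k : int) :
  same_algebra a b c d a b (c + k * a) (d + k * b).
Proof.
have row2 : forall c d, same_algebra a b c d a b (c + a) (d + b).
  move=> {}c {}d.
  apply: same_algebra_trans (@same_algebra_swap _ _ _ _ _) _.
  apply: same_algebra_trans (@same_algebra_row _ _ _ _ _) _.
  exact: same_algebra_swap.
have pos (n : nat) : forall c d, same_algebra a b c d a b (c + n%:Z * a) (d + n%:Z * b).
  elim: n => [|n IH] c0 d0; first by rewrite !mul0r !addr0; exact: same_algebra_refl.
  apply: same_algebra_trans (IH _ _) _.
  by have := row2 (c0 + n%:Z * a) (d0 + n%:Z * b);
    congr same_algebra; rewrite intS mulrDl mul1r; ring.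
case: k => n; first exact: pos.
apply: same_algebra_sym; have := pos n.+1 (c + Negz n * a) (d + Negz n * b).
by congr same_algebra; rewrite NegzE; ring.
Qed.

(** Column moves watched on the first row only. The second row is existential and controlled by the
    determinant and by the divisors common to its entries, which is all that the Smith form asks of
    it. *)
Definition col_reduces (a b c d a' b' : int) := exists c' d',
  [/\ same_algebra a b c d a' b' c' d', a * d - b * c = a' * d' - b' * c' &
    forall e, (e %| c)%Z -> (e %| d)%Z -> (e %| c')%Z /\ (e %| d')%Z].

Lemma col_reduces_refl a b c d : col_reduces a b c d a b.
Proof. by exists c, d; split=> //; exact: same_algebra_refl. Qed.

Lemma col_reduces_trans a b c d a' b' a'' b'' : col_reduces a b c d a' b' ->
  (forall c' d', col_reduces a' b' c' d' a'' b'') -> col_reduces a b c d a'' b''.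
Proof.
case=> c' [d' [s1 e1 h1]] /(_ c' d')[c'' [d'' [s2 e2 h2]]]; exists c'', d''.
split; [exact: same_algebra_trans s1 s2|by rewrite e1|].
by move=> e ec ed; have [? ?] := h1 e ec ed; exact: h2.
Qed.

Lemma col_reduces_subr a b c d : col_reduces a b c d a (b - a).
Proof.
exists c, (d - c); split; [exact: same_algebra_col|ring|] => e ec ed.
by split=> //; rewrite rpredB.
Qed.

Lemma col_reduces_addr a b c d : col_reduces a b c d a (b + a).
Proof.
exists c, (d + c); split; [|ring|] => [|e ec ed]; last by split=> //; rewrite rpredD.
have := @same_algebra_col K a (b + a) c (d + c); rewrite !addrK.
exact: same_algebra_sym.
Qed.

Lemma col_reduces_subl a b c d : col_reduces a b c d (a - b) b.
Proof.
exists (c - d), d; split; [|ring|] => [|e ec ed]; last by split=> //; rewrite rpredB.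
apply: same_algebra_trans (@same_algebra_swap _ _ _ _ _) _.
apply: same_algebra_trans (@same_algebra_col _ _ _ _ _) _.
exact: same_algebra_swap.
Qed.

Lemma col_reduces_addl a b c d : col_reduces a b c d (a + b) b.
Proof.
exists (c + d), d; split; [|ring|] => [|e ec ed]; last by split=> //; rewrite rpredD.
apply: same_algebra_sym; apply: same_algebra_trans (@same_algebra_swap _ _ _ _ _) _.
apply: same_algebra_trans (@same_algebra_col _ _ _ _ _) _; rewrite !addrK.
exact: same_algebra_swap.
Qed.

(** The moves have determinant 1, so the sign changes by way of [(a, 0)], [(a, a)], [(0, a)],
    [(-a, a)], [(-a, 0)]. *)
Lemma col_reduces_norm a c d : col_reduces a 0 c d `|a| 0.
Proof.
have [a0|a0] := lerP 0 a; first by rewrite ger0_norm//; exact: col_reduces_refl.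
rewrite ltr0_norm//.
apply: col_reduces_trans (col_reduces_addr _ _ _ _) _ => ? ?.
apply: col_reduces_trans (col_reduces_subl _ _ _ _) _ => ? ?.
apply: col_reduces_trans (col_reduces_subl _ _ _ _) _ => ? ?.
apply: col_reduces_trans (col_reduces_addr _ _ _ _) _ => ? ?.
rewrite (_ : a - _ - _ = - a); last by ring.
by rewrite (_ : 0 + a + - a = 0); [exact: col_reduces_refl|ring].
Qed.

(** Euclid's algorithm by single additions or subtractions, chosen by the signs so that [|a| + |b|]
    decreases. When [a = 0] no move decreases it, and [b] is brought directly to the first
    column. *)
Lemma col_reduces_gcd a b c d : col_reduces a b c d (gcdz a b) 0.
Proof.
have [N] := ubnP (`|a| + `|b|)%N; elim: N => // N IH in a b c d * => abN.
have [->|b0] := eqVneq b 0; first by rewrite gcdz0; exact: col_reduces_norm.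
have gDl (k : int) : gcdz (k * b + a) b = gcdz a b.
  by rewrite gcdzC gcdzMDl [gcdz b a]gcdzC.
have gDr (k : int) : gcdz a (k * a + b) = gcdz a b by rewrite gcdzMDl.
have [->|a0] := eqVneq a 0.
  rewrite gcd0z; apply: col_reduces_trans (col_reduces_addl _ _ _ _) _ => c1 d1.
  apply: col_reduces_trans (col_reduces_subr _ _ _ _) _ => c2 d2.
  by rewrite add0r subrr; exact: col_reduces_norm.
have [ab|ab] := leqP `|a|%N `|b|%N.
  have [sg|sg] := boolP ((0 < a) == (0 < b)).
    rewrite -(gDr (-1)) mulN1r addrC.
    by apply: col_reduces_trans (col_reduces_subr _ _ _ _) _ => c' d'; apply: IH; lia.
  rewrite -(gDr 1) mul1r addrC.
  by apply: col_reduces_trans (col_reduces_addr _ _ _ _) _ => c' d'; apply: IH; lia.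
have [sg|sg] := boolP ((0 < a) == (0 < b)).
  rewrite -(gDl (-1)) mulN1r addrC.
  by apply: col_reduces_trans (col_reduces_subl _ _ _ _) _ => c' d'; apply: IH; lia.
rewrite -(gDl 1) mul1r addrC.
by apply: col_reduces_trans (col_reduces_addl _ _ _ _) _ => c' d'; apply: IH; lia.
Qed.

(** When the first row has become [(g, 0)], [g] still divides the lower left entry, which a row move
    clears; the determinant then forces the last entry to be [h]. *)
Lemma same_algebra_smith a b c d h : gcdz a b != 0 ->
  (gcdz a b %| c)%Z -> (gcdz a b %| d)%Z -> a * d - b * c = gcdz a b * h ->
  same_algebra a b c d (gcdz a b) 0 0 h.
Proof.
move=> g0 gc gd; have [c' [d' [s -> /(_ _ gc gd)[gc' _]]]] := col_reduces_gcd a b c d.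
rewrite mul0r subr0 => /(mulfI g0) d'h; apply: same_algebra_trans s _.
have := @same_algebra_rowZ (gcdz a b) 0 c' d' (- (c' %/ gcdz a b)%Z).
by rewrite mulNr divzK// subrr mulr0 addr0 d'h.
Qed.

End Smith.

(** * Reduction of C_n^2 to three vertices *)

#[local] Arguments fib _ : simpl never.

Lemma fibSS n : fib n.+2 = (fib n.+1 + fib n)%N. Proof. by []. Qed.

Lemma fib_gt0 n : (0 < fib n.+1)%N.
Proof. by elim: n => // n IH; rewrite fibSS addn_gt0 IH. Qed.

Lemma sum_fib n : (\sum_(i < n) fib i.+1 = fib n.+2 - 1)%N.
Proof.
elim: n => [|n IH]; first by rewrite big_ord0.
by rewrite big_ord_recr/= IH (fibSS n.+1); have := fib_gt0 n.+1; lia.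
Qed.

Lemma sum_fib2 n : (\sum_(i < n) fib i.+2 = fib n.+3 - 2)%N.
Proof.
elim: n => [|n IH]; first by rewrite big_ord0.
rewrite big_ord_recr/= IH (fibSS n.+2).
by have := fib_gt0 n; have := fib_gt0 n.+1; rewrite (fibSS n.+1) (fibSS n); lia.
Qed.

Definition Cn2_rows n (i : 'I_n) : {ffun 'I_n -> nat} := delta (ordS i) + delta (ordS (ordS i)).

Lemma Cn2_row_graph (K : fieldType) n : lpa_iso K (Cn2 n) (row_graph (@Cn2_rows n)).
Proof.
apply: lpa_iso_count => i k; rewrite /edge_count big_sumType/= !ffunE.
have sum1 (h : 'I_n -> 'I_n) : (\sum_(j | (j == i) && (h j == k)) 1 = (k == h i))%N.
  rewrite big_mkcondr/= big_pred1_eq eq_sym; by case: (_ == _).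
by congr addn; apply: sum1.
Qed.

Section Elimination.
Variables (K : fieldType) (k : nat).
Local Notation n := k.+3.
Local Notation row_iso := (row_iso K).
Let a : 'I_n := inord k.+1.
Let b : 'I_n := inord k.+2.
Let aE : a = k.+1 :> nat. Proof. by rewrite inordK. Qed.
Let bE : b = k.+2 :> nat. Proof. by rewrite inordK. Qed.

(* Eliminating v_k, ..., v_0 in this order writes vertex i as [f i]. *)
Let f (i : nat) : {ffun 'I_n -> nat} := delta a *+ fib (k.+2 - i) + delta b *+ fib (k.+1 - i).

Let f_rec i : (i.+2 <= k.+1)%N -> f i = f i.+1 + f i.+2.
Proof.
move=> ik; rewrite /f.
have -> : (k.+2 - i = (k.+1 - i.+1).+2)%N by lia.
have -> : (k.+1 - i = (k - i.+1).+2)%N by lia.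
have -> : (k.+2 - i.+1 = (k.+1 - i.+1).+1)%N by lia.
have -> : (k.+2 - i.+2 = (k.+1 - i.+1))%N by lia.
have -> : (k.+1 - i.+1 = (k - i.+1).+1)%N by lia.
have -> : (k.+1 - i.+2 = (k - i.+1))%N by lia.
by rewrite !(fibSS _) !mulrnDr addrACA.
Qed.

Let f_last : f k.+1 = delta a.
Proof. by rewrite /f subSnn subnn mulr1n mulr0n addr0. Qed.

Let f_neq0 i : (i <= k.+1)%N -> f i != 0.
Proof.
move=> ik; apply/eqP => /ffunP/(_ a); rewrite !ffunE !ffunMnE !ffunE eqxx.
have -> : (k.+2 - i = (k.+1 - i).+1)%N by lia.
have := fib_gt0 (k.+1 - i); lia.
Qed.

(** The rows after [t] eliminations: those of the [t] vertices just before [a] are already expressed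
    through [a] and [b]. *)
Let partial t (i : 'I_n) : {ffun 'I_n -> nat} :=
  if (k.+1 - t <= i < k.+1)%N then f i else Cn2_rows i.

Let ordSE (i : 'I_n) : (i < k.+2)%N -> ordS i = i.+1 :> nat.
Proof. by move=> ik /=; rewrite modn_small. Qed.

(** Either [j] has been eliminated and its row is [f j], or [j = a] and [f j] is [delta a]
    itself. *)
Let reach m (i j : 'I_n) : ((j < k.+1)%N -> m j = f j) -> (j <= k.+1)%N -> i != j ->
  row_cong K m i (delta j) (f j).
Proof.
move=> mj jk ij; have [jk'|jk'] := ltnP j k.+1.
  by rewrite -mj//; apply: row_cong_step; rewrite // mj// f_neq0.
have -> : j = a by apply: val_inj => /=; rewrite aE; lia.
by rewrite aE f_last; apply: row_cong_refl.
Qed.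

Let partial_eq t (j : 'I_n) : (k.+1 - t <= j)%N -> (j < k.+1)%N -> partial t j = f j.
Proof. by rewrite /partial => -> ->. Qed.

Let partial_step t : (t < k.+1)%N -> row_iso (partial t) (partial t.+1).
Proof.
move=> tk; pose i : 'I_n := inord (k - t).
have iE : i = (k - t)%N :> nat by rewrite inordK; lia.
have pE : partial t.+1 = set_row (partial t) i (f i).
  apply/funext => j; rewrite /set_row /partial; case: eqP => [->|/eqP ji].
    by rewrite iE subSS leqnn /= ltnS leq_subr.
  have : (j != i :> nat) by []; rewrite iE => {}ji.
  by congr (if _ then _ else _); congr andb; lia.
rewrite pE; apply: row_cong_iso (_ : row_cong _ _ _ (Cn2_rows i) _) _; last first.
  by rewrite /partial iE; case: ifP => //; lia.
have Si : ordS i = (k - t).+1 :> nat by rewrite ordSE iE; lia.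
have SSi : ordS (ordS i) = (k - t).+2 :> nat by rewrite ordSE Si; lia.
case: t tk @i iE pE Si SSi => [|t] tk i iE _ Si SSi.
  have -> : f i = Cn2_rows i; last exact: row_cong_refl.
  rewrite /f iE subn0 subSnn (_ : k.+2 - k = 2)%N; last by lia.
  by rewrite /Cn2_rows !mulr1n; congr (delta _ + delta _); apply: ord_inj;
    rewrite ?Si ?SSi ?aE ?bE subn0.
rewrite f_rec; last by rewrite iE; lia.
apply: row_congD.
  rewrite (_ : i.+1 = ordS i); last by rewrite Si iE.
  by apply: reach => [h||]; [apply: partial_eq => //|..];
    rewrite -?(inj_eq (@ord_inj _)) Si ?iE; lia.
rewrite (_ : i.+2 = ordS (ordS i)); last by rewrite SSi iE.
by apply: reach => [h||]; [apply: partial_eq => //|..];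
  rewrite -?(inj_eq (@ord_inj _)) SSi ?iE; lia.
Qed.

Let partial_full : row_iso (@Cn2_rows n) (partial k.+1).
Proof.
have -> : @Cn2_rows n = partial 0.
  by apply/funext => i; rewrite /partial subn0; case: ifP => //; lia.
suff: forall t, (t <= k.+1)%N -> row_iso (partial 0) (partial t) by apply.
elim=> [_|t IH tk]; first exact: row_iso_refl.
by apply: row_iso_trans (IH _) (partial_step tk); exact: ltnW.
Qed.

(** In [C_n^2] the row of [a] is [b + v_0] and that of [b] is [v_0 + v_1]. With [v_0] and [v_1]
    rewritten there, every row is supported on the columns [a] and [b]. *)
Let core (i : 'I_n) : {ffun 'I_n -> nat} :=
  if (i < k.+1)%N then f i else if i == a then f 0 + delta b else f 0 + f 1.

Let core_iso : row_iso (@Cn2_rows n) core.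
Proof.
apply: row_iso_trans partial_full _.
have Sb : ordS b = ord0 by apply: val_inj; rewrite /= bE modnn.
have Sa : ordS a = b by apply: ord_inj; rewrite ordSE aE ?bE.
have S0 : ordS ord0 = inord 1 :> 'I_n by apply: ord_inj; rewrite ordSE ?inordK.
have ab : a != b by rewrite -val_eqE/= aE bE; lia.
have cong0 m i : m ord0 = f 0 -> i = a \/ i = b -> row_cong K m i (delta ord0) (f 0).
  move=> m0 iab; apply: (@reach _ _ ord0) => //; rewrite -(inj_eq (@ord_inj _)).
  by case: iab => ->; rewrite ?aE ?bE.
have p0 : partial k.+1 ord0 = f 0 by apply: partial_eq; rewrite ?subnn.
have conga : row_cong K (partial k.+1) a (Cn2_rows a) (f 0 + delta b).
  by rewrite /Cn2_rows Sa Sb addrC; apply: row_congDr; apply: cong0; [|left].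
have pa : partial k.+1 a = Cn2_rows a by rewrite /partial aE; case: ifP => //; lia.
pose m1 := set_row (partial k.+1) a (f 0 + delta b).
apply: row_iso_trans (row_cong_iso conga pa) _; rewrite -/m1.
have m1b : m1 b = Cn2_rows b.
  by rewrite /m1 set_rowNE// /partial bE; case: ifP => //; lia.
have m1E (j : 'I_n) : (j < k.+1)%N -> m1 j = f j.
  move=> jk; rewrite /m1 set_rowNE ?partial_eq ?subnn//.
  by rewrite -(inj_eq (@ord_inj _)) aE; lia.
have congb : row_cong K m1 b (Cn2_rows b) (f 0 + f 1).
  rewrite /Cn2_rows Sb S0; apply: row_congD; first by apply: cong0; [exact: m1E|right].
  have E1 : (inord 1 : 'I_n) = 1%N :> nat by rewrite inordK.
  rewrite -[X in f X]E1; apply: reach; [exact: m1E|by rewrite E1|].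
  by rewrite -(inj_eq (@ord_inj _)) bE E1.
have -> : core = set_row m1 b (f 0 + f 1).
  apply/funext => i; rewrite /core /set_row -!(inj_eq (@ord_inj _)) aE bE.
  case: ltnP => ik; first by rewrite m1E//; case: eqP => //; lia.
  rewrite /m1 /set_row -!(inj_eq (@ord_inj _)) aE.
  case: (eqVneq (i : nat) k.+1) => ia; first by case: eqP => //; lia.
  by case: eqP => //; have := ltn_ord i; lia.
exact: row_cong_iso congb m1b.
Qed.

(** In [core] the columns of [v_0], ..., [v_k] are all zero, hence equal, so these vertices merge
    into one, numbered 2. *)
Let to3 (i : 'I_n) : 'I_3 := inord (if (i < k.+1)%N then 2 else i - k.+1)%N.

Let to3E (i : 'I_n) : to3 i = (if (i < k.+1)%N then 2 else i - k.+1)%N :> nat.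
Proof.
by rewrite inordK//; case: (ltnP i k.+1) => // ik; have := ltn_ord i; lia.
Qed.

(** The last row is the sum of [f 0], ..., [f k], which is where partial sums of the Fibonacci
    sequence enter. *)
Let core3 (i : 'I_3) : {ffun 'I_3 -> nat} :=
  nth 0 [:: row3 (fib k.+2) (fib k.+1).+1 0; row3 (fib k.+3) (fib k.+2) 0;
            row3 (fib k.+4 - 2) (fib k.+3 - 1) 0] i.

Let fE i (u : 'I_n) : f i u =
  (if u < k.+1 then 0 else if u == k.+1 :> nat then fib (k.+2 - i) else fib (k.+1 - i))%N.
Proof.
rewrite !ffunE !ffunMnE !ffunE -!(inj_eq (@ord_inj _)) aE bE.
by case: ifP => [|/negbT] uk; [|case: ifP => [/eqP ->|]]; have := ltn_ord u; lia.
Qed.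

Let core3_iso : row_iso core core3.
Proof.
pose Q (i : 'I_n) := row3 (core i a) (core i b) 0.
have surj w : exists v, to3 v = w.
  case: w => -[|[|[|//]]] hw; [exists a|exists b|exists ord0]; apply: ord_inj;
    by rewrite to3E; case: (ltnP _ k.+1); rewrite ?aE ?bE /=; lia.
have Q0 i : Q i != 0.
  apply: row3_neq0; rewrite /core; case: ifP => ik.
    by rewrite fE aE ltnn eqxx subSn ?fib_gt0// ltnW.
  by case: ifP => ia; rewrite ffunE fE aE ltnn eqxx subn0 addn_gt0 fib_gt0.
have := row_amalgam K surj Q0.
have core_lt i (u : 'I_n) : (u < k.+1)%N -> core i u = 0%N.
  move=> uk; rewrite /core; case: ifP => _; first by rewrite fE uk.
  case: ifP => _; rewrite ffunE !fE uk//.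
  by rewrite ffunE -(inj_eq (@ord_inj _)) bE; case: eqP => //; lia.
have -> : (fun v => [ffun u => Q v (to3 u)]) = core.
  apply/funext => v; apply/ffunP => u; rewrite ffunE /Q ffunE to3E.
  case: (ltnP u k.+1) => uk; first by rewrite (core_lt v u uk).
  case: (eqVneq (u : nat) k.+1) => ua.
    by rewrite ua subnn/=; congr (core v _); apply: ord_inj; rewrite aE.
  have ub : u = k.+2 :> nat by have := ltn_ord u; lia.
  by rewrite ub subSnn/=; congr (core v _); apply: ord_inj; rewrite bE.
have -> // : (fun w => \sum_(v | to3 v == w) Q v) = core3.
have sumQ (P : pred 'I_n) : \sum_(v | P v) Q v =
    row3 (\sum_(v | P v) core v a) (\sum_(v | P v) core v b) 0.
  apply/ffunP => -[[|[|[|//]]] ?]; rewrite sum_ffunE !ffunE/=; under eq_bigr do rewrite ffunE/=;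
  by rewrite // big1.
have sum3 (w : 'I_3) (F : 'I_n -> nat) : (\sum_(v | to3 v == w) F v =
    \sum_(i < k.+1) (if w == 2 :> nat then F (inord i) else 0) +
    (if w == 0 :> nat then F a else 0) + (if w == 1 :> nat then F b else 0))%N.
  have to3w v : (to3 v == w) = (w == (if v < k.+1 then 2 else v - k.+1)%N :> nat).
    by rewrite -(inj_eq (@ord_inj _)) to3E eq_sym.
  rewrite big_mkcond big_ord_recr big_ord_recr/=; congr (_ + _ + _)%N.
  - apply: eq_bigr => i _.
    have iE : inord i = widen_ord (leqnSn _) (widen_ord (leqnSn _) i) :> 'I_n.
      by apply: ord_inj; rewrite inordK//=; have := ltn_ord i; lia.
    by rewrite iE to3w/= ltn_ord.
  - have -> : widen_ord (leqnSn k.+2) ord_max = a by apply: ord_inj; rewrite aE.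
    by rewrite to3w aE ltnn subnn.
  - have -> : ord_max = b by apply: ord_inj; rewrite bE.
    by rewrite to3w bE ltnNge leqnSn/= subSnn.
have corea : core a = f 0 + delta b by rewrite /core aE ltnn eqxx.
have coreb : core b = f 0 + f 1.
  rewrite /core bE ltnNge leqnSn/=; case: eqP => // /(congr1 (@nat_of_ord _)).
  by rewrite aE bE; lia.
have f0a : f 0 a = fib k.+2 by rewrite fE aE ltnn eqxx.
have f0b : f 0 b = fib k.+1 by rewrite fE bE ltnNge leqnSn/=; case: eqP => //; lia.
have f1a : f 1 a = fib k.+1 by rewrite fE aE ltnn eqxx subSS subn0.
have f1b : f 1 b = fib k by rewrite fE bE ltnNge leqnSn/= !subSS !subn0; case: eqP => //; lia.
have dba : delta b a = 0%N by rewrite ffunE -(inj_eq (@ord_inj _)) aE bE; case: eqP => //; lia.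
have dbb : delta b b = 1%N by rewrite ffunE eqxx.
have coreaa : core a a = fib k.+2 by rewrite corea ffunE f0a dba addr0.
have coreab : core a b = (fib k.+1).+1 by rewrite corea ffunE f0b dbb [LHS]addn1.
have coreba : core b a = fib k.+3 by rewrite coreb ffunE f0a f1a.
have corebb : core b b = fib k.+2 by rewrite coreb ffunE f0b f1b.
apply/funext => w; rewrite sumQ !(sum3 w (core^~ _))/= coreaa coreab coreba corebb /core3.
case: w => -[|[|[|//]]] hw /=; rewrite ?big1_eq ?add0n ?addn0 ?addn1//.
congr row3.
- rewrite -sum_fib2 [RHS](reindex_inj rev_ord_inj)/=; apply: eq_bigr => i _.
  have ik := ltn_ord i; have iE : (inord i : 'I_n) = i :> nat by rewrite inordK//; lia.
  by rewrite /core iE ik fE aE ltnn eqxx; congr fib; lia.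
- rewrite -sum_fib [RHS](reindex_inj rev_ord_inj)/=; apply: eq_bigr => i _.
  have ik := ltn_ord i; have iE : (inord i : 'I_n) = i :> nat by rewrite inordK//; lia.
  rewrite /core iE ik fE bE ltnNge leqnSn/=; case: eqP => [|_]; first by lia.
  by congr fib; lia.
Qed.

(** Replacing one [u_2] by its row makes the first row [(F(k+4), F(k+3), 0)]. This is the third row
    plus [(2, 1, 0)], so collapsing the third row to [u_3] leaves [(2, 1, 1)]. *)
Let core3_state : row_iso core3 (state3 (fib k.+3) (fib k.+2) 0 (fib k.+4 - 2) (fib k.+3 - 1) 0).
Proof.
pose i0 := @Ordinal 3 0 isT; pose i1 := @Ordinal 3 1 isT; pose i2 := @Ordinal 3 2 isT.
have h1 := fib_gt0 k; have h2 := fib_gt0 k.+1; have h3 := fibSS k.+1; have h4 := fibSS k.+2.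
pose m1 := set_row core3 i0 (core3 i1 *+ 1 + row3 (fib k.+2) (fib k.+1) 0).
apply: row_iso_trans (_ : row_iso core3 m1) _.
  apply: row_expand => //; first by apply: row3_neq0; rewrite h2 orbT.
  by apply/ffunP => -[[|[|[|//]]] ?]; rewrite !ffunE/= ?ffunE/=; lia.
have m12 : m1 i2 = core3 i2 by [].
apply: row_iso_trans (@row_collapse K _ m1 i0 i2 1 (row3 2 1 0) _ _ _) _ => //.
- by rewrite m12; apply: row3_neq0; lia.
- by apply/ffunP => -[[|[|[|//]]] ?]; rewrite /m1/= !ffunE/= ?ffunE/= ?ffunE/=; lia.
rewrite [set_row _ _ _](_ : _ = state3 (fib k.+3) (fib k.+2) 0 (fib k.+4 - 2) (fib k.+3 - 1) 0).
  exact: row_iso_refl.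
apply/funext => -[[|[|[|//]]] ?]; apply/ffunP => -[[|[|[|//]]] ?];
  by rewrite /state3 /m1 /set_row /core3 /row3 /delta ?ffunE /= ?ffunE/= ?ffunE/=; lia.
Qed.

Lemma Cn2_state3 : lpa_iso K (Cn2 n)
  (row_graph (state3 (fib k.+3) (fib k.+2) 0 (fib k.+4 - 2) (fib k.+3 - 1) 0)).
Proof.
exact: lpa_iso_trans (Cn2_row_graph K n)
  (row_iso_trans core_iso (row_iso_trans core3_iso core3_state)).
Qed.

End Elimination.

(** * The cases n = 1 and n = 2, where the elimination does not apply *)

Section SmallCycles.
Variable K : fieldType.

Lemma Cn2_rows_two : @Cn2_rows 2 = fun=> [ffun=> 1%N].
Proof. by apply/funext => -[[|[|//]] ?]; apply/ffunP => -[[|[|//]] ?]; rewrite !ffunE. Qed.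

(** [C_1^2] is one vertex with two loops; splitting it with one loop in each part gives [C_2^2]. *)
Lemma Cn2_one_two : row_iso K (@Cn2_rows 1) (@Cn2_rows 2).
Proof.
pose Q (i : 'I_2) : {ffun 'I_1 -> nat} := [ffun=> 1%N].
pose p (_ : 'I_2) : 'I_1 := ord0.
have surj w : exists v, p v = w by exists ord0; apply/esym/ord1.
have Q0 i : Q i != 0 by apply/eqP => /ffunP/(_ ord0); rewrite !ffunE.
have := row_amalgam K surj Q0; rewrite Cn2_rows_two.
have -> : (fun v => [ffun u => Q v (p u)]) = fun _ : 'I_2 => [ffun=> 1%N].
  by apply/funext => v; apply/ffunP => u; rewrite !ffunE.
have -> : (fun w => \sum_(v | p v == w) Q v) = @Cn2_rows 1.
  apply/funext => w; apply/ffunP => u; rewrite !ord1 big_mkcond !big_ord_recl big_ord0.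
  by rewrite /= !ffunE.
exact: row_iso_sym.
Qed.

(** One vertex is split along its two edges. Expansions then take the first row through [(1,1,0)],
    [(1,0,1)], [(2,1,1)] and the second from [(0,0,1)] to [(1,1,1)]. *)
Lemma Cn2_two_state3 : row_iso K (@Cn2_rows 2) (state3 1 1 1 1 1 1).
Proof.
pose row2 (x y : nat) : {ffun 'I_2 -> nat} := [ffun k : 'I_2 => nth 0%N [:: x; y] k].
pose p (i : 'I_3) : 'I_2 := nth ord0 [:: ord0; ord0; ord_max] i.
pose Q (i : 'I_3) : {ffun 'I_2 -> nat} := nth 0 [:: row2 1 0; row2 0 1; row2 1 1] i.
have surj w : exists v, p v = w.
  by case: w => -[|[|//]] ?; [exists ord0|exists ord_max]; apply: val_inj.
have Q0 i : Q i != 0.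
  by case: i => -[|[|[|//]]] ?; apply/eqP => /ffunP E;
    have := (E ord0, E ord_max); rewrite /= !ffunE => -[].
have := row_amalgam K surj Q0; rewrite Cn2_rows_two.
have -> : (fun w => \sum_(v | p v == w) Q v) = fun=> [ffun=> 1%N].
  apply/funext => w; rewrite big_mkcond !big_ord_recl big_ord0.
  by case: w => -[|[|//]] ?; apply/ffunP => -[[|[|//]] ?]; rewrite /= ?ffunE/= ?ffunE/= ?ffunE.
pose m0 (i : 'I_3) : {ffun 'I_3 -> nat} := nth 0 [:: row3 1 1 0; row3 0 0 1; row3 1 1 1] i.
have -> : (fun v => [ffun u => Q v (p u)]) = m0.
  apply/funext => -[[|[|[|//]]] ?]; apply/ffunP => -[[|[|[|//]]] ?];
  by rewrite /m0 /= ?ffunE/= ?ffunE.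
move/row_iso_sym => iso1; apply: row_iso_trans iso1 _.
pose i0 := @Ordinal 3 0 isT; pose i1 := @Ordinal 3 1 isT; pose i2 := @Ordinal 3 2 isT.
have n1 : row3 0 0 1 != 0 by apply: row3_neq0.
have n2 : row3 1 1 1 != 0 by apply: row3_neq0.
apply: row_iso_trans (@row_expand K _ m0 i0 i1 1 (row3 1 0 0) _ _ _) _ => //.
  by apply/ffunP => -[[|[|[|//]]] ?]; rewrite !ffunE/= ?ffunE/=.
set m1 := set_row _ _ _.
apply: row_iso_trans (@row_expand K _ m1 i0 i2 1 (row3 1 0 0) _ _ _) _ => //.
  by apply/ffunP => -[[|[|[|//]]] ?]; rewrite !ffunE/= ?ffunE/=.
set m2 := set_row _ _ _.
apply: row_iso_trans (@row_expand K _ m2 i1 i2 1 0 _ _ _) _ => //.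
  by apply/ffunP => -[[|[|[|//]]] ?]; rewrite !ffunE/= ?ffunE/=.
rewrite [set_row _ _ _](_ : _ = state3 1 1 1 1 1 1); first exact: row_iso_refl.
apply/funext => -[[|[|[|//]]] ?]; apply/ffunP => -[[|[|[|//]]] ?];
  by rewrite /state3 /m2 /m1 /set_row /m0/= ?ffunE/= ?ffunE/= ?ffunE.
Qed.

End SmallCycles.

(** * Comparison with E_n *)

Lemma fib_gcd_gt0 n : (0 < n)%N -> (0 < fib_gcd n)%N.
Proof.
case: n => // n _; rewrite /fib_gcd absz_gt0 gcdz_eq0 negb_and.
by have := fib_gt0 n; case: (fib _).
Qed.

Lemma E_multE n : E_mult n =
  fun i k => state3 1 (2 + fib_gcd n) 1 1 1 (2 + H2 n %/ fib_gcd n) i k.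
Proof.
apply/funext => i; apply/funext => k.
by case: i => -[|[|[|//]]] ?; case: k => -[|[|[|//]]] ?; rewrite ffunE.
Qed.

Lemma Cn2_E_graph (K : fieldType) n : (0 < n)%N ->
  (H2 n)%:Z = (fib n)%:Z ^+ 2 - (fib n)%:Z * ((fib n.-1)%:Z - 1) - ((fib n.-1)%:Z - 1) ^+ 2 ->
  lpa_iso K (Cn2 n) (E_graph n).
Proof.
move=> n_gt0 H2E; rewrite /E_graph E_multE; apply: lpa_iso_trans (Cn2_row_graph K n) _.
set p := (fib n)%:Z in H2E; set q := (fib n.-1)%:Z - 1 in H2E.
have dE : (fib_gcd n)%:Z = gcdz p q by [].
have d0 : gcdz p q != 0 by rewrite -dE; have := fib_gcd_gt0 n_gt0; lia.
have dp : (gcdz p q %| p)%Z := dvdz_gcdl p q.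
have dq : (gcdz p q %| q)%Z := dvdz_gcdr p q.
have hE : (H2 n)%:Z = gcdz p q * (H2 n %/ fib_gcd n)%:Z.
  rewrite -dE -PoszM mulnC divnK// -[(_ %| _)%N]/(_ %| (H2 n)%:Z)%Z.
  have -> : (fib_gcd n %| (H2 n)%:Z)%Z = (gcdz p q %| (H2 n)%:Z)%Z by rewrite -dE.
  by rewrite H2E !rpredB//; [exact: dvdz_mulr|exact: dvdz_mulr|exact: dvdz_mulr].
have E_pres : presents (gcdz p q) 0 0 (H2 n %/ fib_gcd n)%:Z
    1 (2 + fib_gcd n) 1 1 1 (2 + H2 n %/ fib_gcd n).
  by rewrite -dE; split=> //; split; lia.
have gE : gcdz (q - p) (- p) = gcdz p q.
  by rewrite gcdzN gcdzC -[q - p]addrC -[- p]mulN1r gcdzMDl.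
(* These are the entries read off [Cn2_state3]; the last one is [1 - F(n+1)], since
   [p + q = F(n+1) - 1]. *)
have smith : same_algebra K (q - p) (- p) (- q) (- (p + q))
    (gcdz p q) 0 0 (H2 n %/ fib_gcd n)%:Z.
  rewrite -gE; apply: same_algebra_smith; rewrite gE//.
  - by rewrite rpredN.
  - by rewrite rpredN rpredD.
  - by rewrite -hE H2E; ring.
(* For [n = 1] and [n = 2] the matrix is minus the identity, whose Smith form is the identity. *)
have small : gcdz p q = 1 -> (H2 n)%:Z = 1 ->
    row_iso K (state3 1 1 1 1 1 1) (state3 1 (2 + fib_gcd n) 1 1 1 (2 + H2 n %/ fib_gcd n)).
  move=> g1 h1; have small_pres : presents (-1) 0 0 (-1) 1 1 1 1 1 1 by [].
  have : same_algebra K (-1) 0 0 (-1) (gcdz (-1) 0) 0 0 1 by exact: same_algebra_smith.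
  move: E_pres hE; rewrite g1 h1 mul1r => E_pres hE; rewrite -hE in E_pres.
  by apply.
case: n n_gt0 @p @q {dp dq hE} H2E dE d0 E_pres gE smith small =>
  [//|[|[|k]]] _ p q H2E dE d0 E_pres gE smith small.
- apply: row_iso_trans (Cn2_one_two K) (row_iso_trans (Cn2_two_state3 K) _).
  by apply: small => //; rewrite H2E.
- apply: row_iso_trans (Cn2_two_state3 K) _.
  by apply: small => //; rewrite H2E.
apply: row_iso_trans (lpa_iso_trans (lpa_iso_sym (Cn2_row_graph K _)) (Cn2_state3 K k)) _.
apply: smith E_pres; have h1 := fib_gt0 k; have h2 := fib_gt0 k.+1.
have h3 := fibSS k.+1; have h4 := fibSS k.+2.
by split; [lia|lia|rewrite /p /q/=; split; lia].
Qed.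

(** * The determinant H_2(n) *)

Lemma incidence_Cn2 n (i k : 'I_n) : incidence_mx (Cn2 n) i k =
  (k == ordS i)%:Z + (k == ordS (ordS i))%:Z.
Proof.
rewrite mxE cardsE -sum1_card big_sumType/=.
have sum1 (h : 'I_n -> 'I_n) : (\sum_(j | (j == i) && (h j == k)) 1 = (k == h i))%N.
  by rewrite big_mkcondr/= big_pred1_eq eq_sym; case: (_ == _).
by rewrite !sum1 PoszD.
Qed.

Section CirculantDeterminant.
Variable m : nat.
Local Notation n := (m + 2)%N.
Let N : 'M[int]_n := 1%:M - incidence_mx (Cn2 n).
(* The last two columns of P solve the recurrence [z_k = z_(k+1) + z_(k+2)], so
   they clear the upper right block of [N *m P]. *)
Let x (k : nat) : int := fib (m.+1 - k).
(** The exceptional value is [F(-1) = 1]: it continues the recurrence at the index where [m - k]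
    truncates to 0. *)
Let y (k : nat) : int := if k == m.+1 then 1 else fib (m - k).
Let g (k j : nat) : int := if (j < m)%N then (k == j)%:Z else if j == m then x k else y k.
Let P : 'M[int]_n := \matrix_(k, j) g k j.

Let NP_E (i j : 'I_n) : (N *m P) i j = g i j - g (ordS i) j - g (ordS (ordS i)) j.
Proof.
rewrite mxE; under eq_bigr do rewrite !mxE mulrBl.
rewrite big_split/= sumrN.
have pick (c : 'I_n) : \sum_(k < n) (k == c)%:Z * g k j = g c j.
  rewrite (bigD1 c)//= eqxx mul1r big1 ?addr0// => k /negPf ->.
  by rewrite mul0r.
rewrite -[in RHS](pick i) -[in RHS](pick (ordS i)) -[in RHS](pick (ordS (ordS i))).
rewrite -addrA -opprD -big_split/=; congr (_ - _); apply: eq_bigr => k _.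
  by rewrite eq_sym; case: (k == i).
by rewrite -mulrDl -incidence_Cn2 mxE.
Qed.

Let x_rec k : (k < m)%N -> x k - x k.+1 - x k.+2 = 0.
Proof.
move=> km; rewrite /x.
have -> : (m.+1 - k = (m.+1 - k.+2).+2)%N by lia.
have -> : (m.+1 - k.+1 = (m.+1 - k.+2).+1)%N by lia.
by rewrite fibSS PoszD; ring.
Qed.

Let y_rec k : (k < m)%N -> y k - y k.+1 - y k.+2 = 0.
Proof.
move=> km; rewrite /y; have -> : (k == m.+1) = false by lia.
have -> : (k.+1 == m.+1) = false by lia.
case: eqP => [E|E].
  by have -> : m = k.+1; [lia|rewrite subSnn subnn].
have -> : (m - k = (m - k.+2).+2)%N by lia.
have -> : (m - k.+1 = (m - k.+2).+1)%N by lia.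
by rewrite fibSS PoszD; ring.
Qed.

Let det_P : \det P = 1.
Proof.
rewrite -det_tr det_trig.
  rewrite big1// => i _; rewrite !mxE /g /x /y eqxx; have im := ltn_ord i.
  case: (ltnP i m) => // mi; case: eqP => [->|im']; first by rewrite subSnn.
  by case: eqP => //; lia.
apply/is_trig_mxP => i j ij; rewrite !mxE /g /x; have jm := ltn_ord j.
case: (ltnP i m) => mi; first by case: eqP => //; lia.
case: eqP => [im|]; last by lia.
by have -> : (m.+1 - j = 0)%N by lia.
Qed.

Let ordSE (i : 'I_n) : (i < m.+1)%N -> ordS i = i.+1 :> nat.
Proof. by move=> im /=; rewrite modn_small//; lia. Qed.

Let ul : ulsubmx (N *m P) = \matrix_(i, j) ((i == j)%:Z - (i.+1 == j)%:Z - (i.+2 == j)%:Z).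
Proof.
apply/matrixP => i j; rewrite 2!mxE NP_E mxE; have im := ltn_ord i; have jm := ltn_ord j.
have S1 : ordS (lshift 2 i) = i.+1 :> nat by rewrite ordSE//=; lia.
have S2 : ordS (ordS (lshift 2 i)) = i.+2 :> nat by rewrite ordSE S1//; lia.
by rewrite S2 S1 /g/= jm.
Qed.

Let ur : ursubmx (N *m P) = 0.
Proof.
apply/matrixP => i j; rewrite 2!mxE NP_E mxE; have im := ltn_ord i; have jm := ltn_ord j.
have S1 : ordS (lshift 2 i) = i.+1 :> nat by rewrite ordSE//=; lia.
have S2 : ordS (ordS (lshift 2 i)) = i.+2 :> nat by rewrite ordSE S1//; lia.
rewrite S2 S1 /g/= ltnNge leq_addr/=.
by case: eqP => _; [exact: x_rec|exact: y_rec].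
Qed.

Let det_ul : \det (ulsubmx (N *m P)) = 1.
Proof.
rewrite ul -det_tr det_trig.
  rewrite big1// => i _; rewrite !mxE eqxx.
  by case: eqP => //; [lia|]; case: eqP => //; lia.
apply/is_trig_mxP => i j ij; rewrite !mxE -val_eqE/=.
by do 3 (case: eqP; first by lia).
Qed.

(** [P] and the upper left block of [N *m P] are unitriangular, so only the lower right 2 x 2 block
    contributes. Its two rows are those where the indices wrap around. *)
Lemma det_Cn2 : \det N = (1 - (fib m.+1)%:Z) ^+ 2 - (1 + (fib m)%:Z) * (fib m.+2)%:Z.
Proof.
transitivity (\det (N *m P)); first by rewrite det_mulmx det_P mulr1.
rewrite -[N *m P]submxK ur det_lblock det_ul mul1r.
have det2 (M : 'M[int]_2) : \det M =
    M ord0 ord0 * M ord_max ord_max - M ord0 ord_max * M ord_max ord0.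
  rewrite (expand_det_row _ ord0) !big_ord_recl big_ord0 /cofactor !det_mx11 !mxE/=.
  have l00 : lift ord0 ord0 = ord_max :> 'I_2 by apply: val_inj.
  have l10 : lift ord_max ord0 = ord0 :> 'I_2 by apply: val_inj.
  by rewrite !l00 !l10 expr0 expr1; ring.
have drE (i j : 'I_2) : drsubmx (N *m P) i j = (N *m P) (rshift m i) (rshift m j) by rewrite 2!mxE.
have Sa : ordS (rshift m (ord0 : 'I_2)) = m.+1 :> nat by rewrite ordSE/= addn0.
have SSa : ordS (ordS (rshift m (ord0 : 'I_2))) = 0 :> nat.
  by rewrite /= addn0 addn2 (@modn_small m.+1)// modnn.
have Sb : ordS (rshift m (ord_max : 'I_2)) = 0 :> nat by rewrite /= addn1 addn2 modnn.
have SSb : ordS (ordS (rshift m (ord_max : 'I_2))) = 1 :> nat by rewrite ordSE Sb.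
rewrite det2 !drE !NP_E SSa Sa SSb Sb /g/= !addn0 addn1 !ltnNge !leqnSn !leqnn/=.
rewrite eqxx; case: eqP => [|_]; first by lia.
rewrite /x /y subSnn subnn !subn0 eqxx.
have -> : (m == m.+1) = false by lia.
rewrite subnn -[fib 0]/0%N -[fib 1]/1%N fibSS.
(* For [m = 0] the index 1 equals [m + 1], where [y] takes its exceptional value. *)
case: (m) => [|k]; first by [].
rewrite -[(0 == _)%N]/false -[(1 == _)%N]/false !subn1 /= fibSS !PoszD; ring.
Qed.

End CirculantDeterminant.

(** Cassini's identity, squared so that the alternating sign disappears. *)
Lemma fib_cassini n : ((fib n.+1)%:Z ^+ 2 - (fib n.+1)%:Z * (fib n)%:Z - (fib n)%:Z ^+ 2) ^+ 2 = 1.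
Proof.
elim: n => // n <-; rewrite fibSS PoszD; ring.
Qed.

Lemma H2E n : (0 < n)%N -> (H2 n)%:Z = (fib n)%:Z ^+ 2
  - (fib n)%:Z * ((fib n.-1)%:Z - 1) - ((fib n.-1)%:Z - 1) ^+ 2.
Proof.
case: n => // n _; have -> : H2 n.+1 = `|\det (1%:M - incidence_mx (Cn2 n.+1))|%N.
  by rewrite /H2 -det_tr linearB/= trmxK tr_scalar_mx.
set rhs := RHS; have rhs_ge0 : 0 <= rhs.
  rewrite /rhs /=; have := fib_cassini n; have := fib_gt0 n.
  set u := (fib n.+1)%:Z; set v := (fib n)%:Z => u0 /eqP.
  (* By Cassini the bracket is 1 or -1, so the right-hand side is [u + 2 v] or [u + 2 v - 2]. In the
     second case [v > 0], because for [n = 0] the bracket is 1. *)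
  have -> : u ^+ 2 - u * (v - 1) - (v - 1) ^+ 2 =
      (u ^+ 2 - u * v - v ^+ 2) + u + v + v - 1 by ring.
  rewrite sqrf_eq1 => /orP[] /eqP c; first by rewrite c; lia.
  case: (n) @u @v u0 c => [|k] u v u0 c; last by rewrite c; have := fib_gt0 k; lia.
  by [].
rewrite -[RHS](ger0_norm rhs_ge0) /rhs {rhs rhs_ge0} abszE.
case: n => [|n].
  by rewrite det_mx11 mxE [(- _ : 'M__) _ _]mxE incidence_Cn2 mxE !ord1.
have -> : n.+2 = (n + 2)%N by rewrite addn2.
rewrite det_Cn2 addn2/= -normrN; congr `|_|.
by rewrite fibSS PoszD; ring.
Qed.

(** * Finitely generated projectives and leading monomials *)

Section KSpan.
Variables (K : fieldType) (R : pzRingType) (kappa : {rmorphism K -> R}).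

(** Linear span over [K], acting through [kappa]. As an inductive predicate it handles infinite
    index types without finitely supported functions, and gives induction on the number of terms. *)
Inductive kspan (M : lmodType R) (T : Type) (phi : T -> M) (P : T -> Prop) : M -> Prop :=
  | kspan0 : kspan phi P 0
  | kspanD c t x : P t -> kspan phi P x -> kspan phi P (kappa c *: phi t + x).

Variable M : lmodType R.

Lemma kspan_mono (T : Type) (phi : T -> M) (P Q : T -> Prop) x :
  (forall t, P t -> Q t) -> kspan phi P x -> kspan phi Q x.
Proof. by move=> PQ; elim=> [|c t y Pt _ IH]; constructor=> //; apply: PQ. Qed.

Lemma kspan_add (T : Type) (phi : T -> M) P x y :
  kspan phi P x -> kspan phi P y -> kspan phi P (x + y).
Proof. by elim=> [|c t z Pt _ IH] hy; rewrite ?add0r// -addrA; constructor=> //; apply: IH. Qed.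

Lemma kspan_scale (T : Type) (phi : T -> M) P c x :
  kspan phi P x -> kspan phi P (kappa c *: x).
Proof.
elim=> [|d t z Pt _ IH]; first by rewrite scaler0; constructor.
by rewrite scalerDr scalerA -rmorphM; constructor.
Qed.

Lemma kspan_opp (T : Type) (phi : T -> M) P x : kspan phi P x -> kspan phi P (- x).
Proof. by move=> /(kspan_scale (-1)); rewrite rmorphN rmorph1 scaleN1r. Qed.

Lemma kspan_sum (T : Type) (phi : T -> M) P (I : Type) (r : seq I) (Q : pred I) F :
  (forall i, Q i -> kspan phi P (F i)) -> kspan phi P (\sum_(i <- r | Q i) F i).
Proof. by move=> h; apply: big_ind => //; [constructor|exact: kspan_add]. Qed.

Lemma kspan_gen (T : Type) (phi : T -> M) (P : T -> Prop) t : P t -> kspan phi P (phi t).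
Proof.
move=> Pt; rewrite -[phi t]addr0 -[phi t]scale1r -(rmorph1 kappa).
by constructor=> //; constructor.
Qed.

Lemma kspan_bound (T : Type) (phi : T -> M) (P : T -> Prop) (code : T -> nat) x :
  kspan phi P x -> exists N, kspan phi (fun t => P t /\ (code t < N)%N) x.
Proof.
elim=> [|c t y Pt _ [N yN]]; first by exists 0%N; constructor.
exists (maxn N (code t).+1); constructor; first by rewrite leq_max leqnn orbT.
by apply: kspan_mono yN => t' [? lt]; split=> //; rewrite leq_max lt.
Qed.

(** The terms of largest code are gathered into one coefficient; if it vanishes, or its [phi t]
    does, the bound drops. As the [phi t] may be dependent or zero, the leading term belongs to an
    expression of [x] rather than to [x]. *)
Lemma kspan_lead (T : Type) (phi : T -> M) (P : T -> Prop) (code : T -> nat) N x :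
  injective code -> kspan phi (fun t => P t /\ (code t < N)%N) x -> x <> 0 ->
  exists c t, [/\ c != 0, phi t <> 0, P t, (code t < N)%N &
    kspan phi (fun t' => P t' /\ (code t' < code t)%N) (x - kappa c *: phi t)].
Proof.
move=> code_inj; elim: N x => [|N IH] x.
  by case=> [//|? ? ? []].
move=> xN x0.
have [xN'|[c [t [Pt tN xN']]]] : kspan phi (fun t => P t /\ (code t < N)%N) x \/
    exists c t, [/\ P t, code t = N &
      kspan phi (fun t => P t /\ (code t < N)%N) (x - kappa c *: phi t)].
- elim: xN {x0} => [|c t y [Pt tN] _ [IHy|[d [u [Pu uN IHy]]]]]; first by left; constructor.
    move: tN; rewrite ltnS leq_eqVlt => /orP[/eqP tN|tN].
      by right; exists c, t; split=> //; rewrite addrAC subrr add0r.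
    by left; constructor.
  right; move: tN; rewrite ltnS leq_eqVlt => /orP[/eqP tN|tN].
    have -> : t = u by apply: code_inj; rewrite tN uN.
    exists (c + d), u; split=> //.
    by rewrite rmorphD scalerDl opprD addrACA subrr add0r.
  by exists d, u; split=> //; rewrite -addrA; constructor.
- by have [c [t [? ? ? tN ?]]] := IH x xN' x0; exists c, t; split=> //; exact: ltnW.
have drop0 : kappa c *: phi t = 0 -> exists c t, [/\ c != 0, phi t <> 0, P t, (code t < N.+1)%N &
    kspan phi (fun t' => P t' /\ (code t' < code t)%N) (x - kappa c *: phi t)].
  move=> ct0; rewrite ct0 subr0 in xN'.
  by have [c' [t' [? ? ? tN' ?]]] := IH x xN' x0; exists c', t'; split=> //; exact: ltnW.
have [c0|c0] := eqVneq c 0; first by apply: drop0; rewrite c0 rmorph0 scale0r.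
have [t0|/eqP t0] := eqVneq (phi t) 0; first by apply: drop0; rewrite t0 scaler0.
by exists c, t; split=> //; rewrite tN.
Qed.

End KSpan.

Lemma kspan_map (K : fieldType) (R : pzRingType) (kappa : {rmorphism K -> R})
    (M M' : lmodType R) (T T' : Type) (phi : T -> M) (phi' : T' -> M') P P'
    (f : M -> M') x :
  f 0 = 0 -> (forall c x y, f (kappa c *: x + y) = kappa c *: f x + f y) ->
  (forall t, P t -> kspan kappa phi' P' (f (phi t))) -> kspan kappa phi P x ->
  kspan kappa phi' P' (f x).
Proof.
move=> f0 fL fP; elim=> [|c t y Pt _ IH]; first by rewrite f0; constructor.
by rewrite fL; apply: kspan_add => //; apply: kspan_scale; apply: fP.
Qed.

Section Code.
Variables (H X : finType).
Let B := (#|H| + #|X| + 1)%N.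

(* Words are read as numbers in a base exceeding every digit, with a nonzero
   leading digit: this gives a well-founded total order on words which is
   compatible with concatenation on the right. *)
Definition word_code (h : H) (p : seq X) : nat :=
  foldl (fun a x => a * B + enum_rank x)%N (enum_rank h).+1 p.

Lemma word_code_rcons h p x : word_code h (rcons p x) = (word_code h p * B + enum_rank x)%N.
Proof. by rewrite /word_code -cats1 foldl_cat. Qed.

Lemma word_code_gt0 h p : (0 < word_code h p)%N.
Proof.
elim/last_ind: p => [|p x IH]; first by [].
by rewrite word_code_rcons addn_gt0 muln_gt0 IH /B addn1.
Qed.

Lemma rank_lt_base (x : X) : (enum_rank x < B)%N.
Proof. by apply: leq_trans (ltn_ord _) _; rewrite /B addn1 ltnW// ltnS leq_addl. Qed.

Lemma word_code_inj h p h' p' : word_code h p = word_code h' p' -> h = h' /\ p = p'.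
Proof.
have hB (g : H) : ((enum_rank g).+1 < B)%N.
  by rewrite /B addn1 ltnS; apply: leq_trans (ltn_ord _) _; exact: leq_addr.
have big g q x : (B <= word_code g (rcons q x))%N.
  rewrite word_code_rcons; apply: leq_trans (leq_addr _ _).
  by rewrite leq_pmull// word_code_gt0.
elim/last_ind: p p' => [|p x IH] p'.
  case/lastP: p' => [[] /ord_inj/enum_rank_inj ->//|q y E].
  by have := big h' q y; rewrite -E leqNgt hB.
case/lastP: p' => [E|q y]; first by have := big h p x; rewrite E leqNgt hB.
rewrite !word_code_rcons => E.
have xy : enum_rank x = enum_rank y :> nat.
  have := congr1 (modn^~ B) E; rewrite !modnMDl !modn_small//; exact: rank_lt_base.
move: E; rewrite xy => /addIn/eqP; rewrite eqn_pmul2r ?/B ?addn1// => /eqP/IH[-> ->].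
by split=> //; congr rcons; apply: enum_rank_inj; apply: ord_inj.
Qed.

Lemma word_code_mono h p h' p' q : (word_code h p < word_code h' p')%N ->
  (word_code h (p ++ q) < word_code h' (p' ++ q))%N.
Proof.
elim/last_ind: q => [|q x IH] lt; first by rewrite !cats0.
rewrite -!rcons_cat !word_code_rcons ltn_add2r ltn_pmul2r ?/B ?addn1//.
exact: IH.
Qed.

Lemma leq_word_code_cat h p q : (word_code h p <= word_code h (p ++ q))%N.
Proof.
elim/last_ind: q => [|q x IH]; first by rewrite cats0.
rewrite -rcons_cat word_code_rcons; apply: leq_trans IH _.
by apply: leq_trans (leq_addr _ _); rewrite leq_pmulr// /B addn1.
Qed.

End Code.

(** * Diagonalizing idempotents over a system of paths *)

Section PathSystem.
Variables (K : fieldType) (R : pzRingType) (kappa : {rmorphism K -> R}).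
Hypothesis kappaC : forall c z, kappa c * z = z * kappa c.
Variables (W X : finType) (sr rg : X -> W) (reg : pred W).
Variables (om : W -> R) (xe xg : X -> R) (tau : R -> R).
Hypotheses (omM : forall u w, om u * om w = if u == w then om u else 0)
  (om_sum : \sum_w om w = 1)
  (om_xe : forall x, om (sr x) * xe x = xe x)
  (xe_om : forall x, xe x * om (rg x) = xe x)
  (xg_om : forall x, xg x * om (sr x) = xg x)
  (xg_xe : forall x y, xg x * xe y = if x == y then om (rg x) else 0)
  (om_reg : forall w, reg w -> om w = \sum_(x | sr x == w) xe x * xg x)
  (reg_sr : forall x, reg (sr x)).

Definition path_elt (p : seq X) : R := \prod_(x <- p) xe x.
(** Ghosts multiply in the reverse order of their path. *)
Definition ghost_elt (p : seq X) : R := foldr (fun x a => a * xg x) 1 p.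
(** The word [p] need not be composable: the corresponding monomial is then zero, and its endpoint
    is a mere label. *)
Definition endpoint (w : W) (p : seq X) : W := last w [seq rg x | x <- p].

(** [tau] abstracts the degree-0 component of a grading: it tells a node apart from the ghost paths
    left after a cancellation. *)
Hypotheses (tau0 : tau 0 = 0) (tauD : forall y z, tau (y + z) = tau y + tau z)
  (tau_om : forall w, tau (om w) = om w)
  (tau_ghost : forall c u p, p <> [::] -> tau (kappa c * (om u * ghost_elt p)) = 0).

Let mon (w : W) (p : seq X) : R := om w * path_elt p.

Let om_xeE w x : om w * xe x = if w == sr x then xe x else 0.
Proof. by rewrite -{1}om_xe mulrA omM; case: eqP => [->|_]; rewrite ?om_xe ?mul0r. Qed.

Let xe_omE w x : xe x * om w = if rg x == w then xe x else 0.
Proof. by rewrite -{1}xe_om -mulrA omM; case: eqP => [_|_]; rewrite ?xe_om ?mulr0. Qed.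

Let xg_omE w x : xg x * om w = if sr x == w then xg x else 0.
Proof. by rewrite -{1}xg_om -mulrA omM; case: eqP => [_|_]; rewrite ?xg_om ?mulr0. Qed.

Let path_cat p q : path_elt (p ++ q) = path_elt p * path_elt q.
Proof. by rewrite /path_elt big_cat. Qed.

Let path_rcons p x : path_elt (rcons p x) = path_elt p * xe x.
Proof. by rewrite /path_elt -cats1 big_cat big_seq1. Qed.

Let ghost_rcons p x : ghost_elt (rcons p x) = xg x * ghost_elt p.
Proof. by elim: p => [|y p IH] /=; rewrite ?mul1r ?mulr1// IH mulrA. Qed.

Let endpoint_cat w p q : endpoint w (p ++ q) = endpoint (endpoint w p) q.
Proof. by rewrite /endpoint map_cat last_cat. Qed.

Let endpoint_rcons w p x : endpoint w (rcons p x) = rg x.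
Proof. by rewrite /endpoint map_rcons last_rcons. Qed.

Let mon_cat w p q : mon w (p ++ q) = mon w p * path_elt q.
Proof. by rewrite /mon path_cat mulrA. Qed.

Let mon_nil w : mon w [::] = om w.
Proof. by rewrite /mon /path_elt big_nil mulr1. Qed.

Let mon_endpoint w p : mon w p * om (endpoint w p) = mon w p.
Proof.
elim/last_ind: p => [|p x _]; first by rewrite mon_nil omM eqxx.
by rewrite endpoint_rcons /mon path_rcons -!mulrA xe_om.
Qed.

Let om_mon u w p : om u * mon w p = if u == w then mon w p else 0.
Proof. by rewrite /mon mulrA omM; case: eqP => [->//|_]; rewrite mul0r. Qed.

Let xe_mon x w p : xe x * mon w p = if rg x == w then mon (sr x) (x :: p) else 0.
Proof.
rewrite /mon mulrA xe_omE; case: eqP => [_|_]; last by rewrite mul0r.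
by rewrite /path_elt big_cons mulrA om_xe.
Qed.

Let mon_cons w x p : mon w (x :: p) = if w == sr x then xe x * mon (rg x) p else 0.
Proof.
rewrite /mon /path_elt big_cons mulrA om_xeE; case: eqP => _; last by rewrite mul0r.
by rewrite mulrA xe_om.
Qed.

Let ghost_mon_cons p x w y p' : ghost_elt (x :: p) * mon w (y :: p') =
  if (w == sr y) && (x == y) then ghost_elt p * mon (rg x) p' else 0.
Proof.
rewrite mon_cons; case: eqP => _ /=; last by rewrite mulr0.
rewrite -mulrA (mulrA (xg x)) xg_xe; case: eqP => [->|_]; last by rewrite mul0r mulr0.
by rewrite om_mon eqxx.
Qed.

(** Cancelling letter by letter, either the product vanishes, by (CK1) or by a mismatch of nodes, or
    [p'] is exhausted first and a nonempty ghost path remains, which [tau] kills. *)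
Let tau_ghost_mon c u p w p' : ~~ prefix p p' ->
  tau (kappa c * (om u * (ghost_elt p * mon w p'))) = 0.
Proof.
elim: p p' w => [|x p IH] [|y p'] w //=.
  move=> _; rewrite mon_nil -mulrA xg_omE; case: eqP => _; last by rewrite !mulr0.
  by rewrite -[_ * xg x]/(ghost_elt (x :: p)) tau_ghost.
move=> npre; have := ghost_mon_cons p x w y p' => /= ->.
case: ifP => [/andP[_ /eqP xy]|]; last by rewrite !mulr0.
by apply: IH; move: npre; rewrite xy eqxx.
Qed.

Let ghost_mon_cat w p q : mon w p <> 0 -> ghost_elt p * mon w (p ++ q) = mon (endpoint w p) q.
Proof.
elim: p w => [|x p IH] w; first by rewrite mul1r.
rewrite mon_cons cat_cons ghost_mon_cons eqxx andbT; case: eqP => // _ h.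
by rewrite IH// => h'; apply: h; rewrite h' mulr0.
Qed.

Let mon2 (t : W * seq X) : R^o := mon t.1 t.2.
Let in_paths (z : R) (u : W) := kspan kappa mon2 (fun t => endpoint t.1 t.2 = u) z.

Let in_paths_mul z u q : in_paths z u -> in_paths (z * path_elt q) (endpoint u q).
Proof.
apply: (@kspan_map _ _ _ R^o R^o _ _ _ _ _ _ (fun y : R^o => (y * path_elt q : R^o))).
- exact: mul0r.
- by move=> c x y; rewrite mulrDl -mulrA.
move=> [w p] /= <-; rewrite -mon_cat -endpoint_cat.
exact: (@kspan_gen _ _ _ R^o _ mon2 _ (w, p ++ q)).
Qed.

(* [good_elt z]: right multiplication by long paths, or by paths ending in a sink,
   carries z into the span of the paths. *)
Let complete N w p := size p = N \/ (size p <= N)%N /\ ~~ reg (endpoint w p).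
Let good N z := forall w p, complete N w p -> in_paths (z * mon w p) (endpoint w p).

Let goodS N z : good N z -> good N.+1 z.
Proof.
move=> gz w p; case: (leqP (size p) N) => [pN|pN] cp.
  by apply: gz; case: cp => [pN'|[_ ?]]; [rewrite pN' ltnn in pN|right].
case/lastP: p pN cp => [//|p x]; rewrite size_rcons ltnS => pN cp.
have sp : size p = N by case: cp => [|[+ _]]; rewrite size_rcons => ?; lia.
rewrite -cats1 mon_cat mulrA endpoint_cat; apply: in_paths_mul.
by apply: gz; left.
Qed.

Let good_leq M N z : (M <= N)%N -> good M z -> good N z.
Proof. by move=> /subnKC <-; elim: (N - M)%N => [|k IH] gz; rewrite ?addn0// addnS; exact/goodS/IH. Qed.

Let good_add N y z : good N y -> good N z -> good N (y + z).
Proof. by move=> gy gz w p cp; rewrite mulrDl; apply: kspan_add; [exact: gy|exact: gz]. Qed.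

Let good_kappa N c z : good N z -> good N (kappa c * z).
Proof. by move=> gz w p cp; rewrite -mulrA; apply: (@kspan_scale _ _ _ R^o); exact: gz. Qed.

(** The first [N] letters are absorbed by [y] and leave paths; the remaining letters make these long
    enough for [z]. Endpoints are preserved, so a path stopping at a sink still does. *)
Let good_mul N M y z : good N y -> good M z -> good (M + N) (z * y).
Proof.
move=> gy gz w p cp.
have [p1 [p2 [pE c1 c2]]] : exists p1 p2, [/\ p = p1 ++ p2, complete N w p1 &
    (size p2 < M)%N -> ~~ reg (endpoint w p)].
  have [Np|pN] := leqP N (size p).
    exists (take N p), (drop N p); rewrite cat_take_drop; split=> //.
      by left; rewrite size_takel.
    by rewrite size_drop => lt; case: cp => [|[]//]; lia.
  by exists p, [::]; rewrite cats0; case: cp => [|[_ nr]]; [lia|split=> //; right; rewrite ltnW].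
rewrite pE mon_cat mulrA -(mulrA z).
move: c2; rewrite pE !endpoint_cat; set u := endpoint w p1 => c2.
rewrite -mulrA.
apply: (@kspan_map _ _ _ R^o R^o _ _ _ _ _ _ (fun y : R^o => (z * (y * path_elt p2) : R^o))
  _ _ _ _ (gy _ _ c1)).
- by rewrite mul0r mulr0.
- move=> c x1 x2; rewrite mulrDl mulrDr; congr (_ + _).
  by rewrite -[kappa c *: x1]/(kappa c * x1) -(mulrA (kappa c)) (mulrA z) -kappaC -(mulrA (kappa c)).
move=> [w' q] /=; rewrite -/u => qu.
have nr : (size (q ++ p2) < M)%N -> ~~ reg (endpoint w' (q ++ p2)).
  move=> lt; rewrite endpoint_cat qu; apply: c2.
  by apply: leq_ltn_trans lt; rewrite size_cat leq_addl.
rewrite -[X in kspan _ _ _ X]/(z * (mon w' q * path_elt p2)) -mon_cat -qu -endpoint_cat.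
move: (q ++ p2) nr => r nr; have [Mr|rM] := leqP M (size r); last first.
  by apply: gz; right; split; [exact: ltnW|exact: nr].
rewrite -(cat_take_drop M r) mon_cat mulrA endpoint_cat; apply: in_paths_mul.
by apply: gz; left; rewrite size_takel.
Qed.

Definition good_elt z := exists N, good N z.

Lemma good_elt_add y z : good_elt y -> good_elt z -> good_elt (y + z).
Proof.
move=> [N gy] [M gz]; exists (M + N)%N; apply: good_add.
  by apply: good_leq gy; exact: leq_addl.
by apply: good_leq gz; exact: leq_addr.
Qed.

Lemma good_elt_mul y z : good_elt y -> good_elt z -> good_elt (y * z).
Proof. by move=> [N gy] [M gz]; exists (N + M)%N; apply: good_mul. Qed.

Lemma good_elt_kappa c z : good_elt z -> good_elt (kappa c * z).
Proof. by move=> [N gz]; exists N; apply: good_kappa. Qed.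

Lemma good_elt_opp z : good_elt z -> good_elt (- z).
Proof. by move=> /(good_elt_kappa (-1)); rewrite rmorphN rmorph1 mulN1r. Qed.

Lemma good_elt_om w : good_elt (om w).
Proof.
exists 0%N => u p _; rewrite om_mon; case: eqP => [_|_]; last by constructor.
exact: (@kspan_gen _ _ _ R^o _ mon2 _ (u, p)).
Qed.

Lemma good_elt_xe x : good_elt (xe x).
Proof.
exists 0%N => u p _; rewrite xe_mon; case: eqP => [<-|_]; last by constructor.
exact: (@kspan_gen _ _ _ R^o _ mon2 _ (sr x, x :: p)).
Qed.

(** A ghost edge consumes one letter. Against an empty path at a sink it vanishes, since its source
    is regular. *)
Lemma good_elt_xg x : good_elt (xg x).
Proof.
exists 1%N => u [|y [|y' p]] cp; last by case: cp => [|[]].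
  case: cp => [//|[_ /= nr]]; rewrite mon_nil xg_omE; case: eqP => [xu|_]; last by constructor.
  by rewrite -xu reg_sr in nr.
rewrite mon_cons mon_nil xe_om; case: eqP => _; last by rewrite mulr0; constructor.
rewrite xg_xe; case: eqP => [->|_]; last by constructor.
rewrite -[om _]mon_nil; exact: (@kspan_gen _ _ _ R^o _ mon2 _ (rg y, [::])).
Qed.

Lemma good_elt0 : good_elt 0.
Proof. by exists 0%N => w p _; rewrite mul0r; constructor. Qed.

Lemma good_elt1 : good_elt 1.
Proof.
rewrite -om_sum; apply: big_ind => //; [exact: good_elt0|exact: good_elt_add|].
by move=> w _; exact: good_elt_om.
Qed.

Let good_elt_sum (I : Type) (r : seq I) (P : pred I) F :
  (forall i, P i -> good_elt (F i)) -> good_elt (\sum_(i <- r | P i) F i).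
Proof. by move=> h; apply: big_ind => //; [exact: good_elt0|exact: good_elt_add]. Qed.

Let good_elt_ghost p : good_elt (ghost_elt p).
Proof.
elim: p => [|x p IH] /=; first exact: good_elt1.
by apply: good_elt_mul => //; exact: good_elt_xg.
Qed.

Let good_elt_path p : good_elt (path_elt p).
Proof.
elim: p => [|x p IH]; first by rewrite /path_elt big_nil; exact: good_elt1.
by rewrite /path_elt big_cons; apply: good_elt_mul => //; exact: good_elt_xe.
Qed.

Let good_common (I : finType) (F : I -> R) : (forall i, good_elt (F i)) ->
  exists N, forall i, good N (F i).
Proof.
move=> /choice[N gN]; exists (\max_i N i) => i; apply: good_leq (gN i).
exact: leq_bigmax.
Qed.

Let good_elt_mon w p : good_elt (mon w p).
Proof.
by apply: good_elt_mul; [exact: good_elt_om|exact: good_elt_path].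
Qed.

(** The paths obtained by applying (CK2) [N] times to [1], stopping at sinks; hence the sum of
    [p p^*] over them is 1. *)
Fixpoint complete_paths (N : nat) : seq (W * seq X) :=
  if N is N'.+1 then
    flatten [seq (if reg (endpoint t.1 t.2)
                  then [seq (t.1, rcons t.2 x) | x <- enum X & sr x == endpoint t.1 t.2]
                  else [:: t]) | t <- complete_paths N']
  else [seq (w, [::]) | w <- enum W].

Let complete_paths_sum N :
  \sum_(t <- complete_paths N) mon t.1 t.2 * (ghost_elt t.2 * om t.1) = 1.
Proof.
elim: N => [|N IH] /=.
  rewrite big_map big_enum/= -[RHS]om_sum; apply: eq_bigr => w _.
  by rewrite /= mon_nil mul1r omM eqxx.
rewrite big_flatten big_map -[RHS]IH; apply: eq_bigr => -[w p] _ /=.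
case: ifP => [rw|_]; last by rewrite big_seq1.
rewrite big_map big_filter big_enum_cond/=.
rewrite -[in RHS]mon_endpoint (om_reg rw) mulr_sumr mulr_suml.
apply: eq_big => x //= _.
by rewrite ghost_rcons -cats1 mon_cat /path_elt big_seq1 !mulrA.
Qed.

Let complete_pathsP N t : t \in complete_paths N -> complete N t.1 t.2.
Proof.
elim: N t => [|N IH] t /=; first by move=> /mapP[w _ ->]; left.
case/flattenP => _ /mapP[[w p] /IH /= wp ->] /=.
case: ifP => [rw|/negbT rw]; last first.
  rewrite inE => /eqP -> /=; case: wp => [sp|[sp ?]]; right; split=> //.
    by rewrite sp.
  exact: ltnW.
case/mapP => x _ -> /=; left; rewrite size_rcons; case: wp => [->//|[_]].
by rewrite rw.
Qed.

Section Columns.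
Variable n : nat.
Local Notation T := (('I_n * W) * seq X)%type.
Implicit Types (b : 'cV[R]_n) (t : T).

Let colmon t : 'cV[R]_n := \col_k (if k == t.1.1 then mon t.1.2 t.2 else 0).
Let rsc b (a : R) : 'cV[R]_n := map_mx ( *%R^~ a) b.
Let code t : nat := word_code t.1 t.2.
Let cend t := endpoint t.1.2 t.2.
Let low N u b := kspan kappa colmon (fun t => cend t = u /\ (code t < N)%N) b.

Let code_inj : injective code.
Proof. by move=> [h p] [h' p'] /word_code_inj [/= -> ->]. Qed.

Let rscA b a a' : rsc (rsc b a) a' = rsc b (a * a').
Proof. by apply/matrixP => i j; rewrite !mxE mulrA. Qed.

Let rscDl b b' a : rsc (b + b') a = rsc b a + rsc b' a.
Proof. by apply/matrixP => i j; rewrite !mxE mulrDl. Qed.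

Let rscDr b a a' : rsc b (a + a') = rsc b a + rsc b a'.
Proof. by apply/matrixP => i j; rewrite !mxE mulrDr. Qed.

Let rsc0l a : rsc 0 a = 0.
Proof. by apply/matrixP => i j; rewrite !mxE mul0r. Qed.

Let rsc0r b : rsc b 0 = 0.
Proof. by apply/matrixP => i j; rewrite !mxE mulr0. Qed.

Let rscN b a : rsc b (- a) = - rsc b a.
Proof. by apply/matrixP => i j; rewrite !mxE mulrN. Qed.

Let rscNl b a : rsc (- b) a = - rsc b a.
Proof. by apply/matrixP => i j; rewrite !mxE mulNr. Qed.

Let rscZ c b a : rsc (c *: b) a = c *: rsc b a.
Proof. by apply/matrixP => i j; rewrite !mxE mulrA. Qed.

Let rsc_kappa c b a : rsc b (kappa c * a) = kappa c *: rsc b a.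
Proof. by apply/matrixP => i j; rewrite !mxE mulrA -kappaC mulrA. Qed.

Let rsc1 b : rsc b 1 = b.
Proof. by apply/matrixP => i j; rewrite !mxE mulr1. Qed.

Let rsc_sum b (I : Type) (r : seq I) F :
  rsc b (\sum_(i <- r) F i) = \sum_(i <- r) rsc b (F i).
Proof. by apply: (big_morph (rsc b)); [exact: rscDr|exact: rsc0r]. Qed.

Let colmon_path t q : rsc (colmon t) (path_elt q) = colmon (t.1, t.2 ++ q).
Proof.
by apply/matrixP => i j; rewrite !mxE/=; case: eqP; rewrite ?mul0r// mon_cat.
Qed.

Let colmon_end t : rsc (colmon t) (om (cend t)) = colmon t.
Proof.
by apply/matrixP => i j; rewrite !mxE/=; case: eqP; rewrite ?mul0r// mon_endpoint.
Qed.

Let colmon_neq0 t : colmon t <> 0 -> mon t.1.2 t.2 <> 0.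
Proof.
by move=> t0 m0; apply: t0; apply/matrixP => i j; rewrite !mxE m0; case: eqP.
Qed.

(** Multiplying entry [i] by the ghost of [p] and applying [tau] sends the monomial to its end node.
    It annihilates the smaller ones with the same end: [p] is not a prefix of them, as extending a
    word does not lower its code. *)
Let colmon_notin_low t : colmon t <> 0 -> ~ low (code t) (cend t) (colmon t).
Proof.
move=> t0; have m0 := colmon_neq0 t0; move: t0 m0; case: t => [[i w] p] /= t0 m0 lt.
pose u := endpoint w p.
pose f b := tau (om u * (ghost_elt p * (om w * b i 0))).
have f_low b : low (code (i, w, p)) u b -> f b = 0.
  elim=> [|c [[i' w'] p'] x [/= cu ct] _ IH]; rewrite /f !mxE ?mulr0//.
  rewrite !mulrDr tauD [X in _ + X]IH addr0/=; case: eqP => [ii'|_]; last by rewrite !mulr0.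
  rewrite (mulrA (om w)) -kappaC -mulrA (mulrA (ghost_elt p)) -kappaC -(mulrA (kappa c)).
  rewrite (mulrA (om u)) -kappaC -(mulrA (kappa c)) om_mon.
  case: eqP => [ww'|_]; last by rewrite !mulr0.
  apply: tau_ghost_mon; apply/negP => /prefixP[q p'E].
  move: ct; rewrite /code/= -ii' -ww' p'E => ct.
  by have := leq_word_code_cat (i, w) p q; rewrite leqNgt ct.
have := f_low _ lt; rewrite /f mxE eqxx om_mon eqxx.
have := @ghost_mon_cat w p [::] m0; rewrite cats0 => ->; rewrite mon_nil omM eqxx tau_om => u0.
by apply: m0; rewrite -mon_endpoint -/u u0 mulr0.
Qed.

(** [a.2] is monic with leading monomial [a.1], and all its terms end at the same node. *)
Let lead_pair (a : T * 'cV[R]_n) : Prop :=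
  colmon a.1 <> 0 /\ low (code a.1) (cend a.1) (a.2 - colmon a.1).

Let normalize (N : nat) u b : low N u b -> b <> 0 -> exists c a,
  [/\ lead_pair a, b = kappa c *: a.2, cend a.1 = u, (code a.1 < N)%N &
    exists d, a.2 = kappa d *: b].
Proof.
move=> /(kspan_lead code_inj) h /h [c [t [c0 t0 tu tN lt]]].
exists c, (t, kappa c^-1 *: b); split=> //=.
- split=> //=; have := @kspan_scale _ _ kappa _ _ _ _ c^-1 _ lt.
  by rewrite scalerBr scalerA -rmorphM mulVf// rmorph1 scale1r -tu.
- by rewrite scalerA -rmorphM divff// rmorph1 scale1r.
- by exists c^-1.
Qed.

Let low_path u b (t : T) q : low (code t) u b ->
  low (code (t.1, t.2 ++ q)) (endpoint u q) (rsc b (path_elt q)).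
Proof.
apply: (@kspan_map _ _ _ _ _ _ _ _ _ _ _ (fun y => rsc y (path_elt q))).
- exact: rsc0l.
- by move=> c x y; rewrite rscDl rscZ.
move=> t' [<- lt]; rewrite colmon_path; apply: kspan_gen; split.
  by rewrite /cend/= endpoint_cat.
by rewrite /code/=; apply: word_code_mono.
Qed.

Let lead_pair_end a : lead_pair a -> rsc a.2 (om (cend a.1)) = a.2.
Proof.
case: a => t b [_ /= lt]; rewrite -[b](subrK (colmon t)) rscDl colmon_end; congr (_ + _).
elim: lt => [|c t' y [<- _] _ IH]; first exact: rsc0l.
by rewrite rscDl rscZ colmon_end IH.
Qed.

Let lead_pair_path a q : lead_pair a ->
  low (code (a.1.1, a.1.2 ++ q)) (endpoint (cend a.1) q)
    (rsc a.2 (path_elt q) - colmon (a.1.1, a.1.2 ++ q)).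
Proof.
case: a => t b [_ /= lt]; rewrite -colmon_path -rscNl -rscDl.
exact: low_path.
Qed.

Inductive col_span (L : seq 'cV[R]_n) : 'cV[R]_n -> Prop :=
  | col_span0 : col_span L 0
  | col_spanD b s c : b \in L -> good_elt s -> col_span L c -> col_span L (rsc b s + c).

Let col_span_add L c c' : col_span L c -> col_span L c' -> col_span L (c + c').
Proof. by elim=> [|b s d bL gs _ IH] h; rewrite ?add0r// -addrA; constructor=> //; exact: IH. Qed.

Let col_span_gen (L : seq 'cV[R]_n) b s : b \in L -> good_elt s -> col_span L (rsc b s).
Proof. by move=> bL gs; rewrite -[rsc b s]addr0; constructor=> //; constructor. Qed.

Let col_span_sub L L' c : (forall b s, b \in L -> good_elt s -> col_span L' (rsc b s)) ->
  col_span L c -> col_span L' c.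
Proof.
by move=> h; elim=> [|b s d bL gs _ IH]; [constructor|apply: col_span_add => //; exact: h].
Qed.

Let col_spanP L c : col_span L c -> exists s : 'I_(size L) -> R,
  (forall j, good_elt (s j)) /\ c = \sum_(j < size L) rsc (nth 0 L j) (s j).
Proof.
elim=> [|b z d bL gz _ [s [gs ->]]].
  exists (fun=> 0); split=> [_|]; first exact: good_elt0.
  by rewrite big1// => j _; rewrite rsc0r.
have bi : (index b L < size L)%N by rewrite index_mem.
exists (fun j => s j + if j == Ordinal bi then z else 0); split=> [j|].
  by apply: good_elt_add => //; case: eqP => _ //; exact: good_elt0.
under [RHS]eq_bigr do rewrite rscDr.
rewrite big_split/= addrC; congr (_ + _); rewrite (bigD1 (Ordinal bi))//= eqxx nth_index//.
by rewrite big1 ?addr0// => j /negPf ->; rewrite rsc0r.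
Qed.

Variable e : 'M[R]_n.
Hypothesis e_good : forall i j, good_elt (e i j).

Let basis (L : seq (T * 'cV[R]_n)) : Prop :=
  [/\ forall a, a \in L -> lead_pair a, forall a, a \in L -> e *m a.2 = a.2 &
      forall i, col_span [seq a.2 | a <- L] (col i e)].

Let mulmx_rsc b s : e *m rsc b s = rsc (e *m b) s.
Proof.
apply/matrixP => i j; rewrite !mxE mulr_suml.
by apply: eq_bigr => k _; rewrite !mxE mulrA.
Qed.

Let mulmx_kappa c b : e *m (kappa c *: b) = kappa c *: (e *m b).
Proof.
apply/matrixP => i j; rewrite !mxE mulr_sumr.
by apply: eq_bigr => k _; rewrite !mxE !mulrA kappaC.
Qed.

(** Columns of [e] times complete paths are vectors of paths, because the entries of [e] are good.
    They recover the columns of [e] because the [p p^*] add up to 1. Zero vectors are dropped and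
    the others made monic. *)
Let basis_exists (e_idem : e *m e = e) : exists L, basis L.
Proof.
pose raw b := (exists u, kspan kappa colmon (fun t => cend t = u) b) /\ e *m b = b.
have norm_list (Lr : seq 'cV[R]_n) : (forall b, b \in Lr -> raw b) ->
    exists L, [/\ forall a, a \in L -> lead_pair a, forall a, a \in L -> e *m a.2 = a.2 &
      forall b s, b \in Lr -> good_elt s -> col_span [seq a.2 | a <- L] (rsc b s)].
  elim: Lr => [|b Lr IH] rawL; first by exists [::].
  have [|L [L1 L2 L3]] := IH; first by move=> b' b'L; apply: rawL; rewrite inE b'L orbT.
  have [[u bu] eb] := rawL b (mem_head _ _).
  have [b0|/eqP b0] := eqVneq b 0.
    exists L; split=> // b' s; rewrite inE => /orP[/eqP -> _|]; last exact: L3.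
    by rewrite b0 rsc0l; constructor.
  have [N bN] := kspan_bound code bu; have [c [a [la bE _ _ [d aE]]]] := normalize bN b0.
  exists (a :: L); split.
  - by move=> a'; rewrite inE => /orP[/eqP -> //|]; exact: L1.
  - move=> a'; rewrite inE => /orP[/eqP ->|]; last exact: L2.
    by rewrite aE mulmx_kappa eb.
  move=> b' s; rewrite inE => /orP[/eqP -> gs|b'L gs].
    rewrite bE rscZ -rsc_kappa; apply: col_span_gen; first exact: mem_head.
    exact: good_elt_kappa.
  apply: (col_span_sub _ (L3 _ _ b'L gs)) => b'' s' b''L gs'.
  by apply: col_span_gen => //; rewrite inE b''L orbT.
have [N gN] : exists N, forall k : 'I_n * 'I_n, good N (e k.1 k.2) by apply: good_common.
have to_col (b : 'cV[R]_n) u : (forall k, in_paths (b k 0) u) ->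
    kspan kappa colmon (fun t => cend t = u) b.
  move=> bu; have -> : b = \sum_k \col_k' (if k' == k then b k 0 else 0).
    apply/matrixP => i j; rewrite summxE (bigD1 i)//= mxE eqxx big1 ?addr0 ?ord1// => k /negPf.
    by rewrite mxE eq_sym => ->.
  apply: kspan_sum => k _; move: (bu k).
  apply: (@kspan_map _ _ _ R^o _ _ _ _ _ _ _ (fun z : R^o => \col_k' (if k' == k then z : R else 0))).
  - by apply/matrixP => i j; rewrite !mxE; case: eqP.
  - by move=> c x y; apply/matrixP => i j; rewrite !mxE; case: eqP => _ //; rewrite mulr0 addr0.
  by move=> [w p] /= wp; apply: (@kspan_gen _ _ _ _ _ colmon _ (k, w, p)).
pose Lr := [seq rsc (col i e) (mon g.1 g.2) | i <- enum 'I_n, g <- complete_paths N].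
have [|L [L1 L2 L3]] := norm_list Lr.
  move=> _ /allpairsP[[i g] /= [_ tN ->]]; split.
    exists (endpoint g.1 g.2); apply: to_col => k; rewrite !mxE.
    exact: (gN (k, i)) (complete_pathsP tN).
  by rewrite mulmx_rsc colE mulmxA e_idem.
exists L; split=> // i.
rewrite -[col i e]rsc1 -(complete_paths_sum N) rsc_sum.
suff h (s : seq (W * seq X)) : {subset s <= complete_paths N} -> col_span [seq a.2 | a <- L]
    (\sum_(g <- s) rsc (col i e) (mon g.1 g.2 * (ghost_elt g.2 * om g.1))) by apply: h.
elim: s => [|g s IH] sN; first by rewrite big_nil; constructor.
rewrite big_cons; apply: col_span_add; last by apply: IH => g' g's; apply: sN; rewrite inE g's orbT.
rewrite -rscA; apply: L3; last by apply: good_elt_mul; [exact: good_elt_ghost|exact: good_elt_om].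
by apply: allpairs_f; [rewrite mem_enum|apply: sN; rewrite mem_head].
Qed.

Let measure (L : seq (T * 'cV[R]_n)) := (\sum_(a <- L) (code a.1).+1)%N.

Let reducible L := exists L1 (a : T * 'cV[R]_n) L2 (c : T * 'cV[R]_n),
  [/\ L = L1 ++ a :: L2, c \in L1 ++ L2 & exists q, a.1 = (c.1.1, c.1.2 ++ q)].

(* Right Groebner reduction: when the leading monomial of c is a prefix of that of
   a, subtracting a multiple of c from a lowers the leading monomial of a. *)
Let basis_reduce L : basis L -> reducible L -> exists L', basis L' /\ (measure L' < measure L)%N.
Proof.
case=> B1 B2 B3 [L1 [a [L2 [c [LE cL [q aq]]]]]].
have aL : a \in L by rewrite LE mem_cat mem_head orbT.
have subL a' : a' \in L1 ++ L2 -> a' \in L.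
  by rewrite LE !mem_cat inE => /orP[->//|->]; rewrite !orbT.
have cL' := subL _ cL; have la := B1 _ aL; have lc := B1 _ cL'.
pose b := a.2 - rsc c.2 (path_elt q).
have b_low : low (code a.1) (cend a.1) b.
  have -> : b = (a.2 - colmon a.1) - (rsc c.2 (path_elt q) - colmon a.1).
    by rewrite opprB addrA subrK.
  apply: kspan_add; first by case: la.
  have cE : cend a.1 = endpoint (cend c.1) q by rewrite aq /cend/= endpoint_cat.
  by apply: kspan_opp; rewrite cE; have := lead_pair_path q lc; rewrite -aq.
have eb : e *m b = b by rewrite mulmxBr mulmx_rsc !B2.
have aE s : rsc a.2 s = rsc c.2 (path_elt q * s) + rsc b s.
  by rewrite /b rscDl rscNl rscA addrCA subrr addr0.
have meas : measure L = ((code a.1).+1 + measure (L1 ++ L2))%N.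
  by rewrite /measure LE !big_cat big_cons/= addnCA.
have [b0|/eqP b0] := eqVneq b 0.
  exists (L1 ++ L2); split; last by rewrite meas addSn ltnS leq_addl.
  split=> [a' /subL|a' /subL|i]; [exact: B1|exact: B2|].
  apply: col_span_sub (B3 i) => d s /mapP[a' a'L ->] gs.
  move: a'L; rewrite LE mem_cat inE orbCA -mem_cat => /orP[/eqP ->|a'L].
    rewrite aE b0 rsc0l addr0; apply: col_span_gen; first exact: map_f.
    exact: good_elt_mul (good_elt_path q) gs.
  by apply: col_span_gen => //; exact: map_f.
have [c0 [a' [la' bE a'E a'N [d a'd]]]] := normalize b_low b0.
exists (L1 ++ a' :: L2); split; last first.
  rewrite meas; have -> : measure (L1 ++ a' :: L2) = ((code a'.1).+1 + measure (L1 ++ L2))%N.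
    by rewrite /measure !big_cat big_cons/= addnCA.
  by rewrite ltn_add2r ltnS.
have memE (x : T * 'cV[R]_n) : (x \in L1 ++ a' :: L2) = (x == a') || (x \in L1 ++ L2).
  by rewrite !mem_cat inE orbCA.
split=> [x|x|i].
- by rewrite memE => /orP[/eqP ->//|/subL]; exact: B1.
- rewrite memE => /orP[/eqP ->|/subL]; last exact: B2.
  by rewrite a'd mulmx_kappa eb.
apply: col_span_sub (B3 i) => x s /mapP[a1 a1L ->] gs.
move: a1L; rewrite LE mem_cat inE orbCA -mem_cat => /orP[/eqP ->|a1L].
  rewrite aE; apply: col_span_add; last rewrite bE rscZ -rsc_kappa; apply: col_span_gen.
  - by apply: map_f; rewrite memE cL orbT.
  - exact: good_elt_mul (good_elt_path q) gs.
  - by apply: map_f; rewrite memE eqxx.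
  - exact: good_elt_kappa.
by apply: col_span_gen => //; apply: map_f; rewrite memE a1L orbT.
Qed.

Let basis_reduced : e *m e = e -> exists L, basis L /\ ~ reducible L.
Proof.
move=> /basis_exists[L]; have [N] := ubnP (measure L); elim: N L => // N IH L LN bL.
case: (EM (reducible L)) => [/(basis_reduce bL)[L' [bL' lt]]|nr]; last by exists L.
by apply: (IH L' _ bL'); move: lt LN; rewrite ltnS; exact: leq_trans.
Qed.

(* If no leading monomial is a prefix of another, the leading monomials of the
   summands [rsc b_j s_j] are distinct, so nothing can cancel the largest one. *)
Let reduced_free L (a0 : T * 'cV[R]_n) (s : 'I_(size L) -> R) :
  (forall a, a \in L -> lead_pair a) -> ~ reducible L ->
  (forall j, good_elt (s j)) ->
  (forall j : 'I_(size L), om (cend (nth a0 L j).1) * s j = s j) ->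
  \sum_(j < size L) rsc (nth a0 L j).2 (s j) = 0 -> forall j, s j = 0.
Proof.
move=> lL nr gs es sum0.
pose t (j : 'I_(size L)) := (nth a0 L j).1; pose b (j : 'I_(size L)) := (nth a0 L j).2.
have lj (j : 'I_(size L)) : lead_pair (nth a0 L j) by apply: lL; rewrite mem_nth.
have no_prefix i j q : i != j -> t j <> ((t i).1, (t i).2 ++ q).
  move=> ij tj; apply: nr.
  exists (take j L), (nth a0 L j), (drop j.+1 L), (nth a0 L i); split; last by exists q.
    by rewrite -drop_nth ?cat_take_drop.
  rewrite mem_cat; have [lt|] := ltnP i j.
    by rewrite -(nth_take a0 lt) mem_nth// size_takel// ltnW.
  rewrite leq_eqVlt (inj_eq (@ord_inj _)) eq_sym (negPf ij)/= => lt; apply/orP; right.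
  have -> : nth a0 L i = nth a0 (drop j.+1 L) (i - j.+1) by rewrite nth_drop subnKC.
  by rewrite mem_nth// size_drop ltn_sub2r// (leq_ltn_trans lt).
have [N gN] := good_common gs.
(* Multiplication by the complete paths turns the coefficients into combinations of paths, and loses
   nothing because the [p p^*] add up to 1. *)
suff h g : g \in complete_paths N -> forall j, s j * mon g.1 g.2 = 0.
  move=> j; rewrite -[s j]mulr1 -(complete_paths_sum N) mulr_sumr big_seq big1// => g gin.
  by rewrite mulrA h// mul0r.
move=> gin; pose u := endpoint g.1 g.2; pose a j := s j * mon g.1 g.2.
have a_paths j : kspan kappa (fun q => mon (cend (t j)) q : R^o)
    (fun q => endpoint (cend (t j)) q = u) (a j).
  rewrite /a -es -mulrA; have := gN j _ _ (complete_pathsP gin).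
  apply: (@kspan_map _ _ _ R^o R^o _ _ _ _ _ _ (fun z : R^o => om (cend (t j)) * z : R^o)).
  - exact: mulr0.
  - move=> c x y; rewrite mulrDr; congr (_ + _).
    by rewrite -[kappa c *: x]/(kappa c * x) mulrA -kappaC -mulrA.
  move=> [w q] /= wq; rewrite -[mon2 _]/(mon w q) om_mon; case: eqP => [ww|_]; last by constructor.
  by rewrite -ww; apply: (@kspan_gen _ _ _ R^o _ (mon (cend (t j)))); rewrite ww.
have suma : \sum_j rsc (b j) (a j) = 0.
  have := congr1 (fun y => rsc y (mon g.1 g.2)) sum0; rewrite rsc0l.
  rewrite (big_morph (fun y => rsc y _) (fun y z => rscDl y z _) (rsc0l _)) => E; rewrite -[RHS]E.
  by apply: eq_bigr => j _; rewrite rscA.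
pose cd j q := code ((t j).1, (t j).2 ++ q).
have cd_inj j : injective (cd j).
  by move=> q q' /code_inj[] /eqP; rewrite eqseq_cat// eqxx => /eqP.
have a_lead j : a j <> 0 -> exists cq : K * seq X, [/\ cq.1 != 0,
    colmon ((t j).1, (t j).2 ++ cq.2) <> 0, endpoint (cend (t j)) cq.2 = u &
    low (cd j cq.2) u (rsc (b j) (a j) - kappa cq.1 *: colmon ((t j).1, (t j).2 ++ cq.2))].
  move=> aj0; have [N' aN] := kspan_bound (cd j) (a_paths j).
  have [c [q [c0 q0 qu qN lt]]] := kspan_lead (@cd_inj j) aN aj0.
  have cE q' : endpoint (cend (t j)) q' = u -> cend ((t j).1, (t j).2 ++ q') = u.
    by move=> <-; rewrite /cend/= endpoint_cat.
  have bq q' : rsc (b j) (mon (cend (t j)) q') = rsc (b j) (path_elt q').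
    by rewrite -rscA lead_pair_end.
  exists (c, q); split=> //=.
    move=> t0; apply: q0; rewrite -(ghost_mon_cat q (colmon_neq0 (lj j).1)).
    move/matrixP/(_ (t j).1.1 0): t0; rewrite !mxE eqxx/= => ->.
    exact: mulr0.
  rewrite -[rsc _ _](subrK (rsc (b j) (kappa c * mon (cend (t j)) q))) -addrA -rscN -rscDr.
  apply: kspan_add.
    move: lt; apply: (@kspan_map _ _ _ R^o _ _ _ _ _ _ _ (fun z : R^o => rsc (b j) z)).
    - exact: rsc0r.
    - by move=> d x y; rewrite rscDr -rsc_kappa.
    move=> q' [q'u q'q]; rewrite bq -[rsc _ _](subrK (colmon ((t j).1, (t j).2 ++ q'))).
    apply: kspan_add; last by apply: kspan_gen; split; [exact: cE|].
    have := lead_pair_path q' (lj j); rewrite -/(t j) -/(b j) q'u.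
    by apply: kspan_mono => t' [? lt']; split=> //; exact: ltn_trans lt' q'q.
  rewrite rsc_kappa -scalerBr bq; apply: kspan_scale.
  by have := lead_pair_path q (lj j); rewrite -/(t j) -/(b j) qu.
move=> j; apply: contrapT => /eqP aj0.
have /choice[cq cqP] : forall i, exists cq : K * seq X, a i <> 0 -> [/\ cq.1 != 0,
    colmon ((t i).1, (t i).2 ++ cq.2) <> 0, endpoint (cend (t i)) cq.2 = u &
    low (cd i cq.2) u (rsc (b i) (a i) - kappa cq.1 *: colmon ((t i).1, (t i).2 ++ cq.2))].
  move=> i; case: (EM (a i = 0)) => [ai|/a_lead[x xP]]; last by exists x.
  by exists (1, [::]).
have [i0 /eqP ai0 imax] := @arg_maxnP _ j (fun i => a i != 0) (fun i => cd i (cq i).2) aj0.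
have {}imax i : a i <> 0 -> (cd i (cq i).2 <= cd i0 (cq i0).2)%N by move=> /eqP/imax.
have [c0 col0 end0 low0] := cqP i0 ai0.
set t0 := ((t i0).1, _) in col0 low0; have ct0 : code t0 = cd i0 (cq i0).2 by [].
have cend0 : cend t0 = u by rewrite /cend/= endpoint_cat.
have low_rest i : i != i0 -> low (code t0) u (rsc (b i) (a i)).
  move=> ii0; have [ai|/eqP ai] := eqVneq (a i) 0; first by rewrite ai rsc0r; constructor.
  have [ci coli endi lowi] := cqP i ai.
  have lt : (cd i (cq i).2 < code t0)%N.
    rewrite ct0 ltn_neqAle imax// andbT; apply/eqP => /code_inj[t1 t2].
    (* If two leading words coincide, the shorter of the two basis monomials is a prefix of the
       other, against reducedness. *)
    have prefix_of (p p' q q' : seq X) : p ++ q = p' ++ q' -> (size p <= size p')%N ->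
        p' = p ++ drop (size p) p'.
      move=> /(congr1 (take (size p))) + le; rewrite take_size_cat// takel_cat// => E.
      by rewrite {1}E cat_take_drop.
    case: (leqP (size (t i).2) (size (t i0).2)) => [/(prefix_of _ _ _ _ t2) E|/ltnW].
      by apply: (no_prefix i i0 (drop (size (t i).2) (t i0).2)) => //; rewrite -E t1; case: (t i0).
    move=> /(prefix_of _ _ _ _ (esym t2)) E.
    apply: (no_prefix i0 i (drop (size (t i0).2) (t i).2)); first by rewrite eq_sym.
    by rewrite -E -t1; case: (t i).
  rewrite -[rsc _ _](subrK (kappa (cq i).1 *: colmon ((t i).1, (t i).2 ++ (cq i).2))).
  apply: kspan_add.
    by apply: kspan_mono lowi => t' [? lt']; split=> //; exact: ltn_trans lt' lt.
  apply/kspan_scale/kspan_gen; split=> //.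
  by rewrite /cend/= endpoint_cat.
apply: (colmon_notin_low col0); rewrite cend0.
suff: low (code t0) u (kappa (cq i0).1 *: colmon t0).
  move=> /(kspan_scale (cq i0).1^-1); rewrite scalerA -rmorphM mulVf// rmorph1 scale1r.
  exact.
have -> : kappa (cq i0).1 *: colmon t0 =
    - ((rsc (b i0) (a i0) - kappa (cq i0).1 *: colmon t0) + \sum_(i | i != i0) rsc (b i) (a i)).
  move: suma; rewrite (bigD1 i0)//= => /eqP; rewrite addr_eq0 => /eqP ->.
  by rewrite addrAC addNr add0r opprK.
by apply: kspan_opp; apply: kspan_add => //; exact: kspan_sum.
Qed.

(** The columns of [x] are a reduced basis of the image of [e], and [y] holds coordinates of the
    columns of [e], cut by the end nodes [D]. Then [x y = e] gives [x (y x - D) = 0], and freeness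
    gives [y x = D]. *)
Theorem idem_free_nodes : e *m e = e ->
  exists k (w : 'I_k -> W) (x : 'M[R]_(n, k)) (y : 'M[R]_(k, n)),
    x *m y = e /\ y *m x = diag_mx (\row_j om (w j)).
Proof.
move=> ee; have [L [[L1 L2 L3] nr]] := basis_reduced ee.
case: L L1 L2 L3 nr => [|a0 L'] L1 L2 L3 nr.
  have w0 (i : 'I_0) : W by case: i.
  exists 0%N, w0, 0, 0; split; last by apply/matrixP => -[].
  rewrite mul0mx; apply/matrixP => i j; rewrite mxE.
  have : col j e = 0 by case: (L3 j).
  by move/matrixP/(_ i 0); rewrite !mxE.
set L := a0 :: L' in L1 L2 L3 nr *.
pose w (j : 'I_(size L)) := cend (nth a0 L j).1.
pose x : 'M[R]_(n, size L) := \matrix_(i, j) (nth a0 L j).2 i 0.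
have lj (j : 'I_(size L)) : lead_pair (nth a0 L j) by apply: L1; rewrite mem_nth.
have spanE (i : 'I_n) : exists s : 'I_(size L) -> R,
  (forall j, good_elt (s j)) /\ col i e = \sum_(j < size L) rsc (nth a0 L j).2 (s j).
  have := col_spanP (L3 i); rewrite size_map => -[s [gs ->]]; exists s; split=> //.
  by apply: eq_bigr => j _; rewrite (nth_map a0).
have [s sP] := choice spanE.
pose y' : 'M[R]_(size L, n) := \matrix_(j, i) s i j.
pose D := diag_mx (\row_j om (w j)); pose y := D *m y' *m e.
have DD : D *m D = D.
  rewrite mulmx_diag; congr diag_mx; apply/matrixP => i j.
  by rewrite !mxE omM eqxx.
have xD : x *m D = x.
  apply/matrixP => i j; rewrite mul_mx_diag !mxE.
  by have := lead_pair_end (lj j) => /matrixP/(_ i 0); rewrite !mxE.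
have ex : e *m x = x.
  apply/matrixP => i j; have /matrixP/(_ i 0) := L2 _ (mem_nth a0 (ltn_ord j)).
  by rewrite !mxE => <-; apply: eq_bigr => k _; rewrite !mxE.
have xy' : x *m y' = e.
  apply/matrixP => i j; have [_ /matrixP/(_ i 0)] := sP j; rewrite mxE => ->.
  by rewrite summxE mxE; apply: eq_bigr => k _; rewrite !mxE.
have xy : x *m y = e by rewrite /y !mulmxA xD xy' ee.
have x_good i j : good_elt (x i j).
  rewrite mxE; have [_ lt] := lj j; set b := (nth a0 L j).2 in lt *.
  rewrite -[b](subrK (colmon (nth a0 L j).1)) mxE; apply: good_elt_add.
    elim: lt => [|c t z _ _ IH]; first by rewrite mxE; exact: good_elt0.
    rewrite !mxE; apply: good_elt_add => //; apply: good_elt_kappa.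
    by case: eqP => _; [exact: good_elt_mon|exact: good_elt0].
  by rewrite mxE; case: eqP => _; [exact: good_elt_mon|exact: good_elt0].
have D_good i j : good_elt (D i j).
  by rewrite !mxE; case: eqP => _; rewrite ?mulr1n ?mulr0n; [exact: good_elt_om|exact: good_elt0].
have mul_good p q r (A : 'M[R]_(p, q)) (B : 'M[R]_(q, r)) :
    (forall i j, good_elt (A i j)) -> (forall i j, good_elt (B i j)) ->
    forall i j, good_elt ((A *m B) i j).
  by move=> gA gB i j; rewrite mxE; apply: good_elt_sum => k _; exact: good_elt_mul.
have y_good i j : good_elt (y i j).
  apply: (mul_good); last exact: e_good; apply: (mul_good) => // i' j'.
  by rewrite mxE; case: (sP j').
exists (size L), w, x, y; split=> //.
apply/matrixP => i j; apply/eqP; rewrite -subr_eq0; apply/eqP.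
have -> : (y *m x) i j - D i j = (y *m x - D) i j by rewrite !mxE.
move: i; apply: (@reduced_free L a0 (fun i => (y *m x - D) i j)) => //.
- move=> i; rewrite mxE [(- D) _ _]mxE; apply: good_elt_add; last exact/good_elt_opp/D_good.
  exact: mul_good _ _ _ y x y_good x_good i j.
- move=> i; have <- : D *m (y *m x - D) = y *m x - D.
    by rewrite mulmxBr DD /y !mulmxA DD.
  by rewrite mul_diag_mx mxE [(\row__ _) _ _]mxE mulrA omM eqxx.
have: x *m (y *m x - D) = 0 by rewrite mulmxBr mulmxA xy ex xD subrr.
move=> /matrixP H; apply/matrixP => i k; rewrite !ord1; have := H i j; rewrite mxE [RHS]mxE => E.
by rewrite summxE mxE -[RHS]E; apply: eq_bigr => l _; rewrite !mxE.
Qed.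

End Columns.

End PathSystem.

(** * Classes in K_0 *)

Section K0Classes.
Variable R : pzRingType.

Definition idem_class (e : idem R) : K0 R := K0_pi (e, idem_zero R).

Lemma idem_class_eqv e f : idem_eqv e f -> idem_class e = idem_class f.
Proof. by move=> ef; apply: K0_pi_idem => //; exact: idem_refl. Qed.

Lemma idem_classD e f : idem_class (idem_add e f) = idem_class e + idem_class f.
Proof.
rewrite [RHS]K0_piD; apply: K0_pi_idem => /=; first exact: idem_refl.
exact/idem_sym/idem_add0.
Qed.

Lemma idem_class0 (e : idem R) : idem_dim e = 0%N -> idem_class e = 0.
Proof.
move=> e0; apply: K0_pi_idem => /=; last exact: idem_refl.
apply: (@idem_cast R e (idem_zero R) e0); apply/matrixP => i.
by case: i.
Qed.

Lemma K0_pi_class (p : idem R * idem R) : K0_pi p = idem_class p.1 - idem_class p.2.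
Proof.
rewrite [X in _ = _ + X]K0_piN [RHS]K0_piD; apply: K0_pi_idem => /=; apply: idem_sym.
  by apply: idem_trans (idem_addC _ _) (idem_add0 _).
exact: idem_add0.
Qed.

Lemma scalar_idem (z : R) : z * z = z -> (z%:M : 'M_1) *m z%:M = z%:M.
Proof. by move=> zz; rewrite -scalar_mxM zz. Qed.

(** The default 0 on elements that are not idempotent lets sums of classes be written without
    carrying proofs. *)
Definition elt_class (z : R) : K0 R :=
  if pselect (z * z = z) is left zz then idem_class (Idem (scalar_idem zz)) else 0.

Lemma elt_classE z (zz : z * z = z) : elt_class z = idem_class (Idem (scalar_idem zz)).
Proof.
rewrite /elt_class; case: pselect => // zz'; apply: idem_class_eqv.
by exists z%:M, z%:M; rewrite /= scalar_idem.
Qed.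

Lemma elt_class_eqv (a b z w : R) : z * z = z -> w * w = w -> a * b = z -> b * a = w ->
  elt_class z = elt_class w.
Proof.
move=> zz ww ab ba; rewrite (elt_classE zz) (elt_classE ww); apply: idem_class_eqv.
by exists a%:M, b%:M; rewrite /= -!scalar_mxM ab ba.
Qed.

(** The diagonal matrix splits as the block sum of its first entry and the rest. *)
Lemma elt_class_row (k : nat) (d : 'I_k -> R) (e : idem R)
    (x : 'M_(idem_dim e, k)) (y : 'M_(k, idem_dim e)) :
  (forall j, d j * d j = d j) -> x *m y = e -> y *m x = diag_mx (\row_j d j) ->
  idem_class e = \sum_j elt_class (d j).
Proof.
move=> dd xy yx.
have diagP (m : nat) (d' : 'rV[R]_m) : (forall j, d' 0 j * d' 0 j = d' 0 j) ->
    diag_mx d' *m diag_mx d' = diag_mx d'.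
  move=> h; rewrite mulmx_diag; congr diag_mx; apply/matrixP => i j.
  by rewrite !mxE ord1 h.
have ddr j : (\row_j d j) 0 j * (\row_j d j) 0 j = (\row_j d j) 0 j by rewrite !mxE.
have -> : idem_class e = idem_class (Idem (diagP k (\row_j d j) ddr)).
  by apply: idem_class_eqv; exists x, y.
move: ddr; have -> : \sum_j elt_class (d j) = \sum_j elt_class ((\row_j d j) 0 j).
  by apply: eq_bigr => j _; rewrite mxE.
move: (\row_j d j) => {x y xy yx dd} r.
elim: k r {d} => [|k IH] r rr.
  by rewrite big_ord0; apply: idem_class0.
rewrite big_ord_recl.
pose r' : 'rV_k := \row_j r 0 (lift ord0 j).
have rr' j : r' 0 j * r' 0 j = r' 0 j by rewrite !mxE.
have -> : \sum_(i < k) elt_class (r 0 (lift ord0 i)) = idem_class (Idem (diagP k r' rr')).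
  by rewrite IH; apply: eq_bigr => j _; rewrite mxE.
rewrite (elt_classE (rr ord0)) -idem_classD; apply: idem_class_eqv.
have rE : r = row_mx (r 0 ord0)%:M r'.
  apply/matrixP => i j; rewrite !ord1; case: (@split_ordP 1 k j) => l ->.
    rewrite [RHS](row_mxEl (r 0 ord0)%:M r') [RHS]mxE ord1 eqxx mulr1n.
    by congr (fun_of_matrix r _ _); apply: val_inj.
  rewrite [RHS](row_mxEr (r 0 ord0)%:M r') [RHS]mxE.
  by congr (fun_of_matrix r _ _); apply: val_inj.
have dE : diag_mx r = block_mx (r 0 ord0)%:M 0 0 (diag_mx r') :> 'M_(1 + k).
  transitivity (diag_mx (row_mx (r 0 ord0)%:M r')); first by congr diag_mx; exact: rE.
  rewrite diag_mx_row; congr block_mx.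
  by apply/matrixP => i j; rewrite !mxE !ord1 !eqxx.
by exists (diag_mx r), (diag_mx r); rewrite /= diagP.
Qed.

Lemma elt_classD (z w : R) : z * z = z -> w * w = w -> z * w = 0 -> w * z = 0 ->
  elt_class (z + w) = elt_class z + elt_class w.
Proof.
move=> zz ww zw wz.
have ss : (z + w) * (z + w) = z + w.
  by rewrite mulrDl !mulrDr zz ww zw wz addr0 add0r.
rewrite (elt_classE ss) (elt_classE zz) (elt_classE ww) -idem_classD.
apply: idem_class_eqv; exists (row_mx z%:M w%:M), (col_mx z%:M w%:M); split=> /=.
  by rewrite mul_row_col -!scalar_mxM zz ww raddfD.
by rewrite mul_col_row -!scalar_mxM zz ww zw wz !raddf0.
Qed.

Lemma elt_class_sum (I : eqType) (r : seq I) (F : I -> R) : uniq r ->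
  (forall i j, F i * F j = if i == j then F i else 0) ->
  elt_class (\sum_(i <- r) F i) = \sum_(i <- r) elt_class (F i).
Proof.
move=> + FF; elim: r => [_|i r IH /= /andP[ir ur]].
  (* The class of 0 vanishes by additivity applied to [0 + 0] and cancellation. *)
  by rewrite !big_nil; apply: (addrI (elt_class 0)); rewrite -elt_classD ?mulr0// !addr0.
have Fs j : j \notin r -> F j * (\sum_(i <- r) F i) = 0 /\ (\sum_(i <- r) F i) * F j = 0.
  move=> jr; rewrite mulr_sumr mulr_suml !big_seq; split; apply: big1 => l lr; rewrite FF.
    by case: eqP => // jl; rewrite jl lr in jr.
  by case: eqP => // jl; rewrite -jl lr in jr.
have ss : (\sum_(i <- r) F i) * (\sum_(i <- r) F i) = \sum_(i <- r) F i.
  rewrite mulr_suml big_seq [RHS]big_seq; apply: eq_bigr => j jr.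
  rewrite mulr_sumr (bigD1_seq j)//= FF eqxx big1 ?addr0// => l /negPf lj.
  by rewrite FF eq_sym lj.
have [Fis isF] := Fs i ir.
by rewrite !big_cons elt_classD ?FF ?eqxx ?IH.
Qed.

End K0Classes.

(** * Functoriality of K_0 *)

Section K0Functor.
Variables (R S : pzRingType) (f : {additive R -> S}).
Hypothesis fM : forall a b, f (a * b) = f a * f b.

Lemma map_mulmx m n p (A : 'M[R]_(m, n)) (B : 'M[R]_(n, p)) :
  map_mx f (A *m B) = map_mx f A *m map_mx f B.
Proof.
apply/matrixP => i j; rewrite !mxE raddf_sum; apply: eq_bigr => k _.
by rewrite !mxE fM.
Qed.

Lemma map_idem_subproof (e : idem R) : map_mx f e *m map_mx f e = map_mx f e.
Proof. by rewrite -map_mulmx idem_mxP. Qed.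

Definition map_idem (e : idem R) : idem S := Idem (map_idem_subproof e).

Lemma map_idem_eqv e e' : idem_eqv e e' -> idem_eqv (map_idem e) (map_idem e').
Proof.
case=> x [y [xy yx]]; exists (map_mx f x), (map_mx f y).
by rewrite -!map_mulmx xy yx.
Qed.

Lemma map_idem_add e e' :
  idem_eqv (map_idem (idem_add e e')) (idem_add (map_idem e) (map_idem e')).
Proof.
have E : map_mx f (block_mx e 0 0 e') = block_mx (map_mx f e) 0 0 (map_mx f e').
  by rewrite map_block_mx !raddf0.
by exists (map_mx f (block_mx e 0 0 e')), (map_mx f (block_mx e 0 0 e'));
  rewrite -map_mulmx idem_add_subproof.
Qed.

Definition K0_map (x : K0 R) : K0 S :=
  K0_pi (map_idem (K0_repr x).1, map_idem (K0_repr x).2).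

Lemma K0_map_pi p : K0_map (K0_pi p) = K0_pi (map_idem p.1, map_idem p.2).
Proof.
apply/K0_piP; have [r h] := K0_pi_repr p; exists (map_idem r) => /=.
have both a b c : idem_eqv (map_idem (idem_add (idem_add a b) c))
    (idem_add (idem_add (map_idem a) (map_idem b)) (map_idem c)).
  apply: idem_trans (map_idem_add _ _) _.
  exact: idem_addE (map_idem_add _ _) (idem_refl _).
apply: idem_trans (idem_sym (both _ _ _)) _.
by apply: idem_trans (map_idem_eqv h) (both _ _ _).
Qed.

Lemma K0_map_class e : K0_map (idem_class e) = idem_class (map_idem e).
Proof.
rewrite K0_map_pi; apply: K0_pi_idem => /=; first exact: idem_refl.
by exists 0, 0; split; apply/matrixP => -[].
Qed.

Lemma K0_mapD x y : K0_map (x + y) = K0_map x + K0_map y.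
Proof.
elim/K0W: x => p; elim/K0W: y => q.
rewrite [K0_pi p + _]K0_piD !K0_map_pi [RHS]K0_piD.
by apply: K0_pi_idem; apply: map_idem_add.
Qed.

Lemma K0_map_is_additive : additive K0_map.
Proof.
move=> x y; apply: (addIr (K0_map y)).
by rewrite -K0_mapD !subrK.
Qed.

Lemma K0_map_elt_class z : z * z = z -> K0_map (elt_class z) = elt_class (f z).
Proof.
move=> zz; have fzz : f z * f z = f z by rewrite -fM zz.
rewrite (elt_classE zz) (elt_classE fzz) K0_map_class; apply: idem_class_eqv.
have E : map_mx f (z%:M : 'M_1) = (f z)%:M.
  by apply/matrixP => i j; rewrite !mxE !ord1 eqxx.
by exists (f z)%:M, (f z)%:M; rewrite /= E scalar_idem.
Qed.

End K0Functor.

Lemma K0_map_cancel (R S : pzRingType) (f : {additive R -> S}) (g : {additive S -> R})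
    (fM : forall a b, f (a * b) = f a * f b) (gM : forall a b, g (a * b) = g a * g b) :
  cancel f g -> cancel (K0_map fM) (K0_map gM).
Proof.
move=> fK; elim/K0W => p; rewrite !K0_map_pi.
have E (e : idem R) : idem_eqv (map_idem gM (map_idem fM e)) e.
  have Ee : map_mx g (map_mx f e) = e by apply/matrixP => i j; rewrite !mxE fK.
  by exists (e : 'M_(idem_dim e)), (e : 'M_(idem_dim e)); rewrite /= Ee idem_mxP.
by apply: K0_pi_idem; apply: E.
Qed.

Lemma cyclic_K0_iso (R S : pzRingType) (f : {additive R -> S}) (g : {additive S -> R}) :
  (forall a b, f (a * b) = f a * f b) -> (forall a b, g (a * b) = g a * g b) ->
  cancel f g -> cyclic_zmod (K0 S) -> cyclic_zmod (K0 R).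
Proof.
move=> fM gM fK [c cP]; exists (K0_map gM c) => x.
have [m xm] := cP (K0_map fM x); exists m.
rewrite -[x](K0_map_cancel fM gM fK) xm.
pose h : {additive K0 S -> K0 R} := HB.pack (K0_map gM)
  (GRing.isZmodMorphism.Build _ _ (K0_map gM) (K0_map_is_additive gM)).
exact: (raddfMz h).
Qed.

(** * Generation of K_0 by the vertices *)

Section Grading.
Variables (K : fieldType) (V : finType) (Ed : Type) (G : graph V Ed).
Local Notation L := (lpa K G).
Local Notation vx := (lpa_vertex K G).
Local Notation ed := (lpa_edge K G).
Local Notation gh := (lpa_ghost K G).

(* The action of L_K(G) on the functions int -> L_K(G) by left multiplication
   followed by a shift by the degree; it makes the Z-grading visible. *)
Fixpoint shift_act (t : lpa_term K V Ed) (h : int -> L) : int -> L :=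
  match t with
  | LVertex v => fun d => vx v * h d
  | LEdge e => fun d => ed e * h (d - 1)
  | LGhost e => fun d => gh e * h (d + 1)
  | LZero => fun=> 0
  | LAdd s t => fun d => shift_act s h d + shift_act t h d
  | LOpp s => fun d => - shift_act s h d
  | LScale a s => fun d => a *: shift_act s h d
  | LMul s t => shift_act s (shift_act t h)
  end.

Lemma shift_actD t h h' :
  shift_act t (fun d => h d + h' d) = fun d => shift_act t h d + shift_act t h' d.
Proof.
elim: t h h' => [v|e|e||s IHs t IHt|s IH|a s IH|s IHs t IHt] h h' /=;
  try by apply/funext => d; rewrite ?mulrDr ?addr0.
- by rewrite IHs IHt; apply/funext => d; rewrite addrACA.
- by rewrite IH; apply/funext => d; rewrite opprD.
- by rewrite IH; apply/funext => d; rewrite scalerDr.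
- by rewrite IHt IHs.
Qed.

Lemma shift_actZ t a h :
  shift_act t (fun d => a *: h d) = fun d => a *: shift_act t h d.
Proof.
elim: t h => [v|e|e||s IHs t IHt|s IH|b s IH|s IHs t IHt] h /=;
  try by apply/funext => d; rewrite ?lpa_scalerAr ?scaler0.
- by rewrite IHs IHt; apply/funext => d; rewrite scalerDr.
- by rewrite IH; apply/funext => d; rewrite scalerN.
- by rewrite IH; apply/funext => d; rewrite !scalerA mulrC.
- by rewrite IHt IHs.
Qed.

Lemma shift_act_eqv s t : lpa_eqv G s t -> shift_act s = shift_act t.
Proof.
elim=> //=.
- by move=> x y z _ -> _ ->.
- by move=> x x' y y' _ -> _ ->.
- by move=> x x' _ ->.
- by move=> a x x' _ ->.
- by move=> x x' y y' _ -> _ ->.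
- by move=> x y z; apply/funext => h; apply/funext => d; rewrite addrA.
- by move=> x y; apply/funext => h; apply/funext => d; rewrite addrC.
- by move=> x; apply/funext => h; apply/funext => d; rewrite add0r.
- by move=> x; apply/funext => h; apply/funext => d; rewrite addNr.
- by move=> a b x; apply/funext => h; apply/funext => d; rewrite scalerA.
- by move=> x; apply/funext => h; apply/funext => d; rewrite scale1r.
- by move=> a x y; apply/funext => h; apply/funext => d; rewrite scalerDr.
- by move=> a b x; apply/funext => h; apply/funext => d; rewrite scalerDl.
- by move=> x y z; apply/funext => h; rewrite shift_actD.
- by move=> a x y; apply/funext => h; rewrite shift_actZ.
- by move=> v; apply/funext => h; apply/funext => d; rewrite mulrA vertexMid.
- move=> v w /eqP/negPf vw; apply/funext => h; apply/funext => d.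
  by rewrite mulrA vertexM vw mul0r.
- by move=> e; apply/funext => h; apply/funext => d; rewrite mulrA src_edge.
- by move=> e; apply/funext => h; apply/funext => d; rewrite mulrA edge_rng.
- by move=> e; apply/funext => h; apply/funext => d; rewrite mulrA rng_ghost.
- by move=> e; apply/funext => h; apply/funext => d; rewrite mulrA ghost_src.
- by move=> e; apply/funext => h; apply/funext => d; rewrite addrK mulrA ghost_edge.
- move=> e e' ee'; apply/funext => h; apply/funext => d.
  by rewrite mulrA ghost_edge_neq// mul0r.
move=> v es es0 us esv; apply/funext => h; apply/funext => d.
have -> : vx v = lpa_pi G (foldr (fun e x => LAdd (LMul (LEdge e) (LGhost e)) x) LZero es).
  exact/lpa_piP/lpa_CK2.
elim: (es) => [|e es' IH] /=; first exact: mul0r.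
by rewrite lpa_addE lpa_prodE mulrDl IH subrK mulrA.
Qed.

(** Degree is tested on the action, as multiplication combined with a shift by [d], so that no
    direct sum decomposition has to be constructed. *)
Definition homogeneous (d : int) (z : L) :=
  forall h k, shift_act (lpa_repr z) h k = z * h (k - d).

Lemma shift_act_repr t : shift_act (lpa_repr (lpa_pi G t)) = shift_act t.
Proof. exact/shift_act_eqv/lpa_pi_repr. Qed.

Lemma shift_act_add (x y : L) h k :
  shift_act (lpa_repr (x + y)) h k = shift_act (lpa_repr x) h k + shift_act (lpa_repr y) h k.
Proof. by rewrite -[x]lpa_reprK -[y]lpa_reprK -lpa_addE !shift_act_repr. Qed.

Lemma shift_act0 h k : shift_act (lpa_repr (0 : L)) h k = 0.
Proof. by rewrite shift_act_repr. Qed.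

Lemma homogeneous_vertex v : homogeneous 0 (vx v).
Proof. by move=> h k; rewrite shift_act_repr subr0. Qed.

Lemma homogeneous_edge e : homogeneous 1 (ed e).
Proof. by move=> h k; rewrite shift_act_repr. Qed.

Lemma homogeneous_ghost e : homogeneous (-1) (gh e).
Proof. by move=> h k; rewrite shift_act_repr opprK. Qed.

Lemma homogeneousD d x y : homogeneous d x -> homogeneous d y -> homogeneous d (x + y).
Proof. by move=> hx hy h k; rewrite shift_act_add hx hy mulrDl. Qed.

Lemma homogeneous0 d : homogeneous d 0.
Proof. by move=> h k; rewrite shift_act0 mul0r. Qed.

Lemma homogeneousZ d a x : homogeneous d x -> homogeneous d (a *: x).
Proof.
move=> hx h k; rewrite -lpa_scalerAl -hx.
by rewrite -[x in a *: x]lpa_reprK -lpa_scaleE shift_act_repr.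
Qed.

Lemma homogeneousN d x : homogeneous d x -> homogeneous d (- x).
Proof. by move=> /(homogeneousZ (-1)); rewrite scaleN1r. Qed.

Lemma homogeneousM c d x y : homogeneous c x -> homogeneous d y -> homogeneous (c + d) (x * y).
Proof.
move=> hx hy h k; rewrite -[x in LHS]lpa_reprK -[y in LHS]lpa_reprK -lpa_prodE shift_act_repr/=.
by rewrite hx hy mulrA opprD addrA.
Qed.

Lemma homogeneous_sum d (I : Type) (r : seq I) (P : pred I) F :
  (forall i, P i -> homogeneous d (F i)) -> homogeneous d (\sum_(i <- r | P i) F i).
Proof. by move=> h; apply: big_ind => //; [exact: homogeneous0|exact: homogeneousD]. Qed.

Lemma homogeneous1 : homogeneous 0 1.
Proof. by rewrite lpa_oneE; apply: homogeneous_sum => v _; exact: homogeneous_vertex. Qed.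

(** Acting on the unit placed in degree 0 and reading the result in degree 0 extracts the degree-0
    component. *)
Definition degree0 (z : L) : L :=
  shift_act (lpa_repr z) (fun d => if d == 0 then 1 else 0) 0.

Lemma degree0D x y : degree0 (x + y) = degree0 x + degree0 y.
Proof. exact: shift_act_add. Qed.

Lemma degree0_0 : degree0 0 = 0.
Proof. exact: shift_act0. Qed.

Lemma degree0_homogeneous d z : homogeneous d z -> degree0 z = if d == 0 then z else 0.
Proof.
move=> hz; rewrite /degree0 hz sub0r oppr_eq0.
by case: eqP => _; rewrite ?mulr1 ?mulr0.
Qed.

Definition lpa_scalar (a : K) : L := a *: (1 : L).

Lemma lpa_scalar_additive : additive lpa_scalar.
Proof. by move=> a b; rewrite /lpa_scalar scalerBl. Qed.

Lemma lpa_scalar_monoid : monoid_morphism lpa_scalar.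
Proof.
split=> [|a b]; first exact: scale1r.
by rewrite /lpa_scalar -lpa_scalerAl mul1r scalerA.
Qed.

HB.instance Definition _ := GRing.isZmodMorphism.Build K L lpa_scalar lpa_scalar_additive.
HB.instance Definition _ := GRing.isMonoidMorphism.Build K L lpa_scalar lpa_scalar_monoid.

Lemma lpa_scalarE a z : lpa_scalar a * z = a *: z.
Proof. by rewrite /lpa_scalar -lpa_scalerAl mul1r. Qed.

Lemma lpa_scalarC a z : lpa_scalar a * z = z * lpa_scalar a.
Proof. by rewrite lpa_scalarE /lpa_scalar -lpa_scalerAr mulr1. Qed.

End Grading.

(** * Idempotents involving finitely many edges *)

Section RelativeGraph.
Variables (K : fieldType) (V : finType) (Ed : eqType) (G : graph V Ed).
Local Notation L := (lpa K G).
Local Notation vx := (lpa_vertex K G).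
Local Notation ed := (lpa_edge K G).
Local Notation gh := (lpa_ghost K G).
Variables (I : finType) (F : I -> Ed).
Hypothesis F_inj : injective F.

Let part v : L := \sum_(i | src G (F i) == v) ed (F i) * gh (F i).

(* Cutting each vertex v into the part covered by the finitely many edges F and
   the remainder, a sink, turns the subalgebra generated by V and F into a
   quotient of a Leavitt path algebra of a finite graph. *)
Let om (w : V * bool) : L := if w.2 then part w.1 else vx w.1 - part w.1.
Let sr (x : I * bool) : V * bool := (src G (F x.1), true).
Let rg (x : I * bool) : V * bool := (rng G (F x.1), x.2).
Let xe (x : I * bool) : L := ed (F x.1) * om (rg x).
Let xg (x : I * bool) : L := om (rg x) * gh (F x.1).

Let vertex_part u v : vx u * part v = if u == v then part v else 0.
Proof.
rewrite mulr_sumr; case: eqP => [->|uv].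
  by apply: eq_bigr => i /eqP iv; rewrite mulrA vertex_edge iv eqxx.
apply: big1 => i /eqP iv; rewrite mulrA vertex_edge iv.
by case: eqP => // _; rewrite mul0r.
Qed.

Let part_vertex u v : part v * vx u = if v == u then part v else 0.
Proof.
rewrite mulr_suml; case: eqP => [<-|uv].
  by apply: eq_bigr => i /eqP iv; rewrite -mulrA ghost_vertex iv eqxx.
apply: big1 => i /eqP iv; rewrite -mulrA ghost_vertex iv.
by case: eqP => // _; rewrite mulr0.
Qed.

Let part_edge v i : part v * ed (F i) = if src G (F i) == v then ed (F i) else 0.
Proof.
rewrite mulr_suml; case: eqP => [iv|iv].
  rewrite (bigD1 i)/=; last exact/eqP.
  rewrite -mulrA ghost_edge edge_rng big1 ?addr0// => j /andP[_ /negPf ji].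
  by rewrite -mulrA ghost_edgeE (inj_eq F_inj) ji mulr0.
apply: big1 => j /eqP jv; rewrite -mulrA ghost_edgeE (inj_eq F_inj).
by case: eqP => [ji|_]; rewrite ?mulr0//; case: iv; rewrite -ji.
Qed.

Let ghost_part v i : gh (F i) * part v = if src G (F i) == v then gh (F i) else 0.
Proof.
rewrite mulr_sumr; case: eqP => [iv|iv].
  rewrite (bigD1 i)/=; last exact/eqP.
  rewrite mulrA ghost_edge rng_ghost big1 ?addr0// => j /andP[_ /negPf ji].
  by rewrite mulrA ghost_edgeE (inj_eq F_inj) eq_sym ji mul0r.
apply: big1 => j /eqP jv; rewrite mulrA ghost_edgeE (inj_eq F_inj).
by case: eqP => [ji|_]; rewrite ?mul0r//; case: iv; rewrite ji.
Qed.

Let partM u v : part u * part v = if u == v then part u else 0.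
Proof.
rewrite {2}/part mulr_sumr; under eq_bigr do rewrite mulrA part_edge.
case: eqP => [->|uv]; first by apply: eq_bigr => i ->.
by apply: big1 => i /eqP ->; case: eqP => [vu|_]; [case: uv|rewrite mul0r].
Qed.

Let om_true v : om (v, true) = part v. Proof. by []. Qed.
Let om_false v : om (v, false) = vx v - part v. Proof. by []. Qed.

Let omM u w : om u * om w = if u == w then om u else 0.
Proof.
case: u w => u [] [w []]; rewrite ?om_true ?om_false xpair_eqE ?andbT ?andbF;
  rewrite ?mulrBl ?mulrBr ?vertexM ?vertex_part ?part_vertex ?partM;
  by case: eqP => [->|_]; rewrite ?subrr ?subr0 ?oppr0 ?sub0r ?subrr ?oppr0.
Qed.

Let om_vertex v : om (v, true) + om (v, false) = vx v.
Proof. by rewrite addrC subrK. Qed.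

Let om_sum : \sum_w om w = 1.
Proof.
rewrite lpa_oneE -(pair_bigA _ (fun v c => om (v, c)))/=; apply: eq_bigr => v _.
by rewrite (bigD1 true)//= (big_pred1 false) ?om_vertex// => -[].
Qed.

Let om_edge w i : om w * ed (F i) = if w == (src G (F i), true) then ed (F i) else 0.
Proof.
case: w => v [] /=; rewrite /om/= ?mulrBl part_edge xpair_eqE ?andbT ?andbF eq_sym//.
by rewrite vertex_edge; case: eqP => _; rewrite ?subrr ?subr0.
Qed.

Let ghost_om w i : gh (F i) * om w = if w == (src G (F i), true) then gh (F i) else 0.
Proof.
case: w => v [] /=; rewrite /om/= ?mulrBr ghost_part xpair_eqE ?andbT ?andbF eq_sym//.
by rewrite ghost_vertex eq_sym; case: eqP => _; rewrite ?subrr ?subr0.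
Qed.

Let om_xe x : om (sr x) * xe x = xe x.
Proof. by rewrite mulrA om_edge eqxx. Qed.

Let xe_om x : xe x * om (rg x) = xe x.
Proof. by rewrite -mulrA omM eqxx. Qed.

Let xg_om x : xg x * om (sr x) = xg x.
Proof. by rewrite -mulrA ghost_om eqxx. Qed.

Let xg_xe x y : xg x * xe y = if x == y then om (rg x) else 0.
Proof.
rewrite /xg /xe -mulrA (mulrA (gh _)) ghost_edgeE (inj_eq F_inj).
case: x y => i c [j d] /=; rewrite xpair_eqE; case: eqP => [->|_] /=; last by rewrite mul0r mulr0.
have -> : vx (rng G (F j)) * om (rg (j, d)) = om (rg (j, d)).
  by rewrite -om_vertex mulrDl !omM /rg/= !xpair_eqE eqxx/=; case: d; rewrite ?addr0 ?add0r.
by rewrite omM /rg/= xpair_eqE eqxx.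
Qed.

Let om_reg (w : V * bool) : w.2 -> om w = \sum_(x | sr x == w) xe x * xg x.
Proof.
case: w => v [] //= _; rewrite om_true.
rewrite (eq_bigl (fun x : I * bool => (src G (F x.1) == v) && true)); last first.
  by move=> x; rewrite xpair_eqE.
rewrite -(pair_big (fun i => src G (F i) == v) xpredT (fun i c => xe (i, c) * xg (i, c)))/=.
apply: eq_bigr => i _; rewrite (bigD1 true)//= (big_pred1 false); last by case.
rewrite /xe /xg/= -!mulrA !(mulrA (om _)) !omM !eqxx -mulrDr -mulrDl om_vertex.
by rewrite rng_ghost.
Qed.

Let part_homogeneous v : homogeneous 0 (part v).
Proof.
apply: homogeneous_sum => i _; rewrite -(subrr 1).
by apply: homogeneousM; [exact: homogeneous_edge|exact: homogeneous_ghost].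
Qed.

Let om_homogeneous w : homogeneous 0 (om w).
Proof.
case: w => v []; first exact: part_homogeneous.
apply: homogeneousD; first exact: homogeneous_vertex.
exact/homogeneousN/part_homogeneous.
Qed.

Let ghost_homogeneous p : homogeneous (- (size p)%:Z) (ghost_elt xg p).
Proof.
elim: p => [|x p IH] /=; first exact: homogeneous1.
have -> : - (size p).+1%:Z = - (size p)%:Z + (0 + -1) by lia.
apply: homogeneousM => //; apply: homogeneousM; first exact: om_homogeneous.
exact: homogeneous_ghost.
Qed.

Let tau_ghost c u p : p <> [::] -> degree0 (lpa_scalar G c * (om u * ghost_elt xg p)) = 0.
Proof.
move=> p0; rewrite lpa_scalarE.
rewrite (@degree0_homogeneous _ _ _ _ (0 + - (size p)%:Z)).
  by case: p p0.
by apply: homogeneousZ; apply: homogeneousM; [exact: om_homogeneous|exact: ghost_homogeneous].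
Qed.

Let reg (w : V * bool) := w.2.
Let reg_sr x : reg (sr x). Proof. by []. Qed.
Let good := good_elt (lpa_scalar G) rg reg om xe.

Let om_degree0 w : degree0 (om w) = om w.
Proof. exact: degree0_homogeneous (om_homogeneous w). Qed.

Let good_om w : good (om w).
Proof. exact: good_elt_om omM w. Qed.

Let good_vertex v : good (vx v).
Proof. by rewrite -om_vertex; apply: good_elt_add; exact: good_om. Qed.

Let rng_om i : om (rg (i, true)) + om (rg (i, false)) = vx (rng G (F i)).
Proof. exact: om_vertex. Qed.

Let good_edge i : good (ed (F i)).
Proof.
rewrite -edge_rng -rng_om mulrDr.
apply: good_elt_add; first exact: (good_elt_xe _ _ omM om_xe xe_om (i, true)).
exact: (good_elt_xe _ _ omM om_xe xe_om (i, false)).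
Qed.

Let good_ghost i : good (gh (F i)).
Proof.
rewrite -rng_ghost -rng_om mulrDl.
apply: good_elt_add; first exact: (good_elt_xg _ omM om_xe xe_om xg_om xg_xe reg_sr (i, true)).
exact: (good_elt_xg _ omM om_xe xe_om xg_om xg_xe reg_sr (i, false)).
Qed.

Fixpoint term_edges (t : lpa_term K V Ed) : seq Ed :=
  match t with
  | LEdge e | LGhost e => [:: e]
  | LAdd s t | LMul s t => term_edges s ++ term_edges t
  | LOpp s | LScale _ s => term_edges s
  | LVertex _ | LZero => [::]
  end.

Let good_term t : (forall e, e \in term_edges t -> exists i, F i = e) -> good (lpa_pi G t).
Proof.
elim: t => [v|e|e||s IHs t IHt|s IH|a s IH|s IHs t IHt] /= h.
- exact: good_vertex.
- by have [|i <-] := h e; [exact: mem_head|exact: good_edge].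
- by have [|i <-] := h e; [exact: mem_head|exact: good_ghost].
- exact: good_elt0.
- rewrite lpa_addE; apply: good_elt_add; [apply: IHs|apply: IHt] => e et; apply: h;
  by rewrite mem_cat et ?orbT.
- rewrite lpa_oppE; exact: good_elt_opp (IH h).
- rewrite lpa_scaleE -lpa_scalarE; exact: good_elt_kappa (IH h).
- rewrite lpa_prodE; apply: (good_elt_mul (@lpa_scalarC _ _ _ G)); [apply: IHs|apply: IHt] => e et;
  by apply: h; rewrite mem_cat et ?orbT.
Qed.

(** [part v] is an orthogonal sum of idempotents [e e^*], each equivalent to the range [e^* e]. *)
Let vertex_part_class v : elt_class (part v) =
  \sum_(i | src G (F i) == v) elt_class (vx (rng G (F i))).
Proof.
have eM i j : ed (F i) * gh (F i) * (ed (F j) * gh (F j)) =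
    if i == j then ed (F i) * gh (F i) else 0.
  rewrite -mulrA (mulrA (gh _)) ghost_edgeE (inj_eq F_inj).
  by case: eqP => [->|_]; rewrite ?rng_ghost ?mul0r ?mulr0.
rewrite /part -big_filter elt_class_sum ?filter_uniq ?index_enum_uniq// big_filter.
apply: eq_bigr => i _; apply: (@elt_class_eqv _ (ed (F i)) (gh (F i))) => //.
- by rewrite eM eqxx.
- exact: vertexMid.
- exact: ghost_edge.
Qed.

Variable Q : K0 L -> Prop.
Hypotheses (Q0 : Q 0) (QB : forall x y, Q x -> Q y -> Q (x - y))
  (Qv : forall v, Q (elt_class (vx v))).

Let QD x y : Q x -> Q y -> Q (x + y).
Proof. by move=> hx hy; rewrite -[y]opprK -[- y]sub0r; exact: QB hx (QB Q0 hy). Qed.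

Let Q_sum (J : Type) (r : seq J) (P : pred J) f :
  (forall j, P j -> Q (f j)) -> Q (\sum_(j <- r | P j) f j).
Proof. by move=> h; apply: big_ind. Qed.

Let Q_om w : Q (elt_class (om w)).
Proof.
have Qpart v : Q (elt_class (part v)) by rewrite vertex_part_class; apply: Q_sum.
case: w => v []; [exact: Qpart|rewrite om_false].
have -> : elt_class (vx v - part v) = elt_class (vx v) - elt_class (part v).
  have := @elt_classD _ (om (v, true)) (om (v, false)).
  rewrite !omM !eqxx !xpair_eqE !andbF om_vertex => /(_ erefl erefl erefl erefl) ->.
  by rewrite om_true om_false addrAC subrr add0r.
exact: QB.
Qed.

(** [Q] stands for a subgroup containing the vertex classes. The idempotent is diagonalized over the
    nodes [om w], and a node class is a sum of vertex classes or a vertex class minus such a sum. *)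
Lemma idem_class_finite_edges (e : idem L) :
  (forall (i j : 'I_(idem_dim e)) f, f \in term_edges (lpa_repr (e i j)) -> exists k, F k = f) ->
  Q (idem_class e).
Proof.
move=> eF; have e_good (i j : 'I_(idem_dim e)) : good (e i j).
  by rewrite -[e i j]lpa_reprK; apply: good_term; exact: eF.
have [k [w [x [y [xy yx]]]]] := idem_free_nodes (@lpa_scalarC _ _ _ G) omM om_sum om_xe xe_om
  xg_om xg_xe om_reg reg_sr (@degree0_0 K V Ed G) (@degree0D K V Ed G) om_degree0 tau_ghost e_good
  (idem_mxP e).
rewrite (elt_class_row _ xy yx); last by move=> j; rewrite omM eqxx.
by apply: Q_sum => j _; exact: Q_om.
Qed.

End RelativeGraph.

(** The finite family [F] consists of the edges occurring in chosen representatives of the matrix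
    entries; equality on [Ed] is made decidable classically. *)
Lemma K0_lpa_ind (K : fieldType) (V : finType) (Ed : Type) (G : graph V Ed)
    (Q : K0 (lpa K G) -> Prop) : Q 0 -> (forall x y, Q x -> Q y -> Q (x - y)) ->
  (forall v, Q (elt_class (lpa_vertex K G v))) -> forall x, Q x.
Proof.
move=> Q0 QB Qv; elim/K0W => p; rewrite K0_pi_class.
pose eT : eqType := HB.pack Ed (gen_eqMixin Ed).
suff h (e : idem (lpa K G)) : Q (idem_class e) by apply: QB.
pose G' : graph V eT := G.
pose es := undup (flatten [seq term_edges (lpa_repr ((e : 'M_(idem_dim e)) k.1 k.2) : lpa_term K V eT)
  | k <- enum (('I_(idem_dim e) * 'I_(idem_dim e))%type : finType)]).
pose F := tnth (in_tuple es).
have F_inj : injective F by apply/tuple_uniqP; exact: undup_uniq.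
apply: (@idem_class_finite_edges K V eT G' _ F F_inj Q) => // i j f fij.
have fes : f \in es.
  rewrite mem_undup; apply/flatten_mapP; exists (i, j) => //; by rewrite mem_enum.
by have /tnthP[k fk] : f \in in_tuple es by []; exists k.
Qed.

(** * Minimality *)

(** The vertex classes add up to the class of [1], so when there are two of them, one is the
    opposite of the other. *)
Lemma cyclic_K0_lpa (K : fieldType) (V : finType) (Ed : Type) (G : graph V Ed) :
  (#|V| < 3)%N -> elt_class (1 : lpa K G) = 0 -> cyclic_zmod (K0 (lpa K G)).
Proof.
move=> V3 one0.
have sum0 : \sum_v elt_class (lpa_vertex K G v) = 0.
  by rewrite -[RHS]one0 lpa_oneE elt_class_sum ?index_enum_uniq// => v w; exact: vertexM.
suff [g gv] : exists g, forall v, exists m : int, elt_class (lpa_vertex K G v) = g *~ m.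
  exists g; apply: K0_lpa_ind => //; first by exists 0; rewrite mulr0z.
  by move=> x y [m ->] [k ->]; exists (m - k); rewrite mulrzBr.
have [v0|] := pickP V; last by move=> V0; exists 0 => v; have := V0 v.
exists (elt_class (lpa_vertex K G v0)) => v.
have [->|vv0] := eqVneq v v0; first by exists 1.
exists (-1); rewrite mulrNz mulr1z; apply/eqP; rewrite -addr_eq0 -sum0 addrC.
rewrite (bigD1 v0)//= (bigD1 v)//= big_pred0 ?addr0// => w.
apply/negP => /andP[wv0 wv].
have : (2 < #|V|)%N.
  rewrite (cardD1 v0) (cardD1 v) (cardD1 w) !inE.
  by rewrite vv0 wv wv0.
by rewrite ltnNge -ltnS V3.
Qed.

Section CycleUnit.
Variables (K : fieldType) (n : nat).
Local Notation L := (lpa K (Cn2 n)).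

Let sum_edge (h : 'I_n -> 'I_n + 'I_n) : L := \sum_i lpa_edge K (Cn2 n) (h i).
Let sum_ghost (h : 'I_n -> 'I_n + 'I_n) : L := \sum_i lpa_ghost K (Cn2 n) (h i).

Let rng_inj h : h = inl \/ h = inr -> injective (rng (Cn2 n) \o h).
Proof.
by have Sinj := bij_inj (@ordS_bij n); case=> -> i j /=; [move/Sinj|move/Sinj/Sinj].
Qed.

Let sum_edge_ghost h : h = inl \/ h = inr ->
  sum_edge h * sum_ghost h = \sum_i lpa_edge K (Cn2 n) (h i) * lpa_ghost K (Cn2 n) (h i).
Proof.
move=> hP; rewrite mulr_suml; apply: eq_bigr => i _.
rewrite mulr_sumr (bigD1 i)//= big1 ?addr0// => j ji.
by apply: edge_ghost; apply: contra ji => /eqP/esym/(rng_inj hP) ->.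
Qed.

Let sum_ghost_edge h : h = inl \/ h = inr -> sum_ghost h * sum_edge h = 1.
Proof.
move=> hP; have hI := rng_inj hP; rewrite lpa_oneE (reindex_inj hI)/= mulr_suml.
apply: eq_bigr => i _; rewrite mulr_sumr (bigD1 i)//= ghost_edge big1 ?addr0// => j ji.
rewrite ghost_edgeE; case: eqP => // hij.
by move: ji; rewrite (hI j i) ?eqxx//= hij.
Qed.

Let sum_ghost_edge0 h h' : (forall i j, h i != h' j) -> sum_ghost h * sum_edge h' = 0.
Proof.
move=> hh'; rewrite mulr_suml big1// => i _; rewrite mulr_sumr big1// => j _.
by rewrite ghost_edgeE (negPf (hh' i j)).
Qed.

(** Within each of the two families every vertex is the source of one edge and the range of one
    edge. So the sums [x] of the [e_i] and [y] of the [f_i] satisfy [x^* x = y^* y = 1],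
    [x^* y = y^* x = 0] and [x x^* + y y^* = 1]: the row [(x, y)] makes [1] equivalent to
    [1 + 1]. *)
Lemma Cn2_unit_class : elt_class (1 : L) = 0.
Proof.
have l : (@inl 'I_n 'I_n) = inl \/ (@inl 'I_n 'I_n) = inr by left.
have r : (@inr 'I_n 'I_n) = inl \/ (@inr 'I_n 'I_n) = inr by right.
have one : sum_edge inl * sum_ghost inl + sum_edge inr * sum_ghost inr = 1.
  rewrite !sum_edge_ghost// lpa_oneE -big_split/=; apply: eq_bigr => v _.
  rewrite lpa_CK2_fin; last by exists (inl v).
  by rewrite big_sumType/= !big_pred1_eq.
apply: (addrI (elt_class (1 : L))); rewrite addr0 (elt_classE (mulr1 1)) -idem_classD.
apply/esym/idem_class_eqv.
exists (row_mx (sum_edge inl)%:M (sum_edge inr)%:M),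
  (col_mx (sum_ghost inl)%:M (sum_ghost inr)%:M); split=> /=.
  by rewrite mul_row_col -!scalar_mxM -raddfD one.
by rewrite mul_col_row -!scalar_mxM !sum_ghost_edge// !sum_ghost_edge0// !raddf0.
Qed.

End CycleUnit.

Lemma Cn2_iso_cyclic (K : fieldType) (n : nat) (V : finType) (Ed : Type) (G : graph V Ed) :
  (#|V| < 3)%N -> lpa_iso K (Cn2 n) G -> cyclic_zmod (K0 (lpa K (Cn2 n))).
Proof.
move=> V3 [f [[g fK gK] fM]].
have gA : additive g by move=> x y; apply: (can_inj fK); rewrite raddfB/= !gK.
pose ga : {additive lpa K G -> lpa K (Cn2 n)} :=
  HB.pack g (GRing.isZmodMorphism.Build _ _ g gA).
have gM a b : ga (a * b) = ga a * ga b by apply: (can_inj fK); rewrite [RHS]fM/= !gK.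
have fM' x y : f (x * y) = f x * f y := fM x y.
(* [lpa_iso] does not mention units; surjectivity and multiplicativity give this. *)
have f1 : f 1 = 1 by rewrite -[RHS](gK 1) -[in RHS](mul1r (g 1)) fM' gK mulr1.
apply: (@cyclic_K0_iso _ _ f ga fM gM fK); apply: cyclic_K0_lpa V3 _.
rewrite -f1 -(K0_map_elt_class (f := f) fM (mulr1 1)) Cn2_unit_class.
by apply: (addrI (K0_map (f := f) fM 0)); rewrite -K0_mapD !addr0.
Qed.

Theorem proposition4p14 (K : fieldType) (n : nat) (n_gt0 : (0 < n)%N) :
  lpa_iso K (Cn2 n) (E_graph n) /\
  (~ cyclic_zmod (K0 (lpa K (Cn2 n))) ->
   forall (V : finType) (Ed : Type) (G : graph V Ed),
     (#|V| < 3)%N -> ~ lpa_iso K (Cn2 n) G).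
Proof.
split; first exact: Cn2_E_graph n_gt0 (H2E n_gt0).
by move=> ncyc V Ed G V3 iso; apply: ncyc; exact: Cn2_iso_cyclic V3 iso.
Qed.
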